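(* Let $m\ge1$ be an integer. (a) For every integer $p>0$, $$\mathrm{ch}(z,q,V_{(m)}(p))=z^{\deg_zv_p}\sum_{k\ge0}z^{k\sqrt{2m}}\,q^{\deg_qv_{p-2km}}\binom{p-(m-1)(k-1)}{k}_q.$$ (b) Let $F_n^{(m)}$ be the natural numbers defined by $F_i^{(m)}=i+1$ for $i=0,1,\ldots,m-1$ and $F_{i+m}^{(m)}=F_{i+m-1}^{(m)}+F_i^{(m)}$ for $i\ge0$. Then for every $p\in\mathbb Z$ and every integer $n\ge0$, $\dim V_{(m),p}(n)=F_n^{(m)}$.
   Context: Fix an integer $m\ge 1$. Let $H$ be the Heisenberg Lie algebra with basis $h_i$, $i\in\mathbb Z$, $[h_i,h_j]=i\,\delta_{i+j,0}$ (the central element acts as $1$). For a scalar $\lambda$ let $H_\lambda$ be the highest weight (Fock) representation with highest weight vector $|\lambda\rangle$: $h_i|\lambda\rangle=0$ for $i>0$, $h_0|\lambda\rangle=\lambda|\lambda\rangle$, and $H_\lambda=\mathbb C[h_{-1},h_{-2},\ldots]|\lambda\rangle$ is free over $\mathbb C[h_{-1},h_{-2},\ldots]$. For $0\le i\le 2m-1$ put $L_{(m),i}=\bigoplus_{n\in\mathbb Z}H_{(2nm+i)/\sqrt{2m}}$. On $\bigoplus_i L_{(m),i}$ the bosonic vertex operator is $$\phi_{\sqrt{2m}}(z)=\exp\Big(\sqrt{2m}\sum_{n>0}\tfrac{h_{-n}}{n}z^n\Big)\exp\Big(-\sqrt{2m}\sum_{n>0}\tfrac{h_{n}}{n}z^{-n}\Big)\,T\,z^{\sqrt{2m}\,h_0}=\sum_{n\in\mathbb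 Z}a_nz^{-n-1},$$ where $T$ commutes with all $h_i$, $i\ne0$, and $T|\lambda\rangle=|\lambda+\sqrt{2m}\rangle$. The operators $a_n$ pairwise commute. Put $v_p=\left|\frac{-p}{\sqrt{2m}}\right\rangle$ for $p\in\mathbb Z$; then $a_iv_p=0$ for $i\ge p$. The Virasoro operator $L_0$ is $L_0=\frac12\sum_{i+j=0}:h_ih_j:-\frac{m-1}{\sqrt{2m}}h_0$, where $:\ :$ is normal ordering. For a subspace $V$ stable under $h_0$ and $L_0$, $\mathrm{ch}(z,q,V)=\mathrm{Tr}(z^{h_0}q^{L_0}|_V)$. For a joint eigenvector $v$, $\deg_zv$ and $\deg_qv$ are the eigenvalues of $h_0$ and $L_0$; in particular $\deg_zv_p=\frac{-p}{\sqrt{2m}}$ and $\deg_qv_p=\frac{p^2}{4m}+\frac{p(m-1)}{2m}$. For $p\in\mathbb Z$, $n\ge 0$: $V_{(m),p}(n)=\mathbb C[a_{p-1},a_{p-2},\ldots,a_{p-n}]\cdot v_p$. For $p>0$: $V_{(m)}(p)=V_{(m),p}(p)=\mathbb C[a_{p-1},\ldots,a_0]\cdot v_p$. $\binom{a}{k}_q=\prod_{j=1}^k\frac{1-q^{a-k+j}}{1-q^j}$ is the Gaussian binomial coefficient for $a\ge k\ge0$, and it is understood to be $0$ when $a<k$ (including $a<0$) with $k\ge1$. *)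

(* Defs.v *)
From HB Require Import structures.
From mathcomp Require Import all_boot all_order all_algebra.
From mathcomp Require Import finmap multiset.
From mathcomp Require Import monalg.
From mathcomp Require Import boolp classical_sets cardinality fsbigop reals.
From mathcomp Require Import complex ring zify.

Set Implicit Arguments.
Unset Strict Implicit.
Unset Printing Implicit Defensive.

Import Order.TTheory GRing.Theory Num.Theory.
Local Open Scope classical_set_scope.
Local Open Scope ring_scope.

Section LinearAlgebra.
Context (K : fieldType) (E : lmodType K).

Definition lspan (S : set E) : set E :=
  [set v | exists n (c : 'I_n -> K) (w : 'I_n -> E),
     (forall i, S (w i)) /\ v = \sum_i c i *: w i].

(* Only meaningful when [V] is a linear subspace. *)
Definition has_dim (V : set E) (d : nat) : Prop :=
  exists b : 'I_d -> E,
    [/\ forall i, V (b i),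
        forall c : 'I_d -> K, \sum_i c i *: b i = 0 -> forall i, c i = 0
      & forall v, V v -> exists c : 'I_d -> K, v = \sum_i c i *: b i].

Definition stable (f : E -> E) (V : set E) : Prop := forall v, V v -> V (f v).

(* Coefficients of exp (\sum_(n > 0) X_n z^n) = \sum_j (\sum_n X_n z^n)^j / j!
   for a family of operators [X]; [pow_coef X j k] is the coefficient of z^k
   in the j-th power, which vanishes for j > k since there is no constant
   term. *)
Fixpoint pow_coef (X : nat -> E -> E) (j k : nat) (v : E) : E :=
  if j is j'.+1 then \sum_(1 <= i < k.+1) X i (pow_coef X j' (k - i) v)
  else if k == 0%N then v else 0.

Definition exp_coef (X : nat -> E -> E) (k : nat) (v : E) : E :=
  \sum_(j < k.+1) (j`!)%:R^-1 *: pow_coef X j k v.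

End LinearAlgebra.

Section Fock.
Context (C : numClosedFieldType) (m : nat).

Definition alpha : C := sqrtC (2 * m)%:R.

(* The sum of the spaces L_(m),i, 0 <= i < 2m, is the sum over p in Z of the
   Fock spaces of highest weight - p / sqrt (2m).  The basis vector (p, A)
   stands for (\prod_(n in A) h_(-(n+1))) v_p, so that the index n : nat
   encodes the creation operator h_(-(n+1)). *)
Definition fock_index : choiceType := (int * {mset nat}%mset)%type.
Definition fock := {malg C[fock_index]}.
Definition ket (p : int) (A : {mset nat}%mset) : fock := << ((p, A) : fock_index) >>.
Definition vac (p : int) : fock := ket p mset0.

Definition lin_ext (f : fock_index -> fock) (v : fock) : fock :=
  \sum_(b <- msupp v) v@_b *: f b.

Definition degz (p : int) : C := - p%:~R / alpha.

Definition heis_ket (i : int) (b : fock_index) : fock :=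
  match i with
  | Negz n => ket b.1 (n +` b.2)%mset
  | Posz 0 => degz b.1 *: ket b.1 b.2
  | Posz n.+1 => (n.+1 * b.2 n)%:R *: ket b.1 (b.2 `\ n)%mset
  end.
Definition heis (i : int) : fock -> fock := lin_ext (heis_ket i).

(* T |lambda> = |lambda + sqrt (2m)>, that is, T v_p = v_(p - 2m). *)
Definition shiftT : fock -> fock :=
  lin_ext (fun b => ket (b.1 - (2 * m)%:Z) b.2).

(* Coefficient of z^e in the operator z^(sqrt (2m) h_0). *)
Definition zh0_coef (e : int) : fock -> fock :=
  lin_ext (fun b => if alpha * degz b.1 == e%:~R then ket b.1 b.2 else 0).

(* Coefficient of z^k in exp (sqrt (2m) \sum_(n > 0) h_(-n) / n z^n). *)
Definition expm_coef : nat -> fock -> fock :=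
  exp_coef (fun n v => (alpha / n%:R) *: heis (- n%:Z) v).

(* Coefficient of z^(-l) in exp (- sqrt (2m) \sum_(n > 0) h_n / n z^(-n)). *)
Definition expp_coef : nat -> fock -> fock :=
  exp_coef (fun n v => (- (alpha / n%:R)) *: heis n%:Z v).

(* Coefficient of z^(-n-1) in the vertex operator; applied to a given vector
   the sum over (k, l, e) has finitely many nonzero terms. *)
Definition amode (n : int) (v : fock) : fock :=
  \sum_(t \in [set t : nat * nat * int |
                 t.1.1%:Z - t.1.2%:Z + t.2 = - n - 1])
     expm_coef t.1.1 (expp_coef t.1.2 (shiftT (zh0_coef t.2 v))).

Definition nord (i j : int) (v : fock) : fock :=
  if i <= j then heis i (heis j v) else heis j (heis i v).

Definition L0 (v : fock) : fock :=
  2%:R^-1 *: (\sum_(t \in [set t : int * int | t.1 + t.2 = 0]) nord t.1 t.2 v)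
  - ((m%:R - 1) / alpha) *: heis 0 v.

Definition degq (p : int) : C :=
  p%:~R ^+ 2 / (4 * m)%:R + p%:~R * (m%:R - 1) / (2 * m)%:R.

Definition Vsub (p : int) (n : nat) : set fock :=
  lspan [set v | exists s : seq int,
           all (fun i => p - n%:Z <= i <= p - 1) s /\ v = foldr amode (vac p) s].

Definition joint_eigenspace (V : set fock) (x y : C) : set fock :=
  [set v | [/\ V v, heis 0 v = x *: v & L0 v = y *: v]].

(* Formal series in z, q are represented by their coefficients:
   f x y is the coefficient of z^x q^y. *)
Definition zqseries := C -> C -> C.

(* [has_char V f]: V is stable under h_0 and L_0, which are simultaneously
   diagonalizable on V with finite-dimensional joint eigenspaces, and
   Tr (z^(h_0) q^(L_0) | V) = f. *)
Definition has_char (V : set fock) (f : zqseries) : Prop :=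
  [/\ stable (heis 0) V, stable L0 V,
      V `<=` lspan [set v | exists x y, joint_eigenspace V x y v]
    & forall x y, exists2 d, has_dim (joint_eigenspace V x y) d & f x y = d%:R].

(* Multiplication of a series by z^x q^y. *)
Definition zqshift (x y : C) (f : zqseries) : zqseries :=
  fun x' y' => f (x' - x) (y' - y).

(* P(q) as a series in z, q. *)
Definition qseries (P : {poly C}) : zqseries :=
  fun x y => \sum_(j < size P) P`_j * ((x == 0) && (y == j%:R))%:R.

(* The division is exact, see [gbinomE]. *)
Definition gbinom (a : int) (k : nat) : {poly C} :=
  if (a < k%:Z) && (0 < k)%N then 0
  else (\prod_(1 <= j < k.+1) (1 - 'X^(absz (a - k%:Z + j%:Z)%R)))
         %/ (\prod_(1 <= j < k.+1) (1 - 'X^j)).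

Lemma lin_ext_sum (f : fock_index -> fock) (v : fock) (D : {fset fock_index}) :
  (msupp v `<=` D)%fset -> lin_ext f v = \sum_(b <- D) v@_b *: f b.
Proof.
move=> vD; rewrite /lin_ext; apply: big_fset_incl => // b _ bv.
by rewrite mcoeff_outdom // scale0r.
Qed.

Lemma lin_ext_is_linear (f : fock_index -> fock) : linear (lin_ext f).
Proof.
move=> c u v; pose D := (msupp (c *: u + v) `|` (msupp u `|` msupp v))%fset.
have uD : (msupp u `<=` D)%fset by rewrite /D fsetUCA fsubsetUl.
have vD : (msupp v `<=` D)%fset by rewrite /D fsetUA fsubsetUr.
rewrite (lin_ext_sum _ uD) (lin_ext_sum _ vD) (@lin_ext_sum f _ D) ?fsubsetUl //.
rewrite scaler_sumr -big_split /=; apply: eq_bigr => b _.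
by rewrite mcoeffD mcoeffZ scalerDl scalerA.
Qed.

HB.instance Definition _ (f : fock_index -> fock) :=
  GRing.isLinear.Build C fock fock _ (lin_ext f) (lin_ext_is_linear f).

Lemma lin_ext_ket (f : fock_index -> fock) (p : int) (A : {mset nat}%mset) :
  lin_ext f (ket p A) = f (p, A).
Proof. by rewrite (lin_ext_sum _ msuppU_le) big_seq_fset1 mcoeffUU scale1r. Qed.

Lemma linear_ket_ext (f g : {linear fock -> fock}) :
  (forall p A, f (ket p A) = g (ket p A)) -> f =1 g.
Proof.
move=> fg v; rewrite [v]monalgE !linear_sum; apply: eq_bigr => -[p A] _ /=.
suff -> : << v@_(p, A) *g ((p, A) : fock_index) >> = v@_(p, A) *: ket p A.
  by rewrite !linearZ fg.
by apply/malgP => b; rewrite mcoeffZ !mcoeffU mulr_natr.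
Qed.

HB.instance Definition _ (i : int) := GRing.Linear.on (heis i).

Lemma heis_create (n : nat) p A :
  heis (Negz n) (ket p A) = ket p (n +` A)%mset.
Proof. exact: lin_ext_ket. Qed.

Lemma heis_weight p A : heis 0 (ket p A) = degz p *: ket p A.
Proof. exact: lin_ext_ket. Qed.

Lemma heis_annihil (n : nat) p A :
  heis n.+1 (ket p A) = (n.+1 * A n)%:R *: ket p (A `\ n)%mset.
Proof. exact: lin_ext_ket. Qed.

Let heisZ i c v : heis i (c *: v) = c *: heis i v.
Proof. exact: linearZ. Qed.

Let heis_comm_pos_neg n k p A :
  heis n.+1 (heis (Negz k) (ket p A)) - heis (Negz k) (heis n.+1 (ket p A))
  = (n.+1%:R *+ (n == k)) *: ket p A.
Proof.
rewrite !(heis_create, heis_annihil, heisZ) mset1DE.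
have [->|nk] := eqVneq n k.
  have -> : ((k +` A) `\ k = A)%mset.
    by apply/msetP => c; rewrite msetB1E mset1DE addKn.
  have -> : (k.+1 * A k)%:R *: ket p (k +` (A `\ k))%mset
          = (k.+1 * A k)%:R *: ket p A.
    have [->|Ak] := posnP (A k); first by rewrite muln0 !scale0r.
    congr (_ *: ket p _); apply/msetP => c; rewrite mset1DE msetB1E.
    by case: eqP => [->|_]; rewrite ?subnKC ?subn0.
  by rewrite -scalerBl mulnDr natrD addrK muln1.
have -> : ((k +` A) `\ n = k +` (A `\ n))%mset.
  apply/msetP => c; rewrite !(msetB1E, mset1DE).
  by case: (eqVneq c n) => [->|_]; rewrite ?subn0 // (negbTE nk).
by rewrite add0n subrr scale0r.
Qed.

Let heis_comm_ket i j p A :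
  heis i (heis j (ket p A)) - heis j (heis i (ket p A))
  = (i%:~R *+ (i + j == 0)) *: ket p A.
Proof.
pose hE := (heis_create, heis_weight, heis_annihil, heisZ).
case: i j => [[|n]|n] [[|k]|k].
- by rewrite subrr mulr0z mul0rn scale0r.
- by rewrite !hE !scalerA mulrC subrr scale0r.
- by rewrite !hE subrr scale0r.
- by rewrite !hE !scalerA mulrC subrr scale0r.
- rewrite !hE !scalerA -!natrM !msetB1E eq_sym.
  have -> : (A `\ k `\ n = A `\ n `\ k)%mset.
    by apply/msetP => c; rewrite !msetB1E subnAC.
  rewrite -scalerBl scale0r; case: eqVneq => [->|_]; first by rewrite subrr scale0r.
  by rewrite !subn0 mulnC subrr scale0r.
- rewrite heis_comm_pos_neg; congr ((_ *+ _) *: _).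
  by rewrite NegzE subr_eq0.
- by rewrite !hE subrr scale0r.
- rewrite -opprB heis_comm_pos_neg -scaleNr NegzE addrC subr_eq0 eqz_nat eqSS.
  by case: eqVneq => [->|_]; rewrite ?mulr0n ?oppr0 // mulr1n mulrNz.
- rewrite !hE; have -> : (n +` (k +` A) = k +` (n +` A))%mset.
    by apply/msetP => c; rewrite !mset1DE addnCA.
  by rewrite subrr scale0r.
Qed.

Let heis_gt0_vac i p : 0 < i -> heis i (vac p) = 0.
Proof.
by case: i => [[|n]|n] // _; rewrite heis_annihil mset0E muln0 scale0r.
Qed.

Lemma heis_comm (i j : int) (v : fock) :
  heis i (heis j v) - heis j (heis i v) = (i%:~R *+ (i + j == 0)) *: v.
Proof.
pose f : {linear fock -> fock} := (heis i \o heis j) \- (heis j \o heis i).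
pose g : {linear fock -> fock} := *:%R (i%:~R *+ (i + j == 0) : C).
by apply: (@linear_ket_ext f g) => p A; exact: heis_comm_ket.
Qed.

Let expp_coef_vac l p :
  expp_coef l (vac p) = if l == 0%N then vac p else 0.
Proof.
transitivity (vac p *+ (l == 0%N)); last by case: (l == 0%N).
have X0 i v : (0 < i)%N -> v = vac p \/ v = 0 ->
    (- (alpha / i%:R)) *: heis i%:Z v = 0.
  move=> i0 [] ->; first by rewrite heis_gt0_vac ?scaler0.
  by rewrite linear0 scaler0.
have pow0 j k : pow_coef (fun n v => (- (alpha / n%:R)) *: heis n%:Z v) j k (vac p)
    = vac p *+ ((j == 0%N) && (k == 0%N)).
  elim: j k => [|j IHj] k /=; first by case: eqP.
  rewrite big_nat_cond big1 // => i /andP[/andP[i0 _] _].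
  by rewrite X0 // IHj; case: (_ && _); [left | right].
rewrite /expp_coef /exp_coef (eq_bigr (fun j : 'I_l.+1 =>
  (j`!)%:R^-1 *: (vac p *+ ((j == 0%N :> nat) && (l == 0%N))))); last first.
  by move=> j _; congr (_ *: _); exact: pow0.
rewrite big_ord_recl /= invr1 scale1r.
by rewrite big1 ?addr0 // => i _; rewrite mulr0n scaler0.
Qed.

Let expm_coef0 k : expm_coef k 0 = 0.
Proof.
rewrite /expm_coef /exp_coef big1 // => -[j _] _ /=.
suff -> : pow_coef (fun n v => (alpha / n%:R) *: heis (- n%:Z) v) j k 0 = 0.
  by rewrite scaler0.
elim: j k => [|j IHj] k /=; first by case: ifP.
by rewrite big1 // => i _; rewrite IHj linear0 scaler0.
Qed.

Let expp_coef0 k : expp_coef k 0 = 0.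
Proof.
rewrite /expp_coef /exp_coef big1 // => -[j _] _ /=.
suff -> : pow_coef (fun n v => (- (alpha / n%:R)) *: heis n%:Z v) j k 0 = 0.
  by rewrite scaler0.
elim: j k => [|j IHj] k /=; first by case: ifP.
by rewrite big1 // => i _; rewrite IHj linear0 scaler0.
Qed.

Let zh0_coef_vac e p : (0 < m)%N ->
  zh0_coef e (vac p) = if e == - p then vac p else 0.
Proof.
move=> m_gt0; have alpha0 : alpha != 0.
  by rewrite /alpha sqrtC_eq0 pnatr_eq0 muln_eq0 -lt0n.
rewrite [LHS]lin_ext_ket /degz mulrC divfK // -rmorphN /= eqr_int.
by rewrite eq_sym.
Qed.

Let shiftT_vac p : shiftT (vac p) = vac (p - (2 * m)%:Z).
Proof. exact: lin_ext_ket. Qed.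

Let shiftT0 : shiftT 0 = 0.
Proof. exact: linear0. Qed.

Lemma amode_vac (n p : int) : (0 < m)%N ->
  amode n (vac p) =
    if n < p then expm_coef (absz (p - n - 1)%R) (vac (p - (2 * m)%:Z)) else 0.
Proof.
move=> m_gt0.
have termE (t : nat * nat * int) :
    expm_coef t.1.1 (expp_coef t.1.2 (shiftT (zh0_coef t.2 (vac p))))
    = if (t.1.2 == 0%N) && (t.2 == - p)
      then expm_coef t.1.1 (vac (p - (2 * m)%:Z)) else 0.
  rewrite (zh0_coef_vac _ _ m_gt0) (fun_if shiftT) shiftT_vac shiftT0.
  rewrite (fun_if (expp_coef _)) expp_coef_vac expp_coef0.
  rewrite !(fun_if (expm_coef _)) !expm_coef0.
  move: (expm_coef _ _) => w; move: (t.1.2 == 0%N) (t.2 == - p).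
  by move=> [] [].
rewrite /amode; under eq_fsbigr do rewrite termE.
move: (vac (p - _)) expm_coef {termE} => w W.
case: ifPn => np; last first.
  rewrite fsbig1 // => -[[k l] e] /= kle; case: ifP => // /andP[/eqP l0 /eqP e0].
  by move: kle np; rewrite l0 e0; lia.
rewrite (fsbigE [:: (absz (p - n - 1)%R, 0%N, - p)]) //=; first last.
- move=> [[k l] e] /= kle; rewrite inE !xpair_eqE; case: ifP => //.
  move=> /andP[/eqP l0 /eqP e0]; rewrite l0 e0 !eqxx !andbT => /eqP[].
  by move: kle; rewrite l0 e0; lia.
- by move=> t /=; rewrite inE => /eqP -> /=; lia.
by rewrite big_mkcond big_seq1 ifT ?eqxx // inE /=; lia.
Qed.

Lemma L0_vac (p : int) : (0 < m)%N -> L0 (vac p) = degq p *: vac p.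
Proof.
move=> m_gt0; rewrite /L0 (fsbigE [:: (0, 0)]) //=; first last.
- move=> [i j] /= ij0; rewrite inE /nord.
  have {ij0} -> : j = - i by apply/eqP; rewrite -subr_eq0 opprK addrC ij0.
  case: (ltgtP i 0) => [i_lt0|i_gt0|->]; last by rewrite oppr0 eqxx.
  + rewrite (le_trans (ltW i_lt0)) ?oppr_ge0 ?(ltW i_lt0) //.
    by rewrite [heis (- i) _]heis_gt0_vac ?oppr_gt0 // linear0.
  + rewrite leNgt (lt_trans _ i_gt0) ?oppr_lt0 //=.
    by rewrite heis_gt0_vac // linear0.
- by move=> t /=; rewrite inE => /eqP ->.
rewrite big_mkcond big_seq1 ifT; last by rewrite inE /= addr0.
rewrite /nord lexx /= !(heis_weight, heisZ) !scalerA -scalerBl.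
congr (_ *: _); rewrite /degz /degq.
have alpha2 : alpha ^+ 2 = (2 * m)%:R by rewrite /alpha sqrtCK.
have alpha0 : alpha != 0 by rewrite /alpha sqrtC_eq0 pnatr_eq0 muln_eq0 -lt0n.
have -> : (4 * m)%:R = 2 * alpha ^+ 2 :> C by rewrite alpha2 -natrM mulnA.
by rewrite -alpha2; field.
Qed.

Let gnum (d k : nat) : {poly C} := \prod_(1 <= j < k.+1) (1 - 'X^(d + j)).
Let gden (k : nat) : {poly C} := \prod_(1 <= j < k.+1) (1 - 'X^j).

Let gnumS d k : gnum d.+1 k.+1
  = gnum d.+1 k * (1 - 'X^(k.+1)) + 'X^(k.+1) * gnum d k.+1.
Proof.
have -> : gnum d k.+1 = (1 - 'X^(d.+1)) * gnum d.+1 k.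
  rewrite /gnum big_ltn // addn1 big_add1 /=; congr (_ * _).
  by apply: eq_bigr => i _; rewrite addnS addSn.
rewrite [gnum _ k.+1]/gnum big_nat_recr //= -/(gnum d.+1 k) exprD.
rewrite mulrA [X in _ = _ + X]mulrC -mulrDr; congr (_ * _).
by rewrite mulrBr mulr1 addrA subrK mulrC.
Qed.

Let gden_dvd d k : gden k %| gnum d k.
Proof.
elim: k d => [|k IHk] d; first by rewrite /gden big_nil dvd1p.
elim: d => [|d IHd]; first by rewrite /gnum dvdpp.
rewrite gnumS; apply: dvdp_add; last exact: dvdp_mull.
by rewrite /gden big_nat_recr //=; apply: dvdp_mul (IHk _) (dvdpp _).
Qed.

Lemma gbinomE (d k : nat) :
  gbinom (d + k)%:Z k * \prod_(1 <= j < k.+1) (1 - 'X^j)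
  = \prod_(1 <= j < k.+1) (1 - 'X^(d + j)).
Proof.
rewrite /gbinom ltNge lez_nat leq_addl /=.
rewrite (eq_bigr (fun j : nat => 1 - 'X^(d + j) : {poly C})); last first.
  by move=> j _; rewrite PoszD addrK -PoszD.
by rewrite divpK // gden_dvd.
Qed.

End Fock.

Arguments Vsub C m p n : clear implicits.

(* Main.v *)
(* By the vertex operator calculus, a word a_(p-1-j_1) ... a_(p-1-j_k) v_p is the
   value at j of \prod_(i < l) (S_i - S_l)^(2m) applied to the function
   j |-> g_(j_1) ... g_(j_k) v_(p-2km), where S_i lowers j_i by one and the g_r
   are the coefficients of exp (sqrt (2m) \sum_(n > 0) h_(-n) / n z^n).  The
   words of length k with all j_i in [0, n) span the part of charge p - 2km of
   V_(m),p(n); put M = n - m (k - 1).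

   Upper bound: these words are annihilated by the coefficients of degree at
   least M of exp (sqrt (2m) / 2 \sum_(n > 0) h_n / n z^n), which are adjoint to
   the g_r for a positive definite form.  Hence their span meets trivially that
   of the products of g's having a factor g_r with r >= M, so that its dimension
   is at most the number of partitions s with k parts (possibly zero) smaller
   than M.

   Lower bound: the words with exponents s + m (k - 1), for s such a partition,
   are independent, because up to a shift (S_i - S_l)^(2m) is the product of
   (S_i - S_l)^m and its adjoint: pairing a vanishing symmetrized combination
   with its own coefficients yields a vanishing sum of squares.

   Counting these partitions by size gives the Gaussian binomials, and summing
   their numbers over k gives the recursion of F^(m). *)
Require Import Defs.
From HB Require Import structures.
From mathcomp Require Import all_boot all_order all_algebra all_fingroup.
From mathcomp Require Import finmap multiset monalg.
From mathcomp Require Import boolp classical_sets fsbigop reals complex ring zify.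

Set Implicit Arguments.
Unset Strict Implicit.
Unset Printing Implicit Defensive.

Import Order.TTheory GRing.Theory Num.Theory.
Local Open Scope classical_set_scope.
Local Open Scope ring_scope.

(** * Linear spans and dimension *)

Section Span.
Context (K : fieldType) (E : lmodType K).
Implicit Types (V S : set E) (u v : E).

(** The form is the usual Fock form with the contribution of every mode halved, and the half is
    essential. The adjoint of g_r is then built with alpha / 2, and alpha / 2 times alpha is m, so
    carrying it through the g's produces one factor (1 - y_i)^(-m) per exponent. The 2m differences
    attached to a pair {i, l} compensate exactly the exponents -m at its two ends; the unscaled form
    would give -2m at each end, which they could not compensate. The same m returns in the lower
    bound. Splitting (S_i - S_l)^(2m) into an operator and its adjoint costs the shift (S_i S_l)^m,
    and each index lies in k - 1 pairs, so all exponents move up by m (k - 1). The entries s_i + m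
    (k - 1) are below n exactly when s_i < M. This is why both bounds are indexed by the same
    partitions and no dimension has to be known in advance. Products of g's are independent only up
    to permuting their exponents, hence the symmetrization; it is compatible with the words because
    the exponent 2m is even. *)

Definition subsp V := V 0 /\ forall (a : K) u v, V u -> V v -> V (a *: u + v).

Lemma subsp_add V u v : subsp V -> V u -> V v -> V (u + v).
Proof. by case=> _ h hu hv; rewrite -[u]scale1r; apply: h. Qed.

Lemma subsp_scale V a u : subsp V -> V u -> V (a *: u).
Proof. by case=> h0 h hu; rewrite -[_ *: _]addr0; apply: h. Qed.

Lemma subsp_sub V u v : subsp V -> V u -> V v -> V (u - v).
Proof.
by move=> sV hu hv; rewrite -scaleN1r; apply: subsp_add => //; apply: subsp_scale.
Qed.

Lemma subsp_sum V (I : eqType) (r : seq I) (P : pred I) (F : I -> E) : subsp V ->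
  (forall i, i \in r -> P i -> V (F i)) -> V (\sum_(i <- r | P i) F i).
Proof.
move=> sV hF; rewrite big_seq_cond; elim/big_ind : _ => //.
- by case: sV.
- by move=> x y; exact: subsp_add.
- by move=> i /andP[ri Pi]; exact: hF.
Qed.

Lemma lspan_subsp S : subsp (lspan S).
Proof.
split=> [|a u v [n1 [c1 [w1 [h1 ->]]]] [n2 [c2 [w2 [h2 ->]]]]].
  by exists 0%N, (fun=> 0), (fun=> 0); split=> [[]//|]; rewrite big_ord0.
exists (n1 + n2)%N,
  (fun i => match split i with inl j => a * c1 j | inr j => c2 j end),
  (fun i => match split i with inl j => w1 j | inr j => w2 j end); split.
  by move=> i; case: (split i).
rewrite big_split_ord /= scaler_sumr; congr (_ + _); apply: eq_bigr => i _.
  by rewrite (unsplitK (inl _ i)) scalerA.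
by rewrite (unsplitK (inr _ i)).
Qed.

Lemma lspan0 S : lspan S 0.
Proof. by have [] := lspan_subsp S. Qed.

Lemma lspan_incl S v : S v -> lspan S v.
Proof.
move=> Sv; exists 1%N, (fun=> 1), (fun=> v); split=> //.
by rewrite big_ord_recl big_ord0 addr0 scale1r.
Qed.

Lemma lspan_min S V : subsp V -> (forall v, S v -> V v) -> forall v, lspan S v -> V v.
Proof.
move=> sV SV _ [n [c [w [hw ->]]]]; apply: subsp_sum => // i _ _.
by apply: subsp_scale => //; apply: SV.
Qed.

Lemma lspan_mono S S' v : (forall u, S u -> S' u) -> lspan S v -> lspan S' v.
Proof.
by move=> SS'; apply: lspan_min (lspan_subsp _) _ _ => u /SS'; apply: lspan_incl.
Qed.

(** That this set is a subspace lets coverage modulo [N] be checked on generators, through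
    [lspan_min]. *)
Lemma subsp_mod (T : eqType) (B : seq T) (N : set E) (e : T -> E) : subsp N ->
  subsp [set v | exists a : T -> K, N (v - \sum_(b <- B) a b *: e b)].
Proof.
move=> sN; split=> [|a u v [b hb] [c hc]].
  exists (fun=> 0); rewrite big1 ?subr0; first by case: sN.
  by move=> i _; rewrite scale0r.
exists (fun x => a * b x + c x).
rewrite (eq_bigr (fun x => a *: (b x *: e x) + c x *: e x)); last first.
  by move=> x _; rewrite scalerDl scalerA.
rewrite big_split /= -scaler_sumr opprD addrACA -scalerBr.
by case: sN => _; apply.
Qed.

Lemma mod_mem (T : eqType) (B : seq T) (N : set E) (e : T -> E) b : uniq B -> subsp N ->
  b \in B -> exists a : T -> K, N (e b - \sum_(x <- B) a x *: e x).
Proof.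
move=> uB [N0 _] bB; exists (fun x => (x == b)%:R).
rewrite (bigD1_seq b) //= eqxx scale1r big1 ?addr0 ?subrr // => x /negbTE ->.
by rewrite scale0r.
Qed.

Lemma has_dim_ext V V' d : (forall v, V v <-> V' v) -> has_dim V d -> has_dim V' d.
Proof.
move=> VV' [b [h1 h2 h3]]; exists b; split=> //.
- by move=> i; apply/VV'.
- by move=> v /VV'; apply: h3.
Qed.

Lemma has_dim0 V : (forall v, V v <-> v = 0) -> has_dim V 0.
Proof.
move=> h; exists (fun=> 0); split=> [[]//|c _ []//|v /h ->].
by exists (fun=> 0); rewrite big_ord0.
Qed.

Lemma has_dim_add V1 V2 V d1 d2 : subsp V1 -> subsp V2 ->
  (forall v, V v <-> exists v1 v2, [/\ V1 v1, V2 v2 & v = v1 + v2]) ->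
  (forall v, V1 v -> V2 v -> v = 0) ->
  has_dim V1 d1 -> has_dim V2 d2 -> has_dim V (d1 + d2).
Proof.
move=> s1 s2 hV dis [b1 [hb1 free1 gen1]] [b2 [hb2 free2 gen2]].
have V1s (c : 'I_d1 -> K) : V1 (\sum_i c i *: b1 i).
  by apply: subsp_sum => // i _ _; apply: subsp_scale.
have V2s (c : 'I_d2 -> K) : V2 (\sum_i c i *: b2 i).
  by apply: subsp_sum => // i _ _; apply: subsp_scale.
exists (fun i => match split i with inl j => b1 j | inr j => b2 j end).
have sumE (c : 'I_(d1 + d2) -> K) :
    \sum_i c i *: match split i with inl j => b1 j | inr j => b2 j end
    = \sum_i c (lshift d2 i) *: b1 i + \sum_i c (rshift d1 i) *: b2 i.
  rewrite big_split_ord /=; congr (_ + _); apply: eq_bigr => i _.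
    by rewrite (unsplitK (inl _ i)).
  by rewrite (unsplitK (inr _ i)).
split.
- move=> i; apply/hV; case: (split i) => j.
    by exists (b1 j), 0; rewrite addr0; split=> //; case: s2.
  by exists 0, (b2 j); rewrite add0r; split=> //; case: s1.
- move=> c; rewrite sumE => c0.
  have e1 : \sum_i c (lshift d2 i) *: b1 i = - \sum_i c (rshift d1 i) *: b2 i.
    by apply/eqP; rewrite -addr_eq0 c0.
  have z1 : \sum_i c (lshift d2 i) *: b1 i = 0.
    by apply: dis => //; rewrite e1 -scaleN1r; apply: subsp_scale.
  have z2 : \sum_i c (rshift d1 i) *: b2 i = 0 by rewrite z1 add0r in c0.
  move=> i; rewrite -(splitK i); case: (split i) => j /=.
    exact: (free1 (fun j => c (lshift d2 j))).
  exact: (free2 (fun j => c (rshift d1 j))).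
- move=> v /hV[v1 [v2 [/gen1[c1 ->] /gen2[c2 ->] ->]]].
  exists (fun i => match split i with inl j => c1 j | inr j => c2 j end).
  rewrite sumE; congr (_ + _); apply: eq_bigr => i _.
    by rewrite (unsplitK (inl _ i)).
  by rewrite (unsplitK (inr _ i)).
Qed.

(* The [e]-coordinates in [B] embed [V], and there are as many of them as
   independent vectors [w b]. *)
Lemma has_dim_sandwich (T : eqType) (B : seq T) (V N : set E) (e w : T -> E) :
  uniq B -> subsp V -> subsp N ->
  (forall b, b \in B -> V (w b)) ->
  (forall v, V v -> exists a : T -> K, N (v - \sum_(b <- B) a b *: e b)) ->
  (forall v, V v -> N v -> v = 0) ->
  (forall x : T -> K, \sum_(b <- B) x b *: w b = 0 -> forall b, b \in B -> x b = 0) ->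
  has_dim V (size B).
Proof.
move=> uB sV sN Vw cover inj free.
pose t i := tnth (in_tuple B) i.
have tB i : t i \in B by exact: mem_tnth.
have sumt (F : T -> E) : \sum_(b <- B) F b = \sum_i F (t i) by exact: big_tnth.
pose toT (c : 'I_(size B) -> K) (b : T) :=
  if insub (index b B) is Some i then c i else 0.
have toTK c i : toT c (t i) = c i.
  rewrite /toT /t (tnth_nth (t i)) /= index_uniq // insubT //= => lti.
  by congr c; apply: val_inj.
have Vsum (c : 'I_(size B) -> K) : V (\sum_i c i *: w (t i)).
  by apply: subsp_sum => // i _ _; apply: subsp_scale => //; exact: Vw.
have freew (c : 'I_(size B) -> K) : \sum_i c i *: w (t i) = 0 -> forall i, c i = 0.
  move=> c0 i; rewrite -(toTK c i); apply: free (tB i).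
  by rewrite sumt -[RHS]c0; apply: eq_bigr => j _; rewrite toTK.
have /choice[a aP] : forall i, exists a : T -> K, N (w (t i) - \sum_(b <- B) a b *: e b).
  by move=> i; apply: cover; exact: Vw.
pose A : 'M[K]_(size B) := \matrix_(i, j) a i (t j).
have Nsum (c : 'I_(size B) -> K) :
    N (\sum_i c i *: w (t i) - \sum_j ((\row_i c i) *m A) 0 j *: e (t j)).
  have -> : \sum_j ((\row_i c i) *m A) 0 j *: e (t j)
          = \sum_i c i *: (\sum_(b <- B) a i b *: e b).
    rewrite (eq_bigr (fun j => \sum_i (c i * a i (t j)) *: e (t j))); last first.
      by move=> j _; rewrite mxE scaler_suml; apply: eq_bigr => i _; rewrite !mxE.
    rewrite exchange_big; apply: eq_bigr => i _; rewrite sumt scaler_sumr.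
    by apply: eq_bigr => j _; rewrite scalerA.
  rewrite -sumrB; apply: subsp_sum => // i _ _; rewrite -scalerBr.
  exact: subsp_scale.
(* A row killed by [A] gives a combination of the [w]'s lying in [V] and in [N], hence zero, and the
   [w]'s are independent. *)
have Au : A \in unitmx.
  rewrite -row_free_unit -kermx_eq0; apply/eqP/row_matrixP => i; rewrite row0.
  have : row i (kermx A) *m A = 0 by rewrite -row_mul mulmx_ker row0.
  move: (row i _) => r rA; apply/rowP => j; rewrite mxE.
  have rE : r = \row_i r 0 i by apply/rowP => l; rewrite mxE.
  apply: (freew (fun i => r 0 i)); apply: inj => //.
  have := Nsum (fun i => r 0 i); rewrite -rE rA [X in _ - X]big1 ?subr0 // => l _.
  by rewrite mxE scale0r.
exists (fun i => w (t i)); split=> // [i|v Vv]; first exact: Vw.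
have [av avP] := cover v Vv.
(* With these coefficients the combination of the [w]'s has the same [e]-coordinates as [v], so the
   difference lies in [V] and in [N]. *)
pose r : 'rV[K]_(size B) := (\row_j av (t j)) *m invmx A.
have rE : r = \row_i r 0 i by apply/rowP => l; rewrite mxE.
exists (fun i => r 0 i); apply/eqP; rewrite -subr_eq0; apply/eqP.
apply: inj; first exact: subsp_sub.
have := subsp_sub sN avP (Nsum (fun i => r 0 i)); rewrite -rE /r mulmxKV // sumt.
rewrite [X in _ - (_ - X)](eq_bigr (fun j => av (t j) *: e (t j))); last first.
  by move=> j _; rewrite mxE.
by rewrite opprB addrA subrK.
Qed.

End Span.

(** * Exponentials of families of operators *)

Section ExpCoef.
Context (K : numFieldType) (E : lmodType K).
Implicit Types (X : nat -> E -> E) (f : E -> E) (u v : E).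

Let lin0 f : linear f -> f 0 = 0.
Proof. by move=> fl; have := fl (-1) 0 0; rewrite scaler0 addr0 scaleN1r addNr. Qed.

Let linZ f a v : linear f -> f (a *: v) = a *: f v.
Proof. by move=> fl; rewrite -[a *: v]addr0 fl lin0 // addr0. Qed.

Let lin_sum f (I : Type) (r : seq I) (P : pred I) (F : I -> E) : linear f ->
  f (\sum_(i <- r | P i) F i) = \sum_(i <- r | P i) f (F i).
Proof.
move=> fl; apply: (big_morph f) => [u v|]; last exact: lin0.
by rewrite -[u]scale1r fl !scale1r.
Qed.

Let linear_bigsum (I : Type) (r : seq I) (P : pred I) (F : I -> E -> E) :
  (forall i, linear (F i)) -> linear (fun v => \sum_(i <- r | P i) F i v).
Proof.
move=> Fl a u v; rewrite scaler_sumr -big_split; apply: eq_bigr => i _.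
by rewrite Fl.
Qed.

Lemma triangle_swap (V : nmodType) (F : nat -> nat -> V) (k : nat) :
  \sum_(1 <= i < k.+1) \sum_(1 <= l < (k - i).+1) F i l
  = \sum_(1 <= l < k.+1) \sum_(1 <= i < (k - l).+1) F i l.
Proof.
have widen (G : nat -> nat -> V) i : (0 < i <= k)%N ->
    \sum_(1 <= l < (k - i).+1) G i l = \sum_(1 <= l < k.+1 | (i + l <= k)%N) G i l.
  move=> /andP[i0 ik]; rewrite (big_nat_widen 1 (k - i).+1 k.+1) //=; last by lia.
  rewrite big_nat_cond [RHS]big_nat_cond; apply: eq_bigl => l; apply/idP/idP; lia.
transitivity (\sum_(1 <= i < k.+1) \sum_(1 <= l < k.+1 | (i + l <= k)%N) F i l).
  by apply: eq_big_nat => i; apply: widen.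
rewrite (exchange_big_dep_nat xpredT) //=; apply: eq_big_nat => l lk.
by rewrite (widen (fun l i => F i l)) //; apply: eq_bigl => i; rewrite addnC.
Qed.

Lemma pow_coef_linear X : (forall n, linear (X n)) -> forall j k, linear (pow_coef X j k).
Proof.
move=> Xl; elim=> [|j IH] k /=; first by move=> a u v; case: ifP; rewrite ?scaler0 ?addr0.
by apply: linear_bigsum => i a u v; rewrite IH Xl.
Qed.

Lemma pow_coef_gt X : (forall n, linear (X n)) ->
  forall j k v, (k < j)%N -> pow_coef X j k v = 0.
Proof.
move=> Xl; elim=> [//|j IH] k v /= kj; rewrite big_nat big1 // => i ik.
by rewrite IH ?lin0 //; lia.
Qed.

Lemma pow_coef_comm X f : linear f -> (forall n v, (0 < n)%N -> f (X n v) = X n (f v)) ->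
  forall j k v, f (pow_coef X j k v) = pow_coef X j k (f v).
Proof.
move=> fl fX; elim=> [|j IH] k v /=; first by case: ifP; rewrite ?lin0.
by rewrite lin_sum //; apply: eq_big_nat => i ik; rewrite fX ?IH //; lia.
Qed.

Lemma pow_coefS X j k v :
  pow_coef X j.+1 k v = \sum_(1 <= i < k.+1) X i (pow_coef X j (k - i) v).
Proof. by []. Qed.

(** This is z d/dz of X(z)^(j+1), which equals (j+1) (z X'(z)) X(z)^j because the operators
    commute. *)
Lemma pow_coef_rec X : (forall n, linear (X n)) ->
  (forall i l v, (0 < i)%N -> (0 < l)%N -> X i (X l v) = X l (X i v)) ->
  forall j k v, k%:R *: pow_coef X j.+1 k v
    = j.+1%:R *: \sum_(1 <= i < k.+1) i%:R *: X i (pow_coef X j (k - i) v).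
Proof.
move=> Xl XC; elim=> [|j IH] k v.
  rewrite scale1r scaler_sumr; apply: eq_big_nat => i /andP[i0 ik] /=.
  case: ifPn => [ki|_]; last by rewrite lin0 // !scaler0.
  by have -> : i = k by lia.
have XZ n a u : X n (a *: u) = a *: X n u by apply: linZ.
rewrite [pow_coef X j.+2 k v]pow_coefS [LHS]scaler_sumr.
transitivity (\sum_(1 <= i < k.+1) (i%:R *: X i (pow_coef X j.+1 (k - i) v)
  + j.+1%:R *: \sum_(1 <= l < (k - i).+1)
      l%:R *: X i (X l (pow_coef X j (k - i - l) v)))).
  apply: eq_big_nat => i /andP[i0 ik].
  have {1}-> : k = (i + (k - i))%N by lia.
  rewrite natrD scalerDl; congr (_ + _); rewrite -XZ IH XZ lin_sum //.
  by congr (_ *: _); apply: eq_bigr => l _; rewrite XZ.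
rewrite big_split /= -scaler_sumr triangle_swap.
rewrite -[j.+2%:R]nat1r scalerDl scale1r; congr (_ + _ *: _).
apply: eq_big_nat => l /andP[l0 lk]; rewrite lin_sum // scaler_sumr.
apply: eq_big_nat => i /andP[i0 ik]; rewrite XC //.
by congr (_ *: X l (X i (pow_coef X j _ v))); lia.
Qed.

Lemma exp_coef_linear X k : (forall n, linear (X n)) -> linear (exp_coef X k).
Proof.
move=> Xl; apply: linear_bigsum => j a u v.
by rewrite pow_coef_linear // scalerDr !scalerA mulrC.
Qed.

Lemma exp_coef_comm X f k v : linear f ->
  (forall n v, (0 < n)%N -> f (X n v) = X n (f v)) ->
  f (exp_coef X k v) = exp_coef X k (f v).
Proof.
move=> fl fX; rewrite /exp_coef lin_sum //; apply: eq_bigr => j _.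
by rewrite linZ // (pow_coef_comm fl fX).
Qed.

Lemma exp_coef0 X v : exp_coef X 0 v = v.
Proof. by rewrite /exp_coef big_ord_recl big_ord0 /= invr1 scale1r addr0. Qed.

Lemma exp_coef_widen X k B v : (forall n, linear (X n)) -> (k < B)%N ->
  exp_coef X k v = \sum_(j < B) (j`!)%:R^-1 *: pow_coef X j k v.
Proof.
move=> Xl kB; rewrite /exp_coef.
rewrite (big_ord_widen B (fun j => (j`!)%:R^-1 *: pow_coef X j k v)) //.
rewrite big_mkcond; apply: eq_bigr => j _; case: ifPn => // jk.
by rewrite pow_coef_gt ?scaler0 //; lia.
Qed.

(** The equation z d/dz exp X = (z X') exp X. In characteristic 0 it determines every coefficient
    from the one of degree 0, so later identities are proved by induction on the degree through
    it. *)
Lemma exp_coef_rec X k v : (forall n, linear (X n)) ->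
  (forall i l v, (0 < i)%N -> (0 < l)%N -> X i (X l v) = X l (X i v)) ->
  k%:R *: exp_coef X k v = \sum_(1 <= i < k.+1) i%:R *: X i (exp_coef X (k - i) v).
Proof.
move=> Xl XC; rewrite /exp_coef big_ord_recl /= scalerDr.
rewrite [X in X + _](_ : _ = 0) ?add0r; last first.
  by case: k => [|k]; rewrite ?scale0r //= !scaler0.
rewrite scaler_sumr.
transitivity (\sum_(j < k) \sum_(1 <= i < k.+1)
    i%:R *: X i ((j`!)%:R^-1 *: pow_coef X j (k - i) v)).
  apply: eq_bigr => j _; rewrite scalerA mulrC -scalerA pow_coef_rec // scalerA.
  rewrite factS natrM invfM mulrAC mulVf ?pnatr_eq0 // mul1r scaler_sumr.
  by apply: eq_bigr => i _; rewrite (linZ _ _ (Xl i)) !scalerA mulrC.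
rewrite exchange_big; apply: eq_big_nat => i /andP[i0 ik] /=.
rewrite -/(exp_coef X (k - i) v) (exp_coef_widen (B := k)) //; last by lia.
by rewrite lin_sum // scaler_sumr.
Qed.

End ExpCoef.

(* Coefficient of y^a in (1 - y)^e. *)
Definition binc (C : nzRingType) (e a : int) : C :=
  match a, e with
  | Negz _, _ => 0
  | Posz a, Posz n => (-1) ^+ a * 'C(n, a)%:R
  | Posz a, Negz n => 'C(n + a, a)%:R
  end.

Arguments binc C e a : simpl never.

(** * Coefficients of powers of 1 - y *)

Section Binc.
Context (C : comNzRingType).
Local Notation binc := (binc C).

Lemma binc_lt0 e a : a < 0 -> binc e a = 0.
Proof. by case: a. Qed.

Lemma binc0 e : binc e 0 = 1.
Proof. by case: e => n; rewrite /binc /= ?expr0 ?mul1r bin0. Qed.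

Lemma binc_gt e a : 0 <= e -> e < a -> binc e a = 0.
Proof.
case: e => // n _; case: a => // a na; rewrite /binc.
by rewrite bin_small ?mulr0 // -ltz_nat.
Qed.

Lemma bincS e a : binc (e + 1) a = binc e a - binc e (a - 1).
Proof.
case: a => [[|a]|a]; last by rewrite !binc_lt0 ?subr0 //; lia.
  by rewrite [binc e (0 - 1)]binc_lt0 // !binc0 subr0.
have -> : a.+1%:Z - 1 = a by lia.
case: e => [n|[|n]].
- have -> : n%:Z + 1 = n.+1 by lia.
  by rewrite /binc /= binS natrD exprS; ring.
- have -> : Negz 0 + 1 = 0 by [].
  by rewrite /binc /= !add0n !binn bin_small // mulr0 subrr.
- have -> : Negz n.+1 + 1 = Negz n by lia.
  by rewrite /binc /= [(n.+1 + a.+1)%N]addnS binS natrD addrK addSnnS.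
Qed.

Lemma sum_binc e i : \sum_(a < i) binc e a%:Z = binc (e - 1) (i%:Z - 1).
Proof.
elim: i => [|i IH]; first by rewrite big_ord0 binc_lt0.
rewrite big_ord_recr IH.
have -> : i.+1%:Z - 1 = i by lia.
by rewrite /= -[X in binc X i%:Z](subrK 1) bincS addrC subrK.
Qed.

(** For f = (1 - y)^e this is y f' = - e (y / (1 - y)) f, the recursion asked of [bt] in
    [low_gen]. *)
Lemma binc_diag e i : i%:R * binc e i%:Z = - e%:~R * \sum_(a < i) binc e a%:Z.
Proof.
rewrite sum_binc; case: i => [|i]; first by rewrite mul0r binc_lt0 ?mulr0.
have -> : i.+1%:Z - 1 = i by lia.
case: e => [[|n]|n].
- by rewrite /binc /= bin0n mulr0 mulr0 oppr0 mul0r.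
- have -> : n.+1%:Z - 1 = n by lia.
  rewrite /binc /= exprS mulrCA -natrM -mul_bin_diag natrM /intmul.
  by ring.
- have -> : Negz n - 1 = Negz n.+1 by lia.
  have e1 : (i.+1 * 'C(n + i.+1, i.+1) = n.+1 * 'C(n.+1 + i, i))%N.
    by rewrite mul_bin_left addSnnS; congr (_ * _)%N; lia.
  by rewrite /binc -natrM e1 natrM NegzE -mulrNz opprK.
Qed.

End Binc.

(** * Commutation of exponentials of Heisenberg operators *)

Section Heisenberg.
Context (C : numFieldType) (E : lmodType C) (h : int -> {linear E -> E}) (al : C).
Implicit Types (u v : E) (kap : C).

(* Coefficient of z^r in exp (al * \sum_(n > 0) h_(-n) / n z^n). *)
Definition gen (r : int) v : E :=
  if r is Posz n then exp_coef (fun n v => (al / n%:R) *: h (- n%:Z) v) n v else 0.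

(* Coefficient of z^l in exp (kap * \sum_(n > 0) h_n / n z^n). *)
Definition low kap (l : int) v : E :=
  if l is Posz n then exp_coef (fun n v => (kap / n%:R) *: h n%:Z v) n v else 0.

Lemma scale_h_linear (c : C) i : linear (fun v => c *: h i v).
Proof. by move=> a u v; rewrite linearP scalerDr !scalerA mulrC. Qed.

Lemma gen_linear r : linear (gen r).
Proof.
case: r => n /=; last by move=> a u v; rewrite scaler0 addr0.
by apply: exp_coef_linear => i; exact: scale_h_linear.
Qed.

HB.instance Definition _ r := GRing.isLinear.Build C E E _ (gen r) (gen_linear r).

Lemma low_linear kap l : linear (low kap l).
Proof.
case: l => n /=; last by move=> a u v; rewrite scaler0 addr0.
by apply: exp_coef_linear => i; exact: scale_h_linear.
Qed.

HB.instance Definition _ kap l :=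
  GRing.isLinear.Build C E E _ (low kap l) (low_linear kap l).

Lemma genZ r c v : gen r (c *: v) = c *: gen r v.
Proof. exact: linearZ. Qed.

Lemma gen0 v : gen 0 v = v. Proof. exact: exp_coef0. Qed.
Lemma low0 kap v : low kap 0 v = v. Proof. exact: exp_coef0. Qed.
Lemma gen_lt0 r v : r < 0 -> gen r v = 0. Proof. by case: r. Qed.
Lemma low_lt0 kap r v : r < 0 -> low kap r v = 0. Proof. by case: r. Qed.

Hypothesis hcomm : forall i j v,
  h i (h j v) - h j (h i v) = (i%:~R *+ (i + j == 0)) *: v.

Let hC i j v : i + j != 0 -> h i (h j v) = h j (h i v).
Proof. by move=> /negbTE ij; apply/eqP; rewrite -subr_eq0 hcomm ij mulr0n scale0r. Qed.

Let natr_divK (x : C) i : (0 < i)%N -> i%:R * (x / i%:R) = x.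
Proof. by move=> i0; rewrite mulrC divfK // pnatr_eq0 -lt0n. Qed.

(** The bound [B] is any number above [r], the extra terms being zero, so that sums for different
    degrees can share one range. *)
Lemma gen_rec r (B : nat) v : r < B%:Z ->
  r%:~R *: gen r v = al *: \sum_(1 <= i < B) h (- i%:Z) (gen (r - i%:Z) v).
Proof.
case: r => [k|k] rB; last first.
  rewrite scaler0 big_nat big1 ?scaler0 // => i ik.
  by rewrite gen_lt0 ?linear0 //; lia.
rewrite -pmulrn /= exp_coef_rec; first last.
- move=> i l u i0 l0; rewrite !linearZ /= hC ?scalerA 1?mulrC //; lia.
- by move=> i; exact: scale_h_linear.
rewrite scaler_sumr [RHS](big_cat_nat (n := k.+1)) //=.
rewrite [X in _ + X]big_nat [X in _ + X]big1 ?addr0; last first.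
  by move=> i ik; rewrite gen_lt0 ?linear0 ?scaler0 //; lia.
apply: eq_big_nat => i /andP[i0 ik]; rewrite scalerA natr_divK //.
by have -> : k%:Z - i%:Z = (k - i)%N by lia.
Qed.

Lemma low_rec kap r (B : nat) v : r < B%:Z ->
  r%:~R *: low kap r v = kap *: \sum_(1 <= i < B) h i%:Z (low kap (r - i%:Z) v).
Proof.
case: r => [k|k] rB; last first.
  rewrite scaler0 big_nat big1 ?scaler0 // => i ik.
  by rewrite low_lt0 ?linear0 //; lia.
rewrite -pmulrn /= exp_coef_rec; first last.
- move=> i l u i0 l0; rewrite !linearZ /= hC ?scalerA 1?mulrC //; lia.
- by move=> i; exact: scale_h_linear.
rewrite scaler_sumr [RHS](big_cat_nat (n := k.+1)) //=.
rewrite [X in _ + X]big_nat [X in _ + X]big1 ?addr0; last first.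
  by move=> i ik; rewrite low_lt0 ?linear0 ?scaler0 //; lia.
apply: eq_big_nat => i /andP[i0 ik]; rewrite scalerA natr_divK //.
by have -> : k%:Z - i%:Z = (k - i)%N by lia.
Qed.

Lemma gen_comm (f : {linear E -> E}) r v :
  (forall (n : nat) u, (0 < n)%N -> f (h (- n%:Z) u) = h (- n%:Z) (f u)) ->
  f (gen r v) = gen r (f v).
Proof.
move=> fh; case: r => n /=; last exact: linear0.
apply: exp_coef_comm => [|i u i0]; first exact: linearP.
by rewrite linearZ /= fh.
Qed.

Lemma low_comm (f : {linear E -> E}) kap r v :
  (forall (n : nat) u, (0 < n)%N -> f (h n%:Z u) = h n%:Z (f u)) ->
  f (low kap r v) = low kap r (f v).
Proof.
move=> fh; case: r => n /=; last exact: linear0.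
apply: exp_coef_comm => [|i u i0]; first exact: linearP.
by rewrite linearZ /= fh.
Qed.

Lemma genC r s v : gen r (gen s v) = gen s (gen r v).
Proof.
apply: gen_comm => n u n0; apply/esym/gen_comm => k w k0.
by rewrite hC //; lia.
Qed.

Lemma h_low kap (n : nat) l v : h n%:Z (low kap l v) = low kap l (h n%:Z v).
Proof. by apply: low_comm => k u k0; rewrite hC //; lia. Qed.

(** The commutator of h_n with (al / n) h_(-n) z^n is the scalar al z^n, so commuting h_n with the
    exponential multiplies it by al z^n. *)
Lemma h_gen (n : nat) r v : (0 < n)%N ->
  h n%:Z (gen r v) = gen r (h n%:Z v) + al *: gen (r - n%:Z) v.
Proof.
move=> n0; case: r => [k|k]; last first.
  by rewrite [gen (_ - _) _]gen_lt0 ?linear0 ?scaler0 ?addr0 //; lia.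
elim/ltn_ind: k v => -[|k] IH v.
  by rewrite !gen0 gen_lt0 ?scaler0 ?addr0 //; lia.
have {}IH r u : r < k.+1%:Z -> h n%:Z (gen r u)
    = gen r (h n%:Z u) + al *: gen (r - n%:Z) u.
  case: r => r rk; first by apply: IH; lia.
  by rewrite [gen (_ - _) _]gen_lt0 ?linear0 ?scaler0 ?addr0 //; lia.
have k0 : (k.+1%:Z)%:~R != 0 :> C by rewrite intr_eq0.
apply: (scalerI k0); pose B := (k.+2 + n)%N.
rewrite -linearZ /= (@gen_rec _ B); last by rewrite /B; lia.
rewrite linearZ linear_sum /=.
transitivity (al *: \sum_(1 <= i < B)
  (h (- i%:Z) (gen (k.+1%:Z - i%:Z) (h n%:Z v))
   + (al *: h (- i%:Z) (gen (k.+1%:Z - n%:Z - i%:Z) v)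
   + (n%:R *+ (i == n)) *: gen (k.+1%:Z - i%:Z) v))).
  congr (_ *: _); apply: eq_big_nat => i /andP[i0 iB].
  have := hcomm n%:Z (- i%:Z) (gen (k.+1%:Z - i%:Z) v).
  rewrite IH; last by lia.
  rewrite linearD linearZ /= -pmulrn subr_eq0 eqz_nat [(n == i)]eq_sym.
  move=> /eqP; rewrite subr_eq => /eqP ->.
  by rewrite addrC -addrA [k.+1%:Z - n%:Z - _]addrAC.
rewrite !big_split /= -scaler_sumr !scalerDr -(@gen_rec _ B); last by rewrite /B; lia.
rewrite -(@gen_rec _ B); last by rewrite /B; lia.
(* Here [gen_rec] has produced the factor k.+1 - n, and the central term at i = n supplies the
   missing n. *)
congr (_ + _); rewrite (bigD1_seq n) ?iota_uniq ?mem_index_iota //=; last by rewrite /B; lia.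
rewrite eqxx mulr1n big1 ?addr0; last by move=> i /negbTE ->; rewrite mulr0n scale0r.
rewrite !scalerA -scalerDl; congr (_ *: _).
by rewrite rmorphB /= -!pmulrn; ring.
Qed.

Let sum_shift (X : nat -> E) (B i : nat) : (forall s, (B <= s)%N -> X s = 0) ->
  \sum_(1 <= n < B) X (n + i)%N = \sum_(s < B | (i < s)%N) X s.
Proof.
move=> X0; rewrite -(big_geq_mkord i.+1 B xpredT X) -[i.+1]add1n big_addn.
case: (leqP B i) => [Bi|iB].
  rewrite [RHS]big_geq; last by lia.
  by rewrite big_nat big1 // => n nB; rewrite X0 //; lia.
rewrite [LHS](big_cat_nat (n := B - i)) /=; [|lia..].
rewrite [X in _ + X]big_nat [X in _ + X]big1 ?addr0 // => s sB.
by rewrite X0 //; lia.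
Qed.

(* Conjugating exp (al * sum_n h_(-n) / n z^n) by exp (kap * sum_n h_n / n w^n)
   multiplies it by (1 - z w)^(- kap al), whose coefficients are [bt]. *)
Lemma low_gen kap (bt : nat -> C) (B : nat) l r v : bt 0%N = 1 ->
  (forall i, i%:R * bt i = kap * al * \sum_(a < i) bt a) -> l < B%:Z ->
  low kap l (gen r v) = \sum_(a < B) bt a *: gen (r - a%:Z) (low kap (l - a%:Z) v).
Proof.
move=> bt0 btS; case: l => [l|l] lB; last first.
  by rewrite big1 // => a _; rewrite [low _ (_ - _) _]low_lt0 ?linear0 ?scaler0 //; lia.
pose X (l : int) s := gen (r - s%:Z) (low kap (l - s%:Z) v).
have X0 l' s : l' < s%:Z -> X l' s = 0 by move=> ls; rewrite /X low_lt0 ?linear0 //; lia.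
rewrite -/(low kap l _).
elim/ltn_ind: l lB => -[|l] IH lB.
  clear IH; case: B lB => [//|B] _; rewrite big_ord_recl big1 ?addr0; last first.
    by move=> a _; rewrite lift0 -/(X 0 _) X0 ?scaler0.
  by rewrite bt0 scale1r !low0.
have {}IH l' : l' < l.+1%:Z -> low kap l' (gen r v) = \sum_(a < B) bt a *: X l' a.
  case: l' => l' ll; first by apply: IH; lia.
  by rewrite big1 // => a _; rewrite X0 ?scaler0 //; lia.
have l0 : (l.+1%:Z)%:~R != 0 :> C by rewrite intr_eq0.
apply: (scalerI l0); rewrite (@low_rec _ _ B) //.
transitivity (kap *: \sum_(1 <= n < B) \sum_(a < B) (bt a *:
    gen (r - a%:Z) (h n%:Z (low kap (l.+1%:Z - a%:Z - n%:Z) v))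
    + (al * bt a) *: X l.+1%:Z (n + a)%N)).
  congr (_ *: _); apply: eq_big_nat => n /andP[n0 nB].
  rewrite IH; last by lia.
  rewrite linear_sum; apply: eq_bigr => a _; rewrite linearZ /= /X h_gen // h_low.
  rewrite scalerDr scalerA [bt a * al]mulrC -h_low PoszD !opprD !addrA.
  by rewrite [l.+1%:Z - a%:Z - _]addrAC [r - a%:Z - _]addrAC.
rewrite exchange_big /=.
have X0B s : (B <= s)%N -> X l.+1%:Z s = 0 by move=> sB; apply: X0; lia.
under eq_bigr do rewrite big_split /= -scaler_sumr -scaler_sumr (sum_shift _ X0B).
rewrite big_split /= scalerDr.
(* The coefficient of X a is l.+1 - a from the recursion for [low] and a from the recursion for
   [bt]; they add up to l.+1. *)
have -> : kap *: \sum_(a < B) bt a *: \sum_(1 <= n < B)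
    gen (r - a%:Z) (h n%:Z (low kap (l.+1%:Z - a%:Z - n%:Z) v))
  = \sum_(a < B) ((l.+1%:R - a%:R) * bt a) *: X l.+1%:Z a.
  rewrite scaler_sumr; apply: eq_bigr => a _.
  transitivity (bt a *: gen (r - a%:Z)
      ((l.+1%:Z - a%:Z)%:~R *: low kap (l.+1%:Z - a%:Z) v)).
    rewrite (@low_rec _ _ B); last by lia.
    rewrite genZ [gen _ (\sum_(_ <= _ < _) _)]linear_sum !scaler_sumr /=.
    by apply: eq_bigr => n _; rewrite !scalerA [kap * _]mulrC.
  by rewrite genZ scalerA mulrC /X rmorphB.
have -> : kap *: \sum_(a < B) (al * bt a) *: \sum_(s < B | (a < s)%N) X l.+1%:Z s
  = \sum_(s < B) (s%:R * bt s) *: X l.+1%:Z s.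
  rewrite scaler_sumr.
  under eq_bigr do rewrite scaler_sumr scaler_sumr big_mkcond.
  rewrite exchange_big; apply: eq_bigr => s _.
  rewrite btS mulr_sumr scaler_suml.
  rewrite (big_ord_widen B (fun a => (kap * al * bt a) *: X l.+1%:Z s)) 1?ltnW //.
  rewrite [RHS]big_mkcond; apply: eq_bigr => a _.
  by case: ifP => _; rewrite ?scaler0 // !scalerA mulrA.
rewrite -big_split scaler_sumr /=; apply: eq_bigr => a _.
by rewrite scalerA -scalerDl -mulrDl subrK.
Qed.

Lemma low_gen_binc (e : int) kap (B : nat) l r v : kap * al = - e%:~R -> l < B%:Z ->
  low kap l (gen r v) = \sum_(a < B) binc C e a *: gen (r - a%:Z) (low kap (l - a%:Z) v).
Proof.
move=> kapE; apply: (low_gen (bt := fun a => binc C e a%:Z)); first exact: binc0.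
by move=> i; rewrite kapE binc_diag.
Qed.

End Heisenberg.

Arguments gen {C E} h al r v : simpl never.
Arguments low {C E} h kap l v : simpl never.

(** * Difference operators *)

Section Shift.
Context (I : finType).
Local Notation J := {ffun I -> int}.
Implicit Types (i l : I) (j : J) (L : seq (I * I)).

Definition ep i : J := [ffun x => (x == i)%:Z].

Definition df (V : zmodType) i l (u : J -> V) : J -> V :=
  fun j => u (j - ep i) - u (j - ep l).

Definition dops (V : zmodType) L (u : J -> V) : J -> V :=
  foldr (fun q u => df q.1 q.2 u) u L.

Lemma epE i x : ep i x = (x == i)%:Z. Proof. by rewrite ffunE. Qed.

Lemma epMzE i n x : (ep i *~ n) x = (x == i)%:Z * n.
Proof.
case: n => n; first by rewrite -pmulrn ffunMnE epE pmulrn mulrzz.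
by rewrite NegzE mulrNz -pmulrn ffunE ffunMnE epE pmulrn mulrzz mulrN.
Qed.

Lemma sumB_ep i j : \sum_x (j - ep i) x = \sum_x j x - 1.
Proof.
under eq_bigr do rewrite !ffunE.
rewrite sumrB; congr (_ - _); rewrite (bigD1 i) //= eqxx big1 ?addr0 //.
by move=> x /negbTE ->.
Qed.

Section ZmodValued.
Context (V : zmodType).
Implicit Types (u : J -> V).

Lemma dfC a b c d u : df a b (df c d u) = df c d (df a b u).
Proof.
apply/funext => j; rewrite /df !opprB !addrA.
rewrite [j - ep c - ep a]addrAC [j - ep c - ep b]addrAC.
rewrite [j - ep d - ep a]addrAC [j - ep d - ep b]addrAC.
by rewrite -!addrA; congr (_ + _); rewrite !addrA addrC -!addrA; congr (_ + _); rewrite addrC.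
Qed.

Lemma dops_cat L1 L2 u : dops (L1 ++ L2) u = dops L1 (dops L2 u).
Proof. exact: foldr_cat. Qed.

Lemma df_dops a b L u : df a b (dops L u) = dops L (df a b u).
Proof. by elim: L => //= q L IH; rewrite dfC IH. Qed.

Lemma dopsC L1 L2 u : dops L1 (dops L2 u) = dops L2 (dops L1 u).
Proof. by elim: L1 => //= q L IH; rewrite IH df_dops. Qed.

Lemma perm_dops L1 L2 u : perm_eq L1 L2 -> dops L1 u = dops L2 u.
Proof.
move: L1 L2; apply: catCA_perm_subst => s1 s2 s3.
by rewrite !dops_cat dopsC.
Qed.

Lemma df_swap i l u : df l i u = fun j => - df i l u j.
Proof. by apply/funext => j; rewrite /df opprB. Qed.

Lemma dopsN L u : dops L (fun j => - u j) = fun j => - dops L u j.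
Proof.
elim: L => //= q L ->; apply/funext => j; rewrite /df opprD.
by [].
Qed.

Lemma dopsD L u v : dops L (fun j => u j + v j) = fun j => dops L u j + dops L v j.
Proof.
elim: L => //= q L ->; apply/funext => j; rewrite /df opprD addrACA.
by [].
Qed.

Lemma dops_ind L u j (P : V -> Prop) :
  (forall x y, P x -> P y -> P (x - y)) ->
  (forall j', (forall i, j' i <= j i) -> \sum_i j' i = \sum_i j i - (size L)%:Z ->
     P (u j')) ->
  P (dops L u j).
Proof.
move=> PB; elim: L j => [|q L IH] j hu /=; first by apply: hu; rewrite ?subr0.
have step i : P (dops L u (j - ep i)).
  apply: IH => j' j'le j'sum; apply: hu => [x|].
    by apply: le_trans (j'le x) _; rewrite !ffunE lerBlDr lerDl.
  by rewrite j'sum sumB_ep -addrA -opprD.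
by apply: PB; exact: step.
Qed.

End ZmodValued.

Lemma dops_additive (V V' : zmodType) (f : {additive V -> V'}) L (u : J -> V) j :
  f (dops L u j) = dops L (fun j => f (u j)) j.
Proof. by elim: L j => //= q L IH j; rewrite raddfB !IH. Qed.

Lemma dops_local (V V' : zmodType) (f : J -> {additive V -> V'}) L (u : J -> V) j :
  (forall q j, q \in L -> f (j - ep q.1) = f j /\ f (j - ep q.2) = f j) ->
  f j (dops L u j) = dops L (fun j => f j (u j)) j.
Proof.
elim: L j => //= q L IH j hf; have [h1 h2] := hf q j (mem_head _ _).
have hf' q' j' : q' \in L -> f (j' - ep q'.1) = f j' /\ f (j' - ep q'.2) = f j'.
  by move=> q'L; apply: hf; rewrite inE q'L orbT.
by rewrite raddfB; congr (_ - _); [rewrite -h1|rewrite -h2]; apply: IH.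
Qed.

(** Expansion of S_i^n (1 - S_l / S_i)^n; the range may go up to any [B] above [n]. *)
Lemma dops_nseq (K : comNzRingType) (V : lmodType K) (B n : nat) i l (u : J -> V) j :
  (n < B)%N -> dops (nseq n (i, l)) u j
  = \sum_(a < B) binc K n a%:Z *: u (j - ep i *~ (n%:Z - a%:Z) - ep l *~ a%:Z).
Proof.
elim: n B j => [|n IH] [//|B] j nB /=.
  rewrite big_ord_recl big1 ?addr0; first by rewrite binc0 scale1r !mulr0z !subr0.
  by move=> a _; rewrite binc_gt ?scale0r.
have -> : n.+1%:Z = n%:Z + 1 by lia.
under eq_bigr do rewrite bincS scalerBl.
rewrite /df sumrB; congr (_ - _).
  rewrite (IH B.+1); last by lia.
  apply: eq_bigr => a _; congr (_ *: u (_ - _)).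
  have -> : n%:Z + 1 - a%:Z = (n%:Z - a%:Z) + 1 by lia.
  by rewrite [ep i *~ (_ + 1)]mulrzDr mulr1z opprD addrA addrAC.
rewrite big_ord_recl binc_lt0 // scale0r add0r (IH B) //.
apply: eq_bigr => a _; rewrite lift0.
have -> : a.+1%:Z = a%:Z + 1 by lia.
have -> : n%:Z + 1 - (a%:Z + 1) = n%:Z - a%:Z by lia.
rewrite addrK; congr (_ *: u _).
rewrite [ep l *~ (_ + 1)]mulrzDr mulr1z opprD addrA.
by rewrite [j - ep l - _]addrAC [LHS]addrAC.
Qed.

End Shift.

(** * The vertex operator on products of [gen] *)

Section Vertex.
Context (C : numFieldType) (E : lmodType C) (h : int -> {linear E -> E}) (al : C).
Hypothesis hcomm : forall i j v,
  h i (h j v) - h j (h i v) = (i%:~R *+ (i + j == 0)) *: v.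
Context (v0 : E).
Hypothesis hv0 : forall n : nat, (0 < n)%N -> h n%:Z v0 = 0.
Context (I : finType).
Local Notation J := {ffun I -> int}.
Local Notation gen := (gen h al).
Local Notation low := (low h).
Implicit Types (t : seq I) (j : J).

Definition gs t j : E := foldr (fun i v => gen (j i) v) v0 t.

Lemma gs_cons i t j : gs (i :: t) j = gen (j i) (gs t j).
Proof. by []. Qed.

Lemma low_v0 kap l : low kap l v0 = if l == 0 then v0 else 0.
Proof.
case: l => [[|l]|l] //; first by rewrite low0.
have l0 : (l.+1%:Z)%:~R != 0 :> C by rewrite intr_eq0.
apply: (scalerI l0); rewrite (@low_rec _ _ _ hcomm _ _ l.+2); last by lia.
rewrite [RHS]scaler0 big_nat big1 ?scaler0 // => i /andP[i0 _].
by rewrite (h_low hcomm) hv0 // linear0.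
Qed.

Lemma gs_lt0 t j i : i \in t -> j i < 0 -> gs t j = 0.
Proof.
move=> + ji; elim: t => //= l t IH; rewrite inE => /predU1P[<-|/IH ->].
  by rewrite gen_lt0.
by rewrite linear0.
Qed.

Lemma gs_eq t j j' : {in t, j =1 j'} -> gs t j = gs t j'.
Proof.
elim: t => //= i t IH jj'; rewrite jj' ?mem_head // IH // => x xt.
by rewrite jj' // inE xt orbT.
Qed.

Lemma perm_gs t t' j : perm_eq t t' -> gs t j = gs t' j.
Proof.
rewrite /gs; move: v0 => v; apply: (catCA_perm_subst (F := fun t => foldr _ v t)).
move=> s1 s2 s3; rewrite !foldr_cat; move: (foldr _ v s3) => w.
elim: s1 => //= i s1 ->; elim: s2 => //= l s2 <-.
exact: genC.
Qed.

Context (c : nat).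

Definition vrow i t : seq (I * I) := flatten [seq nseq c (i, l) | l <- t].

Lemma mem_vrow q i t : q \in vrow i t -> q.1 = i /\ q.2 \in t.
Proof.
case/flattenP=> s /mapP[l lt ->]; rewrite mem_nseq => /andP[_ /eqP ->].
by [].
Qed.

(** On this list [dops] is the c-th power of the Vandermonde product of the shifts. *)
Fixpoint vpairs t : seq (I * I) :=
  if t is i :: t' then vpairs t' ++ vrow i t' else [::].

Lemma mem_vpairs q t : q \in vpairs t -> q.1 \in t /\ q.2 \in t.
Proof.
elim: t => //= i t IH; rewrite mem_cat !inE => /orP[/IH[-> ->]|/mem_vrow[-> ->]].
  by rewrite !orbT.
by rewrite eqxx orbT.
Qed.

Lemma count_vrow (P : pred (I * I)) i t :
  count P (vrow i t) = (\sum_(l <- t) c * P (i, l))%N.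
Proof.
elim: t => [|l t IH]; first by rewrite big_nil.
by rewrite big_cons count_cat IH count_nseq mulnC.
Qed.

Lemma count_vpairs (P : pred (I * I)) t x y : uniq t -> x \in t -> y \in t -> x != y ->
  P (x, y) -> P (y, x) -> (c <= count P (vpairs t))%N.
Proof.
elim: t => //= i t IH /andP[it ut]; rewrite !inE count_cat.
have row l : l \in t -> P (i, l) -> (c <= count P (vrow i t))%N.
  by move=> lt Pil; rewrite count_vrow (bigD1_seq l) //= Pil muln1 leq_addr.
case/predU1P=> [->|xt] /predU1P[->|yt]; rewrite ?eqxx // => xy Pxy Pyx.
- by apply: leq_trans (row y yt Pxy) (leq_addl _ _).
- by apply: leq_trans (row x xt Pyx) (leq_addl _ _).
- by apply: leq_trans (IH ut xt yt xy Pxy Pyx) (leq_addr _ _).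
Qed.

Lemma size_vrow i t : size (vrow i t) = (c * size t)%N.
Proof. by elim: t => [|l t IH]; rewrite ?muln0 // size_cat IH size_nseq mulnS. Qed.

Lemma size_vpairs t : (size (vpairs t)).*2 = (c * (size t * (size t).-1))%N.
Proof.
elim: t => [|i t IH] /=; first by rewrite mul0n muln0.
rewrite size_cat doubleD IH size_vrow; case: (size t) => [|s] /=; first by rewrite !muln0.
by rewrite -!muln2; nia.
Qed.

(* The vertex operator applied to a product of modes of its creation part: moving
   its annihilation part through the factor in z_l produces (z_i - z_l)^c. *)
Lemma vertex_gs kap t i j B : kap * al = - c%:R -> uniq (i :: t) ->
  \sum_(l <- t) j l < B%:Z ->
  \sum_(a < B) gen (j i - (c * size t)%:Z + a%:Z) (low kap a%:Z (gs t j))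
  = dops (vrow i t) (gs (i :: t)) j.
Proof.
move=> kapE; elim: t j B => [|l t IH] j B.
  rewrite big_nil => _; case: B => // B _.
  rewrite big_ord_recl big1; last first.
    by move=> a _; rewrite lift0 [gs _ _]/= low_v0 linear0.
  by rewrite [LHS]addr0 low0 muln0 subr0 addr0.
rewrite /= big_cons inE negb_or => /andP[/andP[il it] /andP[lt ut]] jB.
(* [A] exceeds both [B], as needed to expand [low], and [c], as needed to expand (S_i - S_l)^c. *)
pose A := (B + c.+1)%N.
transitivity (\sum_(a < A) binc C c a%:Z *: gen (j l - a%:Z)
    (\sum_(b < B) gen (j i - (c * (size t).+1)%:Z + b%:Z) (low kap (b%:Z - a%:Z) (gs t j)))).
  transitivity (\sum_(b < B) \sum_(a < A) binc C c a%:Z *: gen (j l - a%:Z)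
      (gen (j i - (c * (size t).+1)%:Z + b%:Z) (low kap (b%:Z - a%:Z) (gs t j)))).
    apply: eq_bigr => b _.
    rewrite (low_gen_binc (e := c) (B := A) hcomm) //; last first.
      by rewrite /A; have := ltn_ord b; lia.
    rewrite linear_sum; apply: eq_bigr => a _ /=; rewrite genZ.
    by rewrite (genC _ hcomm).
  rewrite exchange_big; apply: eq_bigr => a _ /=.
  by rewrite linear_sum scaler_sumr.
have -> : vrow i (l :: t) = nseq c (i, l) ++ vrow i t by [].
rewrite dops_cat (dops_nseq (K := C) (B := A)); last by rewrite /A; lia.
apply: eq_bigr => a _; congr (_ *: _).
set ja := j - _ - _.
have jal : ja l = j l - a%:Z.
  rewrite /ja !ffunE !epMzE eqxx [l == i]eq_sym (negbTE il) mul0r mul1r subr0.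
  by [].
have jai : ja i = j i - c%:Z + a%:Z.
  rewrite /ja !ffunE !epMzE eqxx (negbTE il) mul0r mul1r subr0.
  by rewrite opprB addrA addrAC.
have jat : {in t, ja =1 j}.
  move=> x xt; rewrite /ja !ffunE !epMzE.
  have /negbTE -> : x != l by apply: contraNneq lt => <-.
  have /negbTE -> : x != i by apply: contraNneq it => <-.
  by rewrite !mul0r !subr0.
have -> : gs [:: i, l & t] = fun j => gen (j l) (gs (i :: t) j).
  by apply/funext => j'; rewrite /= (genC _ hcomm).
rewrite -(dops_local (f := fun j => gen (j l))); last first.
  move=> q j' /mem_vrow[qi qt]; split; rewrite !ffunE.
    by rewrite qi [l == i]eq_sym (negbTE il) subr0.
  have /negbTE -> : l != q.2 by apply: contraNneq lt => ->.
  by rewrite subr0.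
(* Both sides vanish when the exponent of [l] becomes negative; otherwise the degree of the product
   over [t] is below B - a, as the induction hypothesis requires. *)
rewrite jal; case: (ltP (j l) a%:Z) => [ja0|aj]; [|].
  rewrite -subr_lt0 in ja0; by rewrite [LHS]gen_lt0 ?[RHS]gen_lt0.
congr (gen _ _).
have jtB : \sum_(x <- t) j x < (B - a)%:Z.
  have : \sum_(x <- t) j x < B%:Z - a%:Z.
    by rewrite ltrBrDr; apply: le_lt_trans jB; rewrite addrC lerD2r.
  by lia.
rewrite -(IH ja (B - a)%N); first last.
- by rewrite (eq_big_seq j).
- by rewrite /= it.
rewrite (gs_eq jat) jai; case: (leqP a B) => [aB|Ba]; last first.
  have -> : (B - a = 0)%N by lia.
  rewrite big_ord0 big1 // => b _; rewrite low_lt0 ?linear0 //.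
  by have := ltn_ord b; lia.
rewrite -(big_mkord xpredT (fun b => gen (j i - (c * (size t).+1)%:Z + b%:Z)
  (low kap (b%:Z - a%:Z) (gs t j)))).
rewrite (big_cat_nat (n := a)) //= big_nat big1 ?add0r; last first.
  by move=> b /andP[_ ba]; rewrite low_lt0 ?linear0 //; lia.
rewrite -{1}[val a]add0n big_addn big_mkord; apply: eq_bigr => b _.
rewrite PoszD addrK; congr (gen _ _).
by rewrite /= mulnS; move: (j i) (c * size t)%N => x y; lia.
Qed.

End Vertex.

(** * The Fock space *)

Section FockGrading.
Context (C : numClosedFieldType) (m : nat).
Local Notation F := (fock C).
Local Notation ket := (ket C).
Local Notation vac := (vac C).
Implicit Types (p : int) (A : {mset nat}%mset) (u v : F) (b : fock_index).

Definition heisL (i : int) : {linear F -> F} := heis m i.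
Local Notation h := heisL.
Local Notation alpha := (alpha C m).

Lemma fock_expand v : v = \sum_(b <- msupp v) v@_b *: ket b.1 b.2.
Proof.
rewrite [LHS]monalgE; apply: eq_bigr => -[p A] _ /=.
by apply/malgP => b; rewrite mcoeffZ !mcoeffU mulr_natr.
Qed.

Lemma ketE p A b : (ket p A)@_b = ((p, A) == b)%:R.
Proof. exact: mcoeffU. Qed.

(** A sum over [D] is zero by convention when infinitely many terms are nonzero, so linearity needs
    a finite support common to all vectors involved; it is gathered from the basis vectors. *)
Lemma fsum_linear (T : choiceType) (D : set T) (G : T -> {linear F -> F}) :
  (forall p A, exists r : seq T, forall t, D t -> t \notin r -> G t (ket p A) = 0) ->
  linear (fun v => \sum_(t \in D) G t v).
Proof.
move=> hfin a u v.
have cover w : exists r : seq T, forall t, D t -> t \notin r -> G t w = 0.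
  have /choice[r hr] : forall b : fock_index, exists r : seq T,
      forall t, D t -> t \notin r -> G t (ket b.1 b.2) = 0 by move=> b; exact: hfin.
  exists (flatten [seq r b | b <- msupp w]) => t Dt tr.
  rewrite [w]fock_expand linear_sum big_seq big1 // => b bw.
  rewrite linearZ /= hr ?scaler0 //; apply: contra tr => trb.
  by apply/flattenP; exists (r b) => //; apply: map_f.
have [r1 h1] := cover u; have [r2 h2] := cover v.
pose r := undup [seq t <- r1 ++ r2 | t \in D].
have ru : uniq r by exact: undup_uniq.
have rD : [set` r] `<=` D.
  by move=> t /=; rewrite mem_undup mem_filter => /andP[/set_mem].
have out t : D t -> t \notin r -> t \notin r1 /\ t \notin r2.
  move=> Dt; rewrite mem_undup mem_filter mem_cat (mem_set Dt) /= negb_or.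
  by move=> /andP.
have z1 t : D t -> t \notin r -> G t u = 0 by move=> Dt /(out t Dt)[/(h1 t Dt)].
have z2 t : D t -> t \notin r -> G t v = 0 by move=> Dt /(out t Dt)[_ /(h2 t Dt)].
rewrite !(fsbigE r) //; last first.
  by move=> t Dt tr; rewrite linearP z1 // z2 // scaler0 addr0.
rewrite scaler_sumr -big_split; apply: eq_bigr => t _.
by rewrite linearP.
Qed.

Definition wt A : nat := (\sum_(a <- A) a.+1)%N.

Lemma perm_mset1D a A : perm_eq (a +` A)%mset (a :: A).
Proof.
by apply/eq_seq_msetP; rewrite seq_mset_id mset_cons seq_mset_id.
Qed.

Lemma wt1D a A : wt (a +` A)%mset = (a.+1 + wt A)%N.
Proof. by rewrite /wt (perm_big _ (perm_mset1D a A)) big_cons. Qed.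

Lemma size1D a A : size (a +` A)%mset = (size A).+1.
Proof. exact: perm_size (perm_mset1D a A). Qed.

Lemma wt0 : wt mset0 = 0%N.
Proof. by rewrite /wt big_mset0. Qed.

Definition hom p (d : int) v := forall b, v@_b != 0 -> b.1 = p /\ (wt b.2)%:Z = d.

Lemma hom_subsp p d : subsp (hom p d).
Proof.
split=> [b|a u v hu hv b]; first by rewrite mcoeff0 eqxx.
rewrite mcoeffD mcoeffZ => nz; have [u0|/hu//] := eqVneq u@_b 0.
by apply: hv; apply: contraNneq nz => ->; rewrite u0 mulr0 addr0.
Qed.

Lemma hom0 p d : hom p d 0. Proof. by case: (hom_subsp p d). Qed.

Lemma hom_scale p d a v : hom p d v -> hom p d (a *: v).
Proof. by move=> hv; apply: (subsp_scale a (hom_subsp p d)). Qed.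

Lemma hom_ket p A : hom p (wt A) (ket p A).
Proof. by move=> b; rewrite ketE; case: ((p, A) =P b) => [<-|_]; rewrite ?eqxx. Qed.

Lemma hom_vac p : hom p 0 (vac p).
Proof. by rewrite -[0]/(0%N%:Z) -wt0; exact: hom_ket. Qed.

Lemma hom_lt0 p d v : d < 0 -> hom p d v -> v = 0.
Proof.
move=> d0 hv; apply/malgP => b; rewrite mcoeff0; apply/eqP/negPn/negP.
by move=> /hv[_ bd]; rewrite -bd in d0.
Qed.

Lemma hom_expand (V : set F) p d v (f : {linear F -> F}) : subsp V -> hom p d v ->
  (forall A, (wt A)%:Z = d -> V (f (ket p A))) -> V (f v).
Proof.
move=> sV hv hf; rewrite [v]fock_expand linear_sum; apply: subsp_sum => // b bv _.
rewrite linearZ /=; apply: subsp_scale => //.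
by rewrite -mcoeff_neq0 in bv; have [-> bd] := hv b bv; apply: hf.
Qed.

Lemma hom_h p d i v : hom p d v -> hom p (d - i) (h i v).
Proof.
move=> hv; apply: (hom_expand (f := h i) (hom_subsp _ _) hv) => A wA.
rewrite /h /=; case: i => [[|n]|n].
- rewrite heis_weight subr0; apply: hom_scale.
  by rewrite -wA; exact: hom_ket.
- rewrite heis_annihil; have [A0|An] := posnP (A n).
    by rewrite A0 muln0 scale0r; case: (hom_subsp p (d - n.+1%:Z)).
  apply: hom_scale.
  have AE : (n +` (A `\ n))%mset = A by apply: msetB1K; rewrite -mset_gt0.
  have -> : d - n.+1%:Z = wt (A `\ n)%mset.
    by rewrite -wA -{1}AE wt1D PoszD addrC addKr.
  exact: hom_ket.
- rewrite heis_create NegzE opprK -wA -PoszD addnC -wt1D.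
  exact: hom_ket.
Qed.

Lemma h_comm i j v : h i (h j v) - h j (h i v) = (i%:~R *+ (i + j == 0)) *: v.
Proof. exact: heis_comm. Qed.

Local Notation gen := (gen h alpha).
Local Notation low := (low h).

Lemma hom_gen p d r v : hom p d v -> hom p (d + r) (gen r v).
Proof.
move=> hv; case: r => r; last by rewrite gen_lt0 //; exact: hom0.
elim/ltn_ind: r => -[|r] IH; first by rewrite gen0 addr0.
have r0 : (r.+1%:Z)%:~R != 0 :> C by rewrite intr_eq0.
rewrite -[gen _ _]scale1r -(mulVf r0) -scalerA; apply: hom_scale.
rewrite (@gen_rec _ _ _ _ h_comm _ r.+2); last by lia.
apply: hom_scale.
apply: (subsp_sum (hom_subsp _ _)) => i.
rewrite mem_index_iota => /andP[i0 ir] _.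
have -> : d + r.+1%:Z = d + (r.+1 - i)%N%:Z - (- i%:Z) by lia.
apply: hom_h; have -> : r.+1%:Z - i%:Z = (r.+1 - i)%N by lia.
by apply: IH; lia.
Qed.

Lemma hom_low p d kap r v : hom p d v -> hom p (d - r) (low kap r v).
Proof.
move=> hv; case: r => r; last by rewrite low_lt0 //; exact: hom0.
elim/ltn_ind: r => -[|r] IH; first by rewrite low0 subr0.
have r0 : (r.+1%:Z)%:~R != 0 :> C by rewrite intr_eq0.
rewrite -[low _ _ _]scale1r -(mulVf r0) -scalerA; apply: hom_scale.
rewrite (@low_rec _ _ _ h_comm _ _ r.+2); last by lia.
apply: hom_scale.
apply: (subsp_sum (hom_subsp _ _)) => i.
rewrite mem_index_iota => /andP[i0 ir] _.
have -> : d - r.+1%:Z = d - (r.+1 - i)%N%:Z - i%:Z by lia.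
apply: hom_h; have -> : r.+1%:Z - i%:Z = (r.+1 - i)%N by lia.
by apply: IH; lia.
Qed.

End FockGrading.

Arguments hom_subsp {C} p d.
Arguments hom_ket {C} p A [b] _.
Arguments hom0 {C} p d [b] _.
Arguments hom_vac {C} p [b] _.

(** * The modes of the vertex operator on homogeneous vectors *)

Section FockOperators.
Context (C : numClosedFieldType) (m : nat).
Local Notation F := (fock C).
Local Notation ket := (ket C).
Local Notation vac := (vac C).
Local Notation h := (heisL C m).
Local Notation alpha := (alpha C m).
Local Notation gen := (gen h alpha).
Local Notation low := (low h).
Implicit Types (p e : int) (A : {mset nat}%mset) (u v : F).

Hypothesis m_gt0 : (0 < m)%N.

Lemma alpha_sqr : alpha ^+ 2 = (2 * m)%:R.
Proof. exact: sqrtCK. Qed.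

Lemma alpha_neq0 : alpha != 0.
Proof. by rewrite sqrtC_eq0 pnatr_eq0 muln_eq0 -lt0n. Qed.

Lemma alpha_ge0 : 0 <= alpha.
Proof. by rewrite sqrtC_ge0 ler0n. Qed.

Definition shiftL : {linear F -> F} := lin_ext (fun b => ket (b.1 - (2 * m)%:Z) b.2).

Definition zh0L e : {linear F -> F} :=
  lin_ext (fun b => if alpha * degz C m b.1 == e%:~R then ket b.1 b.2 else 0).

Lemma shiftL_ket p A : shiftL (ket p A) = ket (p - (2 * m)%:Z) A.
Proof. exact: lin_ext_ket. Qed.

Lemma zh0L_ket e p A : zh0L e (ket p A) = if e == - p then ket p A else 0.
Proof.
rewrite /zh0L /= lin_ext_ket /degz mulrC divfK ?alpha_neq0 // -rmorphN /= eqr_int.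
by rewrite eq_sym.
Qed.

Lemma hom_shiftL p d v : hom p d v -> hom (p - (2 * m)%:Z) d (shiftL v).
Proof.
move=> hv; apply: (hom_expand (f := shiftL) (hom_subsp _ _) hv) => A <-.
by rewrite shiftL_ket; exact: hom_ket.
Qed.

Lemma zh0L_hom e p d v : hom p d v -> zh0L e v = if e == - p then v else 0.
Proof.
move=> hv; rewrite [v in LHS]fock_expand linear_sum.
transitivity (\sum_(b <- msupp v) v@_b *: (if e == - p then ket b.1 b.2 else 0)).
  rewrite !big_seq; apply: eq_bigr => b; rewrite -mcoeff_neq0 => /hv[bp _].
  by rewrite linearZ /= zh0L_ket bp.
case: eqP => _; first by rewrite -fock_expand.
by rewrite big1 // => b _; rewrite scaler0.
Qed.

Definition modeL (t : nat * nat * int) : {linear F -> F} :=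
  gen t.1.1%:Z \o low (- alpha) t.1.2%:Z \o shiftL \o zh0L t.2.

Lemma expp_coefE l v : expp_coef m l v = low (- alpha) l%:Z v.
Proof.
rewrite /expp_coef /low; congr (exp_coef _ l v); apply/funext => n.
by apply/funext => u; rewrite mulNr.
Qed.

Lemma expm_coefE k v : expm_coef m k v = gen k%:Z v.
Proof. by []. Qed.

Lemma shiftTE v : shiftT m v = shiftL v.
Proof. by []. Qed.

Lemma zh0_coefE e v : zh0_coef m e v = zh0L e v.
Proof. by []. Qed.

Lemma amodeE n v : amode m n v =
  \sum_(t \in [set t : nat * nat * int | t.1.1%:Z - t.1.2%:Z + t.2 = - n - 1]) modeL t v.
Proof.
rewrite /amode; apply: eq_fsbigr => t _.
by rewrite zh0_coefE shiftTE expp_coefE expm_coefE.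
Qed.

Lemma modeL_hom_eq0 p d v t (B : nat) : hom p d v -> d < B%:Z ->
  (t.2 != - p) || (B <= t.1.2)%N -> modeL t v = 0.
Proof.
move=> hv dB; rewrite /modeL /= (zh0L_hom _ hv); case: ifP => [_|_ _]; last first.
  by rewrite !linear0.
rewrite /= => Bt; rewrite (_ : low _ _ _ = 0) ?linear0 //.
apply: hom_lt0 (hom_low (hom_shiftL hv)).
by rewrite subr_lt0; lia.
Qed.

Lemma amode_linear n : linear (amode m n : F -> F).
Proof.
move=> a u v; rewrite !amodeE; apply: fsum_linear => p A.
have [B AB] : exists B : nat, (wt A)%:Z < B%:Z by exists (wt A).+1; lia.
(* Only e = - p survives z^(alpha h_0), only l < B survives the annihilation part, and k is then
   determined. *)
exists [seq (absz (p - n - 1 + l%:Z)%R, l, - p) | l <- iota 0 B] => -[[k l] e] kle.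
apply: contraNeq => nz; rewrite /= in kle; apply/mapP; exists l.
  rewrite mem_iota add0n /=; apply: contraNT nz => lB; apply/eqP.
  by apply: (modeL_hom_eq0 (hom_ket p A) AB); rewrite /= leqNgt lB orbT.
have {nz} ep : e = - p.
  apply/eqP; apply: contraNT nz => ep; apply/eqP.
  by apply: (modeL_hom_eq0 (hom_ket p A) AB); rewrite /= ep.
by rewrite ep; congr (_, _, _); move: kle; rewrite ep; lia.
Qed.

HB.instance Definition _ n := GRing.isLinear.Build C F F _ (amode m n) (amode_linear n).

(** Since [gen] vanishes at negative arguments, the sum carries no condition that the creation index
    be nonnegative. *)
Lemma amode_hom n p d v (B : nat) : hom p d v -> d < B%:Z ->
  amode m n v = \sum_(l < B) gen (p - n - 1 + l%:Z) (low (- alpha) l%:Z (shiftL v)).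
Proof.
move=> hv dB; rewrite amodeE.
pose f (l : nat) := (absz (p - n - 1 + l%:Z)%R, l, - p).
rewrite (fsbigE [seq f l | l <- iota 0 B & 0 <= p - n - 1 + l%:Z]); first last.
- move=> [[k l] e] kle; apply: contraNeq => nz; rewrite /= in kle.
  apply/mapP; exists l.
    rewrite mem_filter mem_iota add0n /=.
    have lB : (l < B)%N.
      apply: contraNT nz => lA; apply/eqP.
      by apply: (modeL_hom_eq0 hv dB); rewrite /= leqNgt lA orbT.
    have ep : e = - p.
      apply/eqP; apply: contraNT nz => ep; apply/eqP.
      by apply: (modeL_hom_eq0 hv dB); rewrite /= ep.
    by rewrite lB andbT; move: kle; rewrite ep; lia.
  have ep : e = - p.
    apply/eqP; apply: contraNT nz => ep; apply/eqP.
    by apply: (modeL_hom_eq0 hv dB); rewrite /= ep.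
  by rewrite /f ep; congr (_, _, _); move: kle; rewrite ep; lia.
- move=> [[k l] e] /= /mapP[l']; rewrite mem_filter => /andP[l0 _] [-> -> ->] /=.
  by lia.
- by rewrite map_inj_uniq ?filter_uniq ?iota_uniq // => l l' [].
rewrite big_map big_filter_cond -(big_mkord xpredT (fun l : nat =>
  gen (p - n - 1 + l%:Z) (low (- alpha) l%:Z (shiftL v)))) big_mkcond.
rewrite /index_iota subn0; apply: eq_bigr => l _.
case: (leP 0 (p - n - 1 + l%:Z)) => l0 /=; last by rewrite gen_lt0.
rewrite mem_set /=; last by lia.
by rewrite /modeL /= (zh0L_hom _ hv) eqxx; congr (gen _ _); lia.
Qed.

End FockOperators.

(** * Words in the modes *)

Section Words.
Context (C : numClosedFieldType) (m : nat).
Local Notation F := (fock C).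
Local Notation ket := (ket C).
Local Notation vac := (vac C).
Local Notation h := (heisL C m).
Local Notation alpha := (alpha C m).
Local Notation gen := (gen h alpha).
Local Notation low := (low h).
Local Notation gs := (gs h alpha).
Implicit Types (p e : int) (A : {mset nat}%mset) (u v : F).

Lemma h_vac p (n : nat) : (0 < n)%N -> h n%:Z (vac p) = 0.
Proof. by move=> n0; apply: hom_lt0 (hom_h (hom_vac p)); lia. Qed.

Lemma h_create n p A : h (Negz n) (ket p A) = ket p (n +` A)%mset.
Proof. exact: heis_create. Qed.

Lemma shiftL_gen r v : shiftL C m (gen r v) = gen r (shiftL C m v).
Proof.
apply: gen_comm => -[//|n] u _.
have := @linear_ket_ext C (shiftL C m \o h (Negz n)) (h (Negz n) \o shiftL C m).
apply => p A; change (shiftL C m (h (Negz n) (ket p A)) = h (Negz n) (shiftL C m (ket p A))).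
by rewrite (h_create n p A) (shiftL_ket C m p (n +` A)%mset) (shiftL_ket C m p A) h_create.
Qed.

Context (I : finType).
Local Notation J := {ffun I -> int}.
Implicit Types (t : seq I) (j : J).

Lemma shiftL_gs p t j : shiftL C m (gs (vac p) t j) = gs (vac (p - (2 * m)%:Z)) t j.
Proof.
elim: t => [|i t IH]; first exact: shiftL_ket.
by rewrite [LHS]shiftL_gen IH.
Qed.

Lemma hom_gs p t j : hom p (\sum_(i <- t) j i) (gs (vac p) t j).
Proof.
elim: t => [|i t IH]; first by rewrite big_nil; exact: hom_vac.
by rewrite big_cons addrC; exact: hom_gen.
Qed.

Definition word p t j : F := foldr (fun i v => amode m (p - 1 - j i) v) (vac p) t.

Lemma low_gsE : - alpha * alpha = - (2 * m)%:R.
Proof. by rewrite mulNr -expr2 alpha_sqr. Qed.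

Hypothesis m_gt0 : (0 < m)%N.

(** The charge of [gs] lowers the index of the outer [gen] by 2 m (size t), which is exactly the
    offset under which [vertex_gs] yields the factors (S_i - S_l)^(2m). *)
Lemma amode_gs p t j i : uniq (i :: t) ->
  amode m (p - 1 - j i) (gs (vac (p - (2 * m * size t)%:Z)) t j)
  = dops (vrow (2 * m) i t) (gs (vac (p - (2 * m * (size t).+1)%:Z)) (i :: t)) j.
Proof.
move=> uit; set p' := p - _.
have [B jB] : exists B : nat, \sum_(x <- t) j x < B%:Z.
  by exists (absz (\sum_(x <- t) j x)).+1; lia.
rewrite (amode_hom m_gt0 _ (hom_gs (p := p') (t := t) (j := j)) jB) shiftL_gs.
have -> : p' - (2 * m)%:Z = p - (2 * m * (size t).+1)%:Z by rewrite /p' mulnS; lia.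
rewrite -(vertex_gs (h_comm m) (@h_vac _) low_gsE uit jB).
apply: eq_bigr => b _; congr (gen _ _); rewrite /p'.
by move: (j i) (2 * m * size t)%N => x y; lia.
Qed.

Lemma word_gs p t j : uniq t ->
  word p t j = dops (vpairs (2 * m) t) (gs (vac (p - (2 * m * size t)%:Z)) t) j.
Proof.
elim: t j => [|i t IH] j; first by rewrite /= muln0 subr0.
move=> /= /andP[it ut]; rewrite IH // dops_cat.
rewrite (dops_local (f := fun j => amode m (p - 1 - j i))); last first.
  move=> q j' /mem_vpairs[q1 q2]; rewrite !ffunE.
  have /negbTE -> : i != q.1 by apply: contraNneq it => ->.
  have /negbTE -> : i != q.2 by apply: contraNneq it => ->.
  by rewrite !subr0.
congr (dops _ _ j); apply/funext => j'.
by apply: amode_gs; rewrite /= it.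
Qed.

End Words.

(** * Annihilation of words by high coefficients of [low] *)

Section Vanishing.
Context (C : numFieldType) (E : lmodType C) (h : int -> {linear E -> E}) (al : C).
Hypothesis hcomm : forall i j v,
  h i (h j v) - h j (h i v) = (i%:~R *+ (i + j == 0)) *: v.
Context (v0 : E).
Hypothesis hv0 : forall n : nat, (0 < n)%N -> h n%:Z v0 = 0.
Context (I : finType).
Local Notation J := {ffun I -> int}.
Local Notation gen := (gen h al).
Local Notation low := (low h).
Local Notation gs := (gs h al v0).
Implicit Types (t : seq I) (j e : J).

(* For [r < B], the sum of (\prod_(i in t) binc (e i) (nu i)) *: gs t (j - nu)
   over the [nu] of degree [r]. *)
Fixpoint bsum (B : nat) t e (r : int) j : E :=
  if t is i :: t' then
    \sum_(a < B) binc C (e i) a%:Z *: gen (j i - a%:Z) (bsum B t' e (r - a%:Z) j)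
  else if r == 0 then v0 else 0.

Lemma bsum_lt0 B t e r j : r < 0 -> bsum B t e r j = 0.
Proof.
elim: t r => [|i t IH] r r0 /=; first by rewrite lt_eqF.
by rewrite big1 // => a _; rewrite IH ?linear0 ?scaler0 //; lia.
Qed.

Lemma bsum_eq B t e e' r j j' : {in t, e =1 e'} -> {in t, j =1 j'} ->
  bsum B t e r j = bsum B t e' r j'.
Proof.
elim: t r => //= i t IH r ee jj; apply: eq_bigr => a _.
rewrite ee ?mem_head // jj ?mem_head // IH // => x xt.
  by rewrite ee // inE xt orbT.
by rewrite jj // inE xt orbT.
Qed.

(** Raising [e i] by one multiplies the generating series by 1 - y_i, and y_i lowers both the degree
    and [j i]. *)
Lemma bsumS B t e r j i : uniq t -> i \in t -> r < B%:Z ->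
  bsum B t (e + ep i) r j = bsum B t e r j - bsum B t e (r - 1) (j - ep i).
Proof.
elim: t r => //= l t IH r /andP[lt ut]; rewrite inE => /predU1P[->{i IH}|it] rB.
  have nl x : x \in t -> (x == l) = false by move=> xt; apply: contraNF lt => /eqP <-.
  have e1 r' : bsum B t (e + ep l) r' j = bsum B t e r' j.
    by apply: bsum_eq => // x xt; rewrite !ffunE nl // addr0.
  have e2 r' : bsum B t e r' (j - ep l) = bsum B t e r' j.
    by apply: bsum_eq => // x xt; rewrite !ffunE nl // subr0.
  under eq_bigr do rewrite e1 ffunE epE eqxx bincS scalerBl.
  rewrite sumrB; congr (_ - _).
  case: B rB e1 e2 => [|B] rB e1 e2; first by rewrite !big_ord0.
  rewrite big_ord_recl binc_lt0 // scale0r add0r [RHS]big_ord_recr [RHS]/=.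
  rewrite [X in _ = _ + X](_ : _ = 0) ?addr0; last first.
    by rewrite [bsum _ _ _ _ _]bsum_lt0 ?linear0 ?scaler0 //; lia.
  apply: eq_bigr => a _; rewrite e2 lift0 !ffunE eqxx.
  have -> : a.+1%:Z = a%:Z + 1 by lia.
  by rewrite addrK !opprD !addrA [j l - a%:Z - 1]addrAC [r - a%:Z - 1]addrAC.
have /negbTE li : l != i by apply: contraNneq lt => ->.
rewrite -sumrB; apply: eq_bigr => a _; rewrite IH //; last by lia.
rewrite !ffunE li addr0 subr0 linearB scalerBr /=.
by rewrite [r - a%:Z - 1]addrAC.
Qed.

(** In these terms S_x - S_y is y_x - y_y = (1 - y_y) - (1 - y_x), so a difference is absorbed into
    the exponents at the cost of one degree. *)
Lemma df_bsum B t e r j x y : uniq t -> x \in t -> y \in t -> r + 1 < B%:Z ->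
  df x y (bsum B t e r) j = bsum B t (e + ep y) (r + 1) j - bsum B t (e + ep x) (r + 1) j.
Proof.
move=> ut xt yt rB; rewrite !bsumS // addrK /df.
by rewrite [RHS]addrC opprB addrA subrK.
Qed.

(** Each factor of [L] raises [e] at one of its two ends, so the sum of the exponents at [x] and [y]
    grows at least by the number of factors joining them. *)
Lemma dops_bsum B t (P : E -> Prop) L e r j : uniq t ->
  (forall x y, P x -> P y -> P (x - y)) ->
  {in L, forall q, q.1 \in t /\ q.2 \in t} -> r + (size L)%:Z < B%:Z ->
  (forall e' : J, (forall x, e x <= e' x) ->
     (forall x y, x != y -> e x + e y
       + (count (fun q => (q == (x, y)) || (q == (y, x))) L)%:Z <= e' x + e' y) ->
     \sum_(x <- t) e' x = \sum_(x <- t) e x + (size L)%:Z ->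
     P (bsum B t e' (r + (size L)%:Z) j)) ->
  P (dops L (bsum B t e r) j).
Proof.
move=> ut PB; elim: L e r => [|q L IH] e r tL rB hP /=.
  rewrite -[r]addr0; apply: hP => //.
  - by move=> x y _; rewrite addr0.
  - by rewrite addr0.
have [q1 q2] := tL q (mem_head _ _).
rewrite df_dops; have -> : df q.1 q.2 (bsum B t e r)
    = fun j => bsum B t (e + ep q.2) (r + 1) j + - bsum B t (e + ep q.1) (r + 1) j.
  by apply/funext => j'; rewrite df_bsum //; move: rB => /=; lia.
rewrite dopsD dopsN.
have sumep z : z \in t -> \sum_(x <- t) (e + ep z) x = \sum_(x <- t) e x + 1.
  move=> zt; under eq_bigr do rewrite ffunE; rewrite big_split /=; congr (_ + _).
  rewrite (bigD1_seq z) //= epE eqxx big1 ?addr0 // => x /negbTE xz.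
  by rewrite epE xz.
have step z : z \in t -> z = q.1 \/ z = q.2 -> P (dops L (bsum B t (e + ep z) (r + 1)) j).
  move=> zt zq; apply: IH.
  - by move=> q' q'L; apply: tL; rewrite inE q'L orbT.
  - by move: rB => /=; lia.
  move=> e' ee' eec sume'.
  have -> : r + 1 + (size L)%:Z = r + (size (q :: L))%:Z by rewrite /=; lia.
  apply: hP => [x|x y xy|].
  - by apply: le_trans (ee' x); rewrite !ffunE lerDl.
  - have key : (((q == (x, y)) || (q == (y, x))) <= (x == z) + (y == z))%N.
      by case: zq => ->; case: orP => // -[]/eqP ->; rewrite eqxx ?addn1.
    apply: le_trans (eec x y xy); rewrite !ffunE /= PoszD.
    move: (count _ L) (e x) (e y) (_ || _) (x == z) (y == z) key => n a b b1 b2 b3.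
    by case: b1; case: b2; case: b3 => //= _; lia.
  - by rewrite sume' sumep // /=; lia.
by apply: PB; apply: step => //; [right|left].
Qed.

Lemma bsum_bound B t e r j (bd : I -> int) :
  (forall i (a : nat), i \in t -> binc C (e i) a%:Z != 0 -> a%:Z <= j i -> a%:Z <= bd i) ->
  \sum_(i <- t) bd i < r -> bsum B t e r j = 0.
Proof.
elim: t r => [|i t IH] r hbd /=; first by rewrite big_nil => r0; rewrite gt_eqF.
rewrite big_cons => ltr; rewrite big1 // => a _.
have [->|nz] := eqVneq (binc C (e i) a%:Z) 0; first by rewrite scale0r.
have [aj|ja] := leP a%:Z (j i); last by rewrite gen_lt0 ?scaler0 // subr_lt0.
rewrite IH ?linear0 ?scaler0 //; first by move=> l b lt; apply: hbd; rewrite inE lt orbT.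
have := hbd i a (mem_head _ _) nz aj.
by move: ltr; move: (\sum_(_ <- _) _) (bd i) => x y; lia.
Qed.

Lemma low_gs_bsum kap (e0 : int) B t r j : kap * al = - e0%:~R -> r < B%:Z ->
  low kap r (gs t j) = bsum B t [ffun=> e0] r j.
Proof.
move=> kapE; elim: t r => [|i t IH] r rB /=; first exact: low_v0.
rewrite (low_gen_binc (e := e0) (B := B) hcomm) // ffunE.
by apply: eq_bigr => a _; rewrite IH //; lia.
Qed.

(* After the [size t * (size t).-1 * m] differences, the exponents [e] of the
   surviving [bsum]s satisfy [e x + e y >= 0], so at most one is negative, and
   [(1 - y)^(e x)] is a polynomial for all the others. *)
Lemma low_dops_eq0 (m : nat) kap t (n : nat) j r : kap * al = m%:R -> uniq t ->
  (0 < size t)%N -> {in t, forall x, j x < n%:Z} ->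
  n%:Z <= r + (m * (size t).-1)%:Z ->
  low kap r (dops (vpairs (2 * m) t) (gs t) j) = 0.
Proof.
move=> kapE ut t0 jn nr; set L := vpairs _ _.
have sL : size L = (m * (size t * (size t).-1))%N.
  by apply: double_inj; rewrite size_vpairs -mulnA mul2n.
have [B rB] : exists B : nat, r + (size L)%:Z < B%:Z.
  by exists (absz (r + (size L)%:Z)).+1; lia.
rewrite dops_additive.
have -> : (fun j => low kap r (gs t j)) = bsum B t [ffun=> - m%:Z] r.
  apply/funext => j'; apply: low_gs_bsum; first by rewrite rmorphN opprK.
  by lia.
apply: (dops_bsum (B := B) (P := fun x => x = 0)) => //.
- by move=> x y -> ->; rewrite subr0.
- by move=> q; exact: mem_vpairs.
move=> e le ce se.
have ge x : - m%:Z <= e x by have := le x; rewrite ffunE.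
have ge2 x y : x \in t -> y \in t -> x != y -> 0 <= e x + e y.
  move=> xt yt xy; apply: le_trans (ce x y xy); rewrite !ffunE.
  have := @count_vpairs I (2 * m) (fun q => (q == (x, y)) || (q == (y, x))) t x y ut xt yt xy.
  by rewrite !eqxx orbT -/L; move: (count _ L) => N /(_ isT isT); lia.
have [x0 x0t hx0] : exists2 x0, x0 \in t & forall x, x \in t -> x != x0 -> 0 <= e x.
  have [/hasP[x xt ex]|] := boolP (has (fun x => e x < 0) t).
    by exists x => // y yt yx; have := ge2 y x yt xt yx; lia.
  rewrite -all_predC => /allP hall; case: t t0 hall {ut jn nr L sL rB se ge2 le ce} => // x t _ hall.
  exists x; first exact: mem_head.
  by move=> y yt _; have := hall y yt; rewrite /= -leNgt.
(* The exceptional index is bounded through [j x0 < n], the others by the degree of a polynomial. As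
   [e x0 >= - m], the bounds add up to at most n - 1 - m (k - 1) + size L, with k = size t, which is
   less than r + size L. *)
apply: (@bsum_bound _ _ _ _ _ (fun x => if x == x0 then n%:Z - 1 else e x)).
  move=> x a xt nz aj; case: eqP => [_|/eqP xx0]; first by have := jn x xt; lia.
  rewrite leNgt; apply: contra nz => ea; apply/eqP; apply: binc_gt => //.
  exact: hx0.
rewrite (bigD1_seq x0) //= eqxx.
rewrite (eq_bigr e); last by move=> x /negbTE ->.
move: se; rewrite (bigD1_seq x0) //= [X in _ = X + _ -> _](_ : _ = - (m * size t)%:Z).
  rewrite sL; move: nr (ge x0); case: (size t) t0 => // s _ /=; rewrite mulnS.
  by move: (\sum_(_ <- _ | _) _) (m * s)%N (m * (s.+1 * s))%N (e x0) => S A D ex0; lia.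
under eq_bigr do rewrite ffunE; rewrite big_const_seq count_predT iter_addr_0.
by rewrite pmulrn mulrzz mulNr -PoszM.
Qed.

End Vanishing.

(** * The positive definite form *)

Section Form.
Context (C : numClosedFieldType) (m : nat).
Local Notation F := (fock C).
Local Notation ket := (ket C).
Local Notation vac := (vac C).
Local Notation h := (heisL C m).
Local Notation alpha := (alpha C m).
Local Notation gen := (gen h alpha).
Local Notation low := (low h).
Implicit Types (p : int) (A : {mset nat}%mset) (u v : F) (b : fock_index).

(** Squared norm of a basis vector: the usual Fock norm with every [a.+1] halved, which makes
    h_(a+1) / 2 the adjoint of h_(-a-1). *)
Definition mnorm A : C :=
  \prod_(a <- finsupp A) ((A a)`!%:R * (a.+1%:R / 2) ^+ A a).

Lemma mnorm_gt0 A : 0 < mnorm A.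
Proof.
apply: prodr_gt0 => a _; rewrite mulr_gt0 ?ltr0n ?fact_gt0 // exprn_gt0 //.
by rewrite divr_gt0 ?ltr0n.
Qed.

Lemma mnorm_widen A (D : {fset nat}) : (finsupp A `<=` D)%fset ->
  mnorm A = \prod_(a <- D) ((A a)`!%:R * (a.+1%:R / 2) ^+ A a).
Proof.
move=> AD; apply: big_fset_incl => // a _; rewrite memNfinsupp => /eqP Aa.
by rewrite Aa fact0 expr0 mulr1.
Qed.

Lemma mnorm1D n A :
  mnorm (n +` A)%mset = (n.+1 * (A n).+1)%:R / 2 * mnorm A.
Proof.
pose D := (n |` finsupp A)%fset.
rewrite (@mnorm_widen A D) ?fsubsetU1 // (@mnorm_widen (n +` A)%mset D); last first.
  apply/fsubsetP => a; rewrite !inE mem_finsupp mset1DE mem_finsupp.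
  by case: (a == n).
have nD : n \in D by rewrite fset1U1.
rewrite [LHS](big_fsetD1 n nD) [in RHS](big_fsetD1 n nD) /=.
rewrite [X in _ * X = _](eq_big_seq (fun a => (A a)`!%:R * (a.+1%:R / 2) ^+ A a)); last first.
  by move=> a; rewrite !inE mset1DE => /andP[/negbTE ->].
rewrite mset1DE eqxx add1n factS exprS !natrM [RHS]mulrA; congr (_ * _).
by move: n.+1%:R (A n).+1%:R (A n)`!%:R (_ ^+ _) => x y z w; ring.
Qed.

Definition form u v : C := \sum_(b <- msupp u) u@_b * (mnorm b.2 * (v@_b)^*).

Lemma form_widen u v (D : {fset fock_index}) : (msupp u `<=` D)%fset ->
  form u v = \sum_(b <- D) u@_b * (mnorm b.2 * (v@_b)^*).
Proof.
move=> uD; apply: big_fset_incl => // b _ bu.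
by rewrite mcoeff_outdom // mul0r.
Qed.

Lemma formP a u u' v : form (a *: u + u') v = a * form u v + form u' v.
Proof.
pose D := (msupp (a *: u + u') `|` (msupp u `|` msupp u'))%fset.
have uD : (msupp u `<=` D)%fset by rewrite /D fsetUCA fsubsetUl.
have u'D : (msupp u' `<=` D)%fset by rewrite /D fsetUA fsubsetUr.
rewrite (form_widen _ uD) (form_widen _ u'D) (@form_widen _ v D) ?fsubsetUl //.
rewrite mulr_sumr -big_split; apply: eq_bigr => b _ /=.
by rewrite mcoeffD mcoeffZ mulrDl -mulrA.
Qed.

Lemma formPr a u v v' : form u (a *: v + v') = a^* * form u v + form u v'.
Proof.
rewrite mulr_sumr -big_split; apply: eq_bigr => b _ /=.
rewrite mcoeffD mcoeffZ rmorphD rmorphM /=; ring.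
Qed.

Lemma form0l v : form 0 v = 0.
Proof. by rewrite /form msupp0 big_seq_fset0. Qed.

Lemma form0r u : form u 0 = 0.
Proof. by rewrite /form big1 // => b _; rewrite mcoeff0 conjC0 !mulr0. Qed.

Lemma formDl u u' v : form (u + u') v = form u v + form u' v.
Proof. by rewrite -[u]scale1r formP mul1r scale1r. Qed.

Lemma formZl a u v : form (a *: u) v = a * form u v.
Proof. by rewrite -[a *: u]addr0 formP form0l addr0. Qed.

Lemma formDr u v v' : form u (v + v') = form u v + form u v'.
Proof. by rewrite -[v]scale1r formPr conjC1 mul1r scale1r. Qed.

Lemma formZr a u v : form u (a *: v) = a^* * form u v.
Proof. by rewrite -[a *: v]addr0 formPr form0r addr0. Qed.

Lemma form_suml (T : Type) (r : seq T) (P : pred T) (G : T -> F) v :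
  form (\sum_(i <- r | P i) G i) v = \sum_(i <- r | P i) form (G i) v.
Proof. by apply: (big_morph (form^~ v)) => [x y|]; rewrite ?formDl ?form0l. Qed.

Lemma form_sumr (T : Type) (r : seq T) (P : pred T) (G : T -> F) u :
  form u (\sum_(i <- r | P i) G i) = \sum_(i <- r | P i) form u (G i).
Proof. by apply: (big_morph (form u)) => [x y|]; rewrite ?formDr ?form0r. Qed.

Lemma form_ket b v : form (ket b.1 b.2) v = mnorm b.2 * (v@_b)^*.
Proof.
rewrite (form_widen _ msuppU_le) big_seq_fset1 -surjective_pairing.
by rewrite mcoeffUU mul1r.
Qed.

Lemma form_eq0 v : form v v = 0 -> v = 0.
Proof.
move/eqP; rewrite /form (eq_bigr (fun b => mnorm b.2 * `|v@_b| ^+ 2)); last first.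
  by move=> b _; rewrite normCK mulrCA.
rewrite psumr_eq0; last first.
  by move=> b _; rewrite mulr_ge0 ?exprn_ge0 // ltW ?mnorm_gt0.
move/allP => h0; apply/malgP => b; rewrite mcoeff0.
have [bv|/mcoeff_outdom//] := boolP (b \in msupp v).
have := h0 b bv; rewrite /= mulf_eq0 gt_eqF ?mnorm_gt0 //= sqrf_eq0 normr_eq0.
by move/eqP.
Qed.

Lemma h_annihilE n v b :
  (h n.+1%:Z v)@_b = (n.+1 * (b.2 n).+1)%:R * v@_(b.1, (n +` b.2)%mset).
Proof.
rewrite [v]fock_expand linear_sum !raddf_sum mulr_sumr /=.
apply: eq_bigr => -[p A] _; case: b => q B /=.
rewrite linearZ /= !mcoeffZ mulrCA; congr (_ * _).
rewrite heis_annihil mcoeffZ !ketE !xpair_eqE.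
have [_|_] := eqVneq p q; last by rewrite !mulr0.
have [A0|An] := posnP (A n).
  rewrite A0 muln0 mul0r (_ : (A == (n +` B)%mset) = false) ?mulr0 //.
  by apply: contraTF isT => /eqP AB; move: A0; rewrite AB mset1DE eqxx.
have [AB|AB] := eqVneq A (n +` B)%mset.
  by rewrite AB msetD1K eqxx !mulr1 mset1DE eqxx.
rewrite mulr0 (_ : ((A `\ n)%mset == B) = false) ?mulr0 //.
apply: contraNF AB => /eqP <-; apply/eqP; rewrite msetB1K //.
by rewrite -mset_gt0.
Qed.

(* The annihilation operators are rescaled so that the adjoint of [gen r] is
   the coefficient of exp (alpha / 2 * \sum_(n > 0) h_n / n z^n). *)
Lemma form_create n u v : form (h (Negz n) u) v = 2^-1 * form u (h n.+1%:Z v).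
Proof.
rewrite [u]fock_expand linear_sum !form_suml mulr_sumr; apply: eq_bigr => b _.
rewrite linearZ !formZl mulrCA; congr (_ * _).
rewrite /= heis_create (form_ket (b.1, (n +` b.2)%mset)) form_ket h_annihilE.
rewrite /= mnorm1D [(_ * v@__)^*]rmorphM rmorph_nat /=.
by move: (mnorm b.2) (_%:R : C) (_ ^*) => x y z; ring.
Qed.

Lemma form_gen r u v : form (gen r u) v = form u (low (alpha / 2) r v).
Proof.
case: r => [r|r]; last by rewrite gen_lt0 // low_lt0 // form0l form0r.
elim/ltn_ind: r u v => -[|r] IH u v; first by rewrite gen0 low0.
have r0 : (r.+1%:Z)%:~R != 0 :> C by rewrite intr_eq0.
apply: (mulfI r0); rewrite -formZl (@gen_rec _ _ _ _ (h_comm m) _ r.+2); last by lia.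
have -> : (r.+1%:Z)%:~R = ((r.+1%:Z)%:~R)^* :> C by rewrite -pmulrn conjC_nat.
rewrite -formZr (@low_rec _ _ _ (h_comm m) _ _ r.+2); last by lia.
rewrite formZl formZr form_suml form_sumr !mulr_sumr.
apply: eq_big_nat => -[//|i] /andP[_ ir].
have -> : - i.+1%:Z = Negz i by lia.
have -> : r.+1%:Z - i.+1%:Z = (r.+1 - i.+1)%N by lia.
rewrite form_create IH; last by lia.
have -> : (alpha / 2)^* = alpha / 2.
  by apply: geC0_conj; rewrite divr_ge0 ?alpha_ge0 ?ler0n.
by rewrite mulrA (h_low (h_comm m)).
Qed.

End Form.

(** * Leading terms of products of [gen] *)

Section Leading.
Context (C : numClosedFieldType) (m : nat).
Local Notation F := (fock C).
Local Notation ket := (ket C).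
Local Notation vac := (vac C).
Local Notation h := (heisL C m).
Local Notation alpha := (alpha C m).
Local Notation gen := (gen h alpha).
Local Notation gs := (gs h alpha).
Implicit Types (p : int) (A : {mset nat}%mset) (u v : F) (b : fock_index).

Hypothesis m_gt0 : (0 < m)%N.

Definition msz A : nat := size A.

Definition fil (s : nat) v := forall b, v@_b != 0 -> (s <= msz b.2)%N.

Lemma fil_subsp s : subsp (fil s).
Proof.
split=> [b|a u v hu hv b]; first by rewrite mcoeff0 eqxx.
rewrite mcoeffD mcoeffZ => nz; have [u0|/hu//] := eqVneq u@_b 0.
by apply: hv; apply: contraNneq nz => ->; rewrite u0 mulr0 addr0.
Qed.

Lemma fil_scale s a v : fil s v -> fil s (a *: v).
Proof. by move=> hv; apply: (subsp_scale a (fil_subsp s)). Qed.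

Lemma fil_add s u v : fil s u -> fil s v -> fil s (u + v).
Proof. by move=> hu hv; apply: (subsp_add (fil_subsp s)). Qed.

Lemma fil_ket p A : fil (msz A) (ket p A).
Proof. by move=> b; rewrite ketE; case: ((p, A) =P b) => [<-|_]; rewrite ?eqxx. Qed.

Lemma filW s s' v : (s' <= s)%N -> fil s v -> fil s' v.
Proof. by move=> ss hv b /hv; apply: leq_trans. Qed.

Lemma fil_create s n v : fil s v -> fil s.+1 (h (Negz n) v).
Proof.
move=> hv; rewrite [v]fock_expand linear_sum.
apply: (subsp_sum (fil_subsp _)) => b bv _; rewrite linearZ; apply: fil_scale.
rewrite (h_create C m n b.1 b.2); apply: (filW _ (@fil_ket b.1 _)).
by rewrite /msz size1D ltnS; apply: hv; rewrite mcoeff_neq0.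
Qed.

(** The linear term of the exponential is the only one with a single creation operator; products of
    two or more go further into the filtration. *)
Lemma fil_gen_lead s (r : nat) v : fil s v ->
  exists2 w, fil s.+2 w & gen r.+1 v = (alpha / r.+1%:R) *: h (Negz r) v + w.
Proof.
elim/ltn_ind: r s v => r IH s v hv.
have r0 : (r.+1%:Z)%:~R != 0 :> C by rewrite intr_eq0.
exists (r.+1%:R^-1 *: (alpha *: \sum_(1 <= i < r.+1) h (- i%:Z) (gen (r.+1%:Z - i%:Z) v))).
  apply/fil_scale/fil_scale/(subsp_sum (fil_subsp _)) => -[|i].
    by rewrite mem_index_iota.
  rewrite mem_index_iota => /andP[_ ir] _.
  have -> : - i.+1%:Z = Negz i by lia.
  have -> : r.+1%:Z - i.+1%:Z = (r - i.+1).+1 by lia.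
  apply: fil_create; have [|w hw ->] := IH (r - i.+1)%N _ s v hv; first by lia.
  by apply: fil_add; [apply/fil_scale/fil_create|apply: filW hw].
apply: (scalerI r0); rewrite (@gen_rec _ _ _ _ (h_comm m) _ r.+2); last by lia.
rewrite big_nat_recr //= subrr gen0 addrC -pmulrn !scalerDr !scalerA.
by rewrite mulrA [_ * alpha]mulrC mulfK ?divff ?mul1r ?pnatr_eq0 //.
Qed.

Lemma fil_gen s (r : nat) v : fil s v -> fil s.+1 (gen r.+1 v).
Proof.
move=> hv; have [w hw ->] := fil_gen_lead r hv.
by apply: fil_add; [apply/fil_scale/fil_create|apply: filW hw].
Qed.

Context (I : finType).
Local Notation J := {ffun I -> int}.
Implicit Types (t : seq I) (j : J).

(** Zero exponents leave no trace because g_0 is the identity. *)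
Definition ms t j : {mset nat}%mset :=
  foldr (fun i A => if j i is Posz n.+1 then (n +` A)%mset else A) mset0 t.

(** Products of g's are thus triangular with respect to the number of creation operators: the
    shortest term records the multiset of nonzero exponents. *)
Lemma gs_lead p t j : (forall i, 0 <= j i) ->
  exists c w, [/\ c != 0, fil (msz (ms t j)).+1 w
    & gs (vac p) t j = c *: ket p (ms t j) + w].
Proof.
move=> j0; elim: t => [|i t [c [w [c0 hw IH]]]] /=.
  exists 1, 0; split; rewrite ?oner_eq0 ?scale1r ?addr0 //.
  by case: (fil_subsp (msz mset0).+1).
have := j0 i; rewrite IH; case: (j i) => // -[|r] _.
  by exists c, w; rewrite gen0.
have [w' hw' e] := fil_gen_lead r (@fil_ket p (ms t j)).
exists (c * (alpha / r.+1%:R)), (c *: w' + gen r.+1 w); split.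
- by rewrite mulf_neq0 // mulf_neq0 ?invr_eq0 ?pnatr_eq0 ?alpha_neq0.
- rewrite /msz size1D; apply: fil_add; first exact: fil_scale.
  exact: fil_gen.
- by rewrite linearD /= genZ e scalerDr scalerA (h_create C m r p) addrA.
Qed.

Lemma gs_coef_ms p t j : (forall i, 0 <= j i) ->
  (gs (vac p) t j)@_(p, ms t j) != 0.
Proof.
move=> /(gs_lead p t)[c [w [c0 hw ->]]]; rewrite mcoeffD mcoeffZ ketE eqxx mulr1.
suff -> : w@_(p, ms t j) = 0 by rewrite addr0.
by apply/eqP/negPn/negP => /hw; rewrite ltnn.
Qed.

Lemma gs_coef_eq0 p t j A : (forall i, 0 <= j i) -> (msz A <= msz (ms t j))%N ->
  A != ms t j -> (gs (vac p) t j)@_(p, A) = 0.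
Proof.
move=> /(gs_lead p t)[c [w [c0 hw ->]]] sA nA.
rewrite mcoeffD mcoeffZ ketE xpair_eqE eqxx eq_sym (negbTE nA) mulr0 add0r.
by apply/eqP/negPn/negP => /hw /=; rewrite ltnNge sA.
Qed.

Lemma msE t j a : (ms t j) a = count (fun i => j i == a.+1%:Z) t.
Proof.
elim: t => [|i t IH] /=; first by rewrite mset0E.
case: (j i) => [[|n]|n] //=; rewrite -?IH // mset1DE eqz_nat eqSS.
by rewrite eq_sym.
Qed.

Lemma msz_ms t j : (forall i, 0 <= j i) -> msz (ms t j) = count (fun i => j i != 0) t.
Proof.
move=> j0; elim: t => [|i t IH] /=; first by rewrite /msz enum_mset0.
have := j0 i; case: (j i) => // -[|n] _; first by rewrite eqxx.
by rewrite /msz size1D; congr S; exact: IH.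
Qed.

End Leading.

(** * Positivity *)

Section Symmetry.
Context (I : finType).
Local Notation J := {ffun I -> int}.
Implicit Types (i l : I) (j : J) (L : seq (I * I)) (s t : seq I) (c : nat).

Definition swap (q : I * I) : I * I := (q.2, q.1).

Lemma dops_swap (V : zmodType) L (u : J -> V) : dops (map swap L) u
  = if odd (size L) then fun j => - dops L u j else dops L u.
Proof.
elim: L => //= q L ->; rewrite df_swap; case: (odd _) => /=; last by [].
by apply/funext => j; rewrite /df opprB opprK addrC.
Qed.

Definition vcross c s t := flatten [seq vrow c i t | i <- s].

Lemma count_vcross c s t (P : pred (I * I)) :
  count P (vcross c s t) = (\sum_(i <- s) \sum_(l <- t) c * P (i, l))%N.
Proof.
elim: s => [|i s IH]; first by rewrite big_nil.
by rewrite big_cons count_cat IH count_vrow.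
Qed.

Lemma count_vpairs_cat c s t (P : pred (I * I)) :
  count P (vpairs c (s ++ t))
  = (count P (vpairs c s) + count P (vpairs c t) + count P (vcross c s t))%N.
Proof.
elim: s => [|i s IH] /=; first by rewrite addn0.
rewrite !count_cat IH !count_vrow big_cat /=.
set a := count _ _; set b := count _ _; set d := count _ _.
set x := (\sum_(_ <- s) _)%N; set y := (\sum_(_ <- t) _)%N.
by lia.
Qed.

Lemma count_vpairsD (a b : nat) t (P : pred (I * I)) :
  count P (vpairs (a + b) t) = (count P (vpairs a t) + count P (vpairs b t))%N.
Proof.
elim: t => //= i t IH; rewrite !count_cat IH !count_vrow.
rewrite -addnACA -big_split; congr (_ + _)%N.
by apply: eq_bigr => l _; rewrite mulnDl.
Qed.

Lemma vpairs_neq c t : uniq t -> all (fun q => q.1 != q.2) (vpairs c t).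
Proof.
elim: t => //= i t IH /andP[it ut]; rewrite all_cat (IH ut).
by apply/allP => q /mem_vrow[-> qt]; apply: contraNneq it => ->.
Qed.

Lemma size_vcross c s t : size (vcross c s t) = (size s * (c * size t))%N.
Proof. by elim: s => //= i s IH; rewrite size_cat IH size_vrow. Qed.

(** Swapping the ends changes the sign once per factor, and the number of factors is even. *)
Lemma dops_vcrossC (V : zmodType) m s t (u : J -> V) :
  dops (vcross (2 * m) t s) u = dops (vcross (2 * m) s t) u.
Proof.
transitivity (dops (map swap (vcross (2 * m) s t)) u); last first.
  by rewrite dops_swap size_vcross mulnA mulnCA -!mulnA oddM.
apply: perm_dops; apply/seq.permP => P; rewrite count_map !count_vcross exchange_big.
by [].
Qed.

(** An even power of the Vandermonde product is symmetric; it suffices to exchange adjacent blocks,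
    which only reorients the cross factors. *)
Lemma perm_vpairs (V : zmodType) m s t (u : J -> V) : perm_eq s t ->
  dops (vpairs (2 * m) s) u = dops (vpairs (2 * m) t) u.
Proof.
move: s t; apply: (catCA_perm_subst (F := fun s => dops (vpairs (2 * m) s) u)).
move=> s1 s2 s3; set c := (2 * m)%N.
have E x y : dops (vpairs c (x ++ y ++ s3)) u
    = dops (vpairs c x ++ vpairs c y ++ vpairs c s3
            ++ vcross c x s3 ++ vcross c y s3) (dops (vcross c x y) u).
  rewrite -dops_cat; apply: perm_dops; apply/seq.permP => P.
  rewrite !(count_cat, count_vpairs_cat) (_ : count P (vcross c x (y ++ s3))
    = count P (vcross c x y) + count P (vcross c x s3))%N.
    move: (count P (vpairs c x)) (count P (vpairs c y)) (count P (vpairs c s3))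
      (count P (vcross c y s3)) (count P (vcross c x s3)) (count P (vcross c x y)).
    by move=> *; lia.
  by rewrite !count_vcross -big_split; apply: eq_bigr => i _; rewrite big_cat.
rewrite !E dops_vcrossC; apply: perm_dops; apply/seq.permP => P.
rewrite !count_cat; move: (count P (vpairs c s1)) (count P (vpairs c s2))
  (count P (vpairs c s3)) (count P (vcross c s1 s3)) (count P (vcross c s2 s3)).
by move=> *; lia.
Qed.

Definition pj (s : {perm I}) j : J := [ffun i => j (s i)].

Lemma pj_ep (s : {perm I}) j i : pj s (j - ep (s i)) = pj s j - ep i.
Proof. by apply/ffunP => x; rewrite !ffunE (inj_eq perm_inj). Qed.

Lemma dops_pj (V : zmodType) (s : {perm I}) L (u : J -> V) j :
  dops L u (pj s j) = dops [seq (s q.1, s q.2) | q <- L] (fun j => u (pj s j)) j.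
Proof.
by elim: L j => //= q L IH j; rewrite /df -!pj_ep !IH.
Qed.

Lemma map_vpairs (f : I -> I) c t :
  [seq (f q.1, f q.2) | q <- vpairs c t] = vpairs c (map f t).
Proof.
have map_vrow i s : [seq (f q.1, f q.2) | q <- vrow c i s] = vrow c (f i) (map f s).
  by elim: s => //= l s IH; rewrite map_cat IH map_nseq.
by elim: t => //= i t IH; rewrite map_cat IH map_vrow.
Qed.

Lemma perm_map_enum (s : {perm I}) : perm_eq (map s (enum I)) (enum I).
Proof.
apply: uniq_perm; rewrite ?(map_inj_uniq perm_inj) ?enum_uniq // => x.
rewrite mem_enum; apply/mapP; exists ((s^-1)%g x); rewrite ?mem_enum //.
by rewrite permKV.
Qed.

Lemma dops_vpairs_pj (V : zmodType) m (s : {perm I}) (u : J -> V) j :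
  dops (vpairs (2 * m) (enum I)) u (pj s j)
  = dops (vpairs (2 * m) (enum I)) (fun j => u (pj s j)) j.
Proof. by rewrite dops_pj map_vpairs (perm_vpairs _ _ (perm_map_enum s)). Qed.

(** Adjoint of [dops L] for the pairing of functions of [j]: every shift is replaced by its inverse,
    by conjugation with j -> - j. *)
Definition dopsa (V : zmodType) L (u : J -> V) : J -> V :=
  fun j => dops L (fun j => u (- j)) (- j).

Lemma dopsa_cons (V : zmodType) q L (u : J -> V) j :
  dopsa (q :: L) u j = dopsa L u (j + ep q.1) - dopsa L u (j + ep q.2).
Proof. by rewrite /dopsa /= /df !opprD. Qed.

Lemma dopsa_vpairs_pj (V : zmodType) m (s : {perm I}) (u : J -> V) j :
  dopsa (vpairs (2 * m) (enum I)) u (pj s j)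
  = dopsa (vpairs (2 * m) (enum I)) (fun j => u (pj s j)) j.
Proof.
rewrite /dopsa; have pjN j' : - pj s j' = pj s (- j').
  by apply/ffunP => x; rewrite !ffunE.
by rewrite pjN dops_vpairs_pj; congr (dops _ _ _); apply/funext => j'; rewrite pjN.
Qed.

Definition kap L : J := \sum_(q <- L) (ep q.1 + ep q.2).

(* S_i S_l (S_i^-1 - S_l^-1) = S_l - S_i *)
Lemma dopsa_kap (V : zmodType) L (u : J -> V) j :
  dopsa L (fun j => u (j - kap L)) j = dops (map swap L) u j.
Proof.
rewrite /kap; elim: L u j => [|q L IH] u j.
  by rewrite big_nil /dopsa /= opprK subr0.
rewrite dopsa_cons big_cons /= /df.
have E j' : dopsa L (fun j => u (j - (ep q.1 + ep q.2 + \sum_(q <- L) (ep q.1 + ep q.2)))) j'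
    = dops [seq swap q | q <- L] u (j' - ep q.1 - ep q.2).
  transitivity (dopsa L (fun j => (fun j => u (j - ep q.1 - ep q.2))
      (j - \sum_(q <- L) (ep q.1 + ep q.2))) j').
    congr (dopsa _ _ _); apply/funext => j''; congr (u _).
    by rewrite opprD addrA addrAC opprD addrA.
  rewrite (IH (fun j => u (j - ep q.1 - ep q.2))).
  elim: [seq _ | _ <- _] j' => //= q' L' IH' j'.
  have e x : j' - x - ep q.1 - ep q.2 = j' - ep q.1 - ep q.2 - x.
    by rewrite [j' - x - _]addrAC [LHS]addrAC.
  by rewrite /df !IH' !e.
by rewrite !E addrK [j + ep q.2 - _]addrAC addrK.
Qed.

End Symmetry.

(** * Finitely supported functions and adjoints of difference operators *)

Section FormalSums.
Context (C : numClosedFieldType) (I : finType).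
Local Notation J := {ffun I -> int}.
Implicit Types (i l : I) (j nu : J) (L : seq (I * I)) (X Y Z : seq (C * J)).

(* [X] stands for the finitely supported function [coef X]. *)
Definition pair (V : lmodType C) X (u : J -> V) : V := \sum_(q <- X) q.1 *: u q.2.

Definition coef X nu : C := \sum_(q <- X) q.1 *+ (q.2 == nu).

Lemma coef_out X nu : nu \notin map snd X -> coef X nu = 0.
Proof.
move=> nX; rewrite /coef big_seq big1 // => q qX.
case: eqP => // qn; case/negP: nX; rewrite -qn; exact: map_f.
Qed.

Lemma pair_coef (V : lmodType C) X (u : J -> V) :
  pair X u = \sum_(nu <- undup (map snd X)) coef X nu *: u nu.
Proof.
rewrite (eq_bigr (fun nu => \sum_(q <- X) (q.1 *+ (q.2 == nu)) *: u nu)); last first.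
  by move=> nu _; rewrite scaler_suml.
rewrite exchange_big /pair !big_seq; apply: eq_bigr => q qX.
rewrite (bigD1_seq q.2) ?undup_uniq ?mem_undup ?map_f //= eqxx mulr1n.
by rewrite big1 ?addr0 // => nu /negbTE; rewrite eq_sym => ->; rewrite scale0r.
Qed.

(** Here and below, the transpose of an operator on functions is realized on lists, together with
    its effect on coefficients. [V] stays general because both Fock-valued and scalar functions get
    paired. *)
Lemma adj_shift (k : J) X : exists Y,
  (forall (V : lmodType C) (u : J -> V), pair Y u = pair X (fun j => u (j + k)))
  /\ forall nu, coef Y nu = coef X (nu - k).
Proof.
exists [seq (q.1, q.2 + k) | q <- X]; split=> [V u|nu].
  by rewrite /pair big_map.
by rewrite /coef big_map; apply: eq_bigr => q _; rewrite /= eq_sym -subr_eq eq_sym.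
Qed.

Lemma adj_opp X : exists Y,
  (forall (V : lmodType C) (u : J -> V), pair Y u = pair X (fun j => u (- j)))
  /\ forall nu, coef Y nu = coef X (- nu).
Proof.
exists [seq (q.1, - q.2) | q <- X]; split=> [V u|nu].
  by rewrite /pair big_map.
by rewrite /coef big_map; apply: eq_bigr => q _; rewrite /= eqr_oppLR.
Qed.

Lemma dopsa_df (V : zmodType) (q : I * I) L (u : J -> V) nu :
  dopsa (q :: L) u nu = dopsa L (fun j => u (j + ep q.1) - u (j + ep q.2)) nu.
Proof.
rewrite /dopsa /= df_dops; congr (dops _ _ _); apply/funext => j.
by rewrite /df !opprB ![_ - j]addrC.
Qed.

Lemma adj_dops L X : exists Y,
  (forall (V : lmodType C) (u : J -> V), pair Y u = pair X (dops L u))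
  /\ forall nu, coef Y nu = dopsa L (coef X) nu.
Proof.
elim: L X => [|q L IH] X; first by exists X; split=> // nu; rewrite /dopsa /= opprK.
pose X' := [seq (x.1, x.2 - ep q.1) | x <- X] ++ [seq (- x.1, x.2 - ep q.2) | x <- X].
have [Y [hY cY]] := IH X'; exists Y; split=> [V u|nu].
  rewrite hY /pair big_cat /= !big_map -big_split /=; apply: eq_bigr => x _.
  by rewrite /df scalerBr scaleNr.
rewrite cY dopsa_df; congr (dopsa _ _ _); apply/funext => j.
rewrite /coef big_cat /= !big_map -sumrB -big_split /=; apply: eq_bigr => x _.
by rewrite mulNrn !subr_eq.
Qed.

Lemma adj_dopsa L X : exists Y,
  (forall (V : lmodType C) (u : J -> V), pair Y u = pair X (dopsa L u))
  /\ forall nu, coef Y nu = dops L (coef X) nu.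
Proof.
have [X1 [h1 c1]] := adj_opp X; have [X2 [h2 c2]] := adj_dops L X1.
have [Y [h c]] := adj_opp X2; exists Y; split=> [V u|nu].
  by rewrite h h2 h1.
rewrite c c2 /dopsa opprK; congr (dops _ _ _); apply/funext => j.
by rewrite c1 opprK.
Qed.

(** A function killed by S_i - S_l is constant along [ep i - ep l], so finite support forces it to
    vanish. *)
Lemma df_inj X i l : i != l -> (forall nu, df i l (coef X) nu = 0) ->
  forall nu, coef X nu = 0.
Proof.
move=> il X0 nu.
have step n : coef X nu = coef X (nu + (ep i - ep l) *+ n).
  elim: n => [|n ->]; first by rewrite addr0.
  have /eqP := X0 (nu + (ep i - ep l) *+ n + ep i); rewrite /df subr_eq0 addrK => /eqP ->.
  by rewrite mulrSr !addrA.
have [B hB] : exists B : nat, forall q, q \in X -> q.2 i < B%:Z.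
  elim: X {X0 step} => [|q X [B hB]]; first by exists 0%N.
  exists (B + absz (q.2 i)).+1 => q'; rewrite inE => /predU1P[->|/hB].
    by move: (q.2 i) => x; lia.
  by move: (q'.2 i) (q.2 i) => x y; lia.
(* This many steps push the i-th coordinate beyond the support. *)
rewrite (step (B + absz (nu i))%N); apply: coef_out; apply/mapP => -[q /hB + qE].
rewrite -qE !ffunE ffunMnE !ffunE eqxx (negbTE il) subr0 pmulrn mulrzz mul1r.
by move: (nu i) => x; lia.
Qed.

Lemma dops_inj L X : all (fun q => q.1 != q.2) L ->
  (forall nu, dops L (coef X) nu = 0) -> forall nu, coef X nu = 0.
Proof.
elim: L => //= q L IH /andP[q12 aL] X0; apply: IH => //.
have [Y [_ cY]] := adj_dopsa L X.
have cYE : coef Y = dops L (coef X) by apply/funext.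
by rewrite -cYE in X0 *; apply: df_inj q12 X0.
Qed.

(** Transposing [dopsa L] onto the conjugated list turns the pairing into the sum of the squared
    absolute values of [dops L (coef X)]. *)
Lemma dops_pos L X : all (fun q => q.1 != q.2) L ->
  pair [seq (q.1^*, q.2) | q <- X] (dopsa L (dops L (coef X) : J -> C^o)) = 0 ->
  forall nu, coef X nu = 0.
Proof.
move=> aL; set g := dops L (coef X); set X' := map _ X.
have cX' nu : coef X' nu = (coef X nu)^*.
  rewrite /coef big_map rmorph_sum; apply: eq_bigr => q _ /=.
  by rewrite rmorphMn.
have [Z [hZ cZ]] := adj_dopsa L X'.
have cZg nu : coef Z nu = (g nu)^*.
  rewrite cZ /g (dops_additive (Num.conj : {additive C -> C})).
  by congr (dops _ _ _); apply/funext => j; rewrite cX'.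
rewrite -hZ pair_coef => /eqP.
rewrite (eq_bigr (fun nu => `|g nu| ^+ 2)); last first.
  by move=> nu _; rewrite cZg normCKC.
rewrite psumr_eq0 => [/allP h0|nu _]; last by rewrite exprn_ge0.
apply: dops_inj aL _ => nu; rewrite -/(g nu).
have [nuZ|/coef_out/eqP] := boolP (nu \in map snd Z).
  have := h0 nu; rewrite mem_undup => /(_ nuZ) /=.
  by rewrite sqrf_eq0 normr_eq0 => /eqP.
by rewrite cZg conjC_eq0 => /eqP.
Qed.

End FormalSums.

Section KapVpairs.
Context (I : finType).
Implicit Types (t : seq I) (c : nat).

Lemma kap_cat (L1 L2 : seq (I * I)) : kap (L1 ++ L2) = kap L1 + kap L2.
Proof. exact: big_cat. Qed.

Lemma kap_vrow c i t x :
  kap (vrow c i t) x = (c * size t * (x == i) + c * count_mem x t)%:Z.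
Proof.
elim: t => [|l t IH]; first by rewrite /kap big_nil ffunE !muln0.
rewrite /vrow /= -/(vrow c i t) kap_cat ffunE IH /kap.
have -> : (\sum_(q <- nseq c (i, l)) (ep q.1 + ep q.2)) x
    = (c * ((x == i) + (l == x)))%:Z.
  rewrite big_nseq iter_addr_0 ffunMnE !ffunE [x == l]eq_sym -PoszD.
  by rewrite pmulrn mulrzz -PoszM mulnC.
by rewrite -PoszD; congr (Posz _); rewrite mulnS; ring.
Qed.

(** Every index lies in (size t).-1 pairs; for c = m this is the source of the shift m (k - 1). *)
Lemma kap_vpairs c t x : uniq t ->
  kap (vpairs c t) x = ((x \in t) * (c * (size t).-1))%:Z.
Proof.
elim: t => [|i t IH] /=; first by rewrite /kap big_nil ffunE.
move=> /andP[it ut]; rewrite kap_cat ffunE (IH ut) kap_vrow inE count_uniq_mem //.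
rewrite -PoszD; congr (Posz _); case: eqP => [->|_] /=.
  by rewrite (negbTE it) mul0n muln0 muln1 mul1n addn0.
case: (boolP (x \in t)) => [xt|_]; last by rewrite !mul0n !muln0.
case: t xt {IH it ut} => // y t _ /=.
by rewrite !mul1n !muln0 muln1 mulnS addnC.
Qed.

End KapVpairs.

(** * Independence of symmetric families of words *)

Section Independence.
Context (C : numClosedFieldType) (m : nat) (k : nat).
Local Notation F := (fock C).
Local Notation I := 'I_k.
Local Notation J := {ffun I -> int}.
Local Notation vac := (vac C).
Local Notation h := (heisL C m).
Local Notation alpha := (alpha C m).
Local Notation T := (enum I).
Local Notation gs p := (gs h alpha (vac p) T).
Implicit Types (p : int) (j nu mu : J) (X Y : seq (C * J)).

Hypothesis m_gt0 : (0 < m)%N.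

Lemma gs_pj p (s : {perm I}) j : gs p (pj s j) = gs p j.
Proof.
rewrite -[RHS](perm_gs _ (h_comm m) _ _ (perm_map_enum s)).
by elim: T => // i t IH; rewrite map_cons !gs_cons IH ffunE.
Qed.

Lemma ms_pj nu mu : (forall i, 0 <= nu i) -> (forall i, 0 <= mu i) ->
  ms T nu = ms T mu -> exists s : {perm I}, nu = pj s mu.
Proof.
move=> nu0 mu0 E.
pose tn := [tuple nu i | i < k]; pose tm := [tuple mu i | i < k].
(* The multiset [ms] forgets the zero exponents, but their number is recovered from [k]. *)
have cnt (f : J) v : (forall i, 0 <= f i) -> count_mem v [tuple f i | i < k]
    = match v with Posz n.+1 => (ms T f) n | Posz 0 => (k - size (ms T f))%N | _ => 0%N end.
  move=> f0; rewrite count_map; case: v => [[|n]|n].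
  - transitivity (count (predC (fun i => f i != 0)) T).
      by apply: eq_count => i /=; rewrite negbK.
    have := count_predC (fun i => f i != 0) T; rewrite size_enum_ord -msz_ms // /msz.
    by move: (count _ _) (size _) => a b; lia.
  - by rewrite msE; apply: eq_count.
  - rewrite (eq_count (a2 := pred0)) ?count_pred0 // => i /=.
    by have := f0 i; case: (f i).
have /tuple_permP[s sE] : perm_eq tn tm.
  by apply/allP => v _ /=; rewrite !cnt // E.
exists s; apply/ffunP => i; rewrite ffunE.
have := congr1 (fun t => nth 0 t i) sE.
by rewrite -!tnth_nth !tnth_mktuple.
Qed.

(** Induction on the number of nonzero exponents of [mu], reading the coefficient of the shortest
    ket of [gs p mu]. Terms with a negative exponent are zero, those with fewer nonzero exponents
    have coefficient zero by induction, and those with at least as many but another multiset do not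
    contain this ket. The remaining ones are permutations of [mu] and contribute equally by
    symmetry. *)
Lemma gs_indep p Y : (forall s nu, coef Y (pj s nu) = coef Y nu) ->
  pair Y (gs p) = 0 -> forall mu, (forall i, 0 <= mu i) -> coef Y mu = 0.
Proof.
move=> Ysym Y0 mu; move: {2}(msz (ms T mu)) (leqnn (msz (ms T mu))) => N.
elim/ltn_ind: N mu => N IH mu muN mu0.
have [muY|/coef_out//] := boolP (mu \in map snd Y).
apply/eqP/negPn/negP => cY; pose b : fock_index := (p, ms T mu).
pose P nu := `[<forall i, 0 <= nu i>] && (ms T nu == ms T mu).
have : \sum_(nu <- undup (map snd Y)) coef Y nu * (gs p nu)@_b = 0.
  have : (pair Y (gs p))@_b = 0 by rewrite Y0 mcoeff0.
  rewrite pair_coef raddf_sum => E0; rewrite -[RHS]E0; apply: eq_bigr => nu _.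
  by rewrite /= mcoeffZ.
rewrite (eq_bigr (fun nu => (coef Y mu * (gs p mu)@_b) *+ P nu)); last first.
  move=> nu _; rewrite /P; case: asboolP => [nu0|nn0] /=; last first.
    have /existsNP[i /negP] := nn0; rewrite -ltNge => i0.
    by rewrite (gs_lt0 _ _ _ (mem_enum _ i) i0) mcoeff0 mulr0.
  case: eqP => [E|/eqP nE].
    have [s ->] := ms_pj nu0 mu0 E.
    by rewrite Ysym gs_pj.
  have [lt|le] := ltnP (msz (ms T nu)) (msz (ms T mu)).
    by rewrite (IH (msz (ms T nu))) ?mul0r //; apply: leq_trans lt muN.
  by rewrite gs_coef_eq0 ?mulr0 // eq_sym.
rewrite sumrMnr => /eqP; rewrite mulrn_eq0 mulf_eq0 (negbTE cY).
rewrite (negbTE (gs_coef_ms _ m_gt0 p T mu0)) orbF.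
rewrite (bigD1_seq mu) ?mem_undup ?undup_uniq //= /P eqxx andbT.
by case: asboolP.
Qed.

(* The invariance of [X] under permutations makes that of its image [Y] under the
   adjoint of the shifted [dops], so [Y] vanishes on the nonnegative orthant,
   and pairing it with [X] gives a sum of squares. *)
Lemma words_indep p X : (forall s nu, coef X (pj s nu) = coef X nu) ->
  (forall q i, q \in X -> 0 <= q.2 i) ->
  pair X (fun j => dops (vpairs (2 * m) T) (gs p) (j + kap (vpairs m T))) = 0 ->
  forall nu, coef X nu = 0.
Proof.
set kp := kap _ => Xsym Xge X0.
have kps (s : {perm I}) : pj s kp = kp.
  by apply/ffunP => i; rewrite ffunE /kp !kap_vpairs ?enum_uniq // !mem_enum.
have [X1 [h1 c1]] := adj_shift kp X; have [Y [hY cY]] := adj_dops (vpairs (2 * m) T) X1.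
have Ysym s nu : coef Y (pj s nu) = coef Y nu.
  rewrite !cY dopsa_vpairs_pj; congr (dopsa _ _ _); apply/funext => j.
  rewrite !c1 -(Xsym s (j - kp)); congr (coef X _).
  apply/ffunP => i; rewrite !ffunE; congr (_ - _).
  by rewrite -[in LHS](kps s) ffunE.
have Y0 : pair Y (gs p) = 0 by rewrite hY h1.
have Yge := gs_indep Ysym Y0.
set L := vpairs m T in kp kps h1 c1 Yge X0 *.
(* By [dopsa_kap], the shift by [kp] turns one half of each 2m-th power, in adjoint form, into
   differences with swapped ends; the other half remains an adjoint. *)
have cYE : coef Y = dopsa L (dops (map (@swap _) L) (coef X)).
  apply/funext => nu; rewrite cY.
  have -> : dops (map (@swap _) L) (coef X) = dopsa L (coef X1).
    by apply/funext => j; rewrite -dopsa_kap; congr (dopsa _ _ _); apply/funext.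
  rewrite /dopsa -[X in _ = dops _ X _](_ : dops L (fun j => coef X1 (- j)) = _); last first.
    by apply/funext => j; rewrite opprK.
  rewrite -dops_cat; congr (_ _); apply: perm_dops; apply/seq.permP => P.
  by rewrite mul2n -addnn count_vpairsD count_cat.
have S0 : pair [seq (q.1^*, q.2) | q <- X] (coef Y : J -> C^o) = 0.
  rewrite /pair big_map big_seq big1 // => q qX.
  by rewrite [coef Y _]Yge => [|i]; [exact: scaler0|exact: Xge qX].
apply: (@dops_pos _ _ L); first by apply: vpairs_neq; exact: enum_uniq.
move: S0; rewrite cYE dops_swap; case: ifP => // _.
rewrite /dopsa dopsN /pair => S0; apply/eqP; rewrite -oppr_eq0 -sumrN.
by apply/eqP; rewrite -[RHS]S0; apply: eq_bigr => q _; rewrite scalerN.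
Qed.

End Independence.

(** * Partitions in a box *)

(* Partitions with [k] parts, possibly zero, all smaller than [M]. *)
Fixpoint box (k M : nat) : seq (seq nat) :=
  if k is k'.+1 then
    (fix boxS M := if M is M'.+1 then boxS M' ++ [seq M' :: s | s <- box k' M'.+1]
                   else [::]) M
  else [:: [::]].

(** Parts are listed in decreasing order, so either all are smaller than [M] or the first one is
    [M]: the Pascal recursion behind both counts. *)
Lemma boxSS k M : box k.+1 M.+1 = box k.+1 M ++ [seq M :: s | s <- box k M.+1].
Proof. by []. Qed.

Lemma box0 M : box 0 M = [:: [::]].
Proof. by []. Qed.

Lemma boxS0 k : box k.+1 0 = [::].
Proof. by []. Qed.

Lemma mem_box k M s :
  (s \in box k M) = [&& size s == k, sorted geq s & all (fun a => a < M)%N s].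
Proof.
elim: k M s => [|k IHk] M s.
  by rewrite box0 inE; case: s.
elim: M s => [|M IHM] s.
  by rewrite boxS0 in_nil; case: s => //= a s; rewrite !andbF.
rewrite boxSS mem_cat IHM; case: s => [|a s].
  by apply/negbTE; rewrite negb_or /=; apply/mapP => -[].
have geq_tr : transitive geq by move=> x y z /= yx zy; exact: leq_trans zy yx.
have -> : (a :: s \in [seq M :: s0 | s0 <- box k M.+1])
    = (a == M) && (s \in box k M.+1).
  apply/mapP/andP => [[s' s'b [-> ->]]|[/eqP -> sb]]; first by rewrite eqxx.
  by exists s.
rewrite IHk /= eqSS !(path_sortedE geq_tr) -!andbA.
have [_|_] := eqVneq (size s) k; rewrite ?andbF //=.
have [|] := boolP (sorted geq s) => _; rewrite ?andbF ?orbF //=.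
rewrite ltnS; case: (ltngtP a M) => aM /=; rewrite ?andbF ?orbF //=.
  case: (boolP (all (geq a) s)) => //= h; apply/idP/idP => _; apply: sub_all h => x /= xa.
    by apply: leq_ltn_trans xa _; exact: ltnW.
  exact: leq_ltn_trans xa aM.
by rewrite aM; case: (boolP (all (geq M) s)) => h //; apply/negbTE.
Qed.

Lemma uniq_box k M : uniq (box k M).
Proof.
elim: k M => [|k IHk] M //; elim: M => [|M IHM] //.
rewrite boxSS cat_uniq IHM map_inj_uniq ?IHk ?andbT; last by move=> s s' [].
by apply/hasPn => s /mapP[s' _ ->]; rewrite mem_box /= ltnn !andbF.
Qed.

(** * Dimension of the span of the words of length k *)

Section Sector.
Context (C : numClosedFieldType) (m : nat) (p : int) (k n : nat) (D : pred nat).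
Local Notation F := (fock C).
Local Notation I := 'I_k.
Local Notation J := {ffun I -> int}.
Local Notation h := (heisL C m).
Local Notation alpha := (alpha C m).
Local Notation gen := (gen h alpha).
Local Notation low := (low h).
Local Notation T := (enum I).
Local Notation p' := (p - (2 * m * k)%:Z).
Local Notation gs := (gs h alpha (vac C p')).
Local Notation word := (@word C m I p T).
Local Notation M := (n - m * k.-1)%N.
Implicit Types (j : J) (s : seq nat) (v : F).

Hypothesis m_gt0 : (0 < m)%N.

(** The predicate [D] selects total exponents: [predT] keeps a whole charge, [pred1] a single
    degree. *)
Definition words : set F := [set v | exists j,
  [/\ forall i, 0 <= j i < n%:Z, D (absz (\sum_i j i)) & v = word j]].

Definition toJ s : J := [ffun i : I => (nth 0%N s i)%:Z].

(** Each of the [k] exponents of the word attached to [s] is shifted by m (k - 1), which accounts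
    for the constant. *)
Definition dbox : seq (seq nat) := [seq s <- box k M | D (sumn s + m * (k * k.-1))%N].

Definition nbox : seq (seq nat) := [seq s <- box k n | has (fun a => M <= a)%N s].

Definition nspan : set F := lspan [set v | exists2 s, s \in nbox & v = gs T (toJ s)].

Lemma size_vpairs_enum : size (vpairs (2 * m) T) = (m * (k * k.-1))%N.
Proof.
by apply: double_inj; rewrite size_vpairs size_enum_ord -mulnA mul2n.
Qed.

Lemma wordE j : word j = dops (vpairs (2 * m) T) (gs T) j.
Proof. by rewrite (word_gs _ m_gt0) ?enum_uniq // size_enum_ord. Qed.

Lemma toJ_sort j : (forall i, 0 <= j i) -> exists2 s, exists sg, toJ s = pj sg j
  & [/\ size s = k, sorted geq s, all (fun a => [exists i, a == absz (j i)]) s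
      & (sumn s)%:Z = \sum_i j i].
Proof.
move=> j0; pose t := [tuple absz (j i) | i < k].
have ps : perm_eq (sort geq t) t by rewrite perm_sort.
exists (sort geq t).
  have /tuple_permP[sg sE] := ps; exists sg; apply/ffunP => i; rewrite !ffunE sE.
  by rewrite -tnth_nth !tnth_mktuple gez0_abs.
split.
- by rewrite size_sort size_tuple.
- by apply: sort_sorted => x y; exact: leq_total.
- by rewrite all_sort; apply/allP => a /mapP[i _ ->]; apply/fintype.existsP; exists i.
- rewrite (perm_sumn ps) sumnE big_map big_enum /= (big_morph Posz PoszD (erefl 0)).
  by apply: eq_bigr => i _; rewrite gez0_abs.
Qed.

Lemma sum_toJ s : size s = k -> \sum_i toJ s i = (sumn s)%:Z.
Proof.
move=> sk; rewrite sumnE (big_nth 0%N) sk big_mkord (big_morph Posz PoszD (erefl 0)).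
by apply: eq_bigr => i _; rewrite ffunE.
Qed.

Lemma toJ_ge0 s i : 0 <= toJ s i. Proof. by rewrite ffunE. Qed.

Lemma nspan_subsp : subsp nspan. Proof. exact: lspan_subsp. Qed.

Lemma low_words (r : nat) v : (0 < k)%N -> (M <= r)%N -> lspan words v ->
  low (alpha / 2) r v = 0.
Proof.
move=> k0 Mr; apply: (lspan_min (V := [set v | low (alpha / 2) r v = 0])).
  by split=> [|a u w /= hu hw]; rewrite /= ?linear0 // linearP /= hu hw scaler0 addr0.
move=> _ [j [jn _ ->]] /=; rewrite wordE.
apply: (low_dops_eq0 (n := n) (h_comm m) (@h_vac C m p')).
- rewrite mulrAC -expr2 alpha_sqr natrM mulrC mulKf ?pnatr_eq0 //.
- exact: enum_uniq.
- by rewrite size_enum_ord.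
- by move=> i _; have /andP[] := jn i.
- by rewrite size_enum_ord; move: Mr; lia.
Qed.

Lemma words_nspan v : lspan words v -> nspan v -> v = 0.
Proof.
move=> Vv Nv; apply: form_eq0.
move: (Nv); apply: (lspan_min (V := [set u | form u v = 0])).
  by split=> [|a u w /= hu hw]; rewrite /= ?form0l // formP hu hw mulr0 addr0.
move=> _ [s + ->] /=; rewrite mem_filter => /andP[/hasP[a /(nthP 0%N)[i ik <-] Ma]].
rewrite mem_box => /and3P[/eqP sk _ _]; rewrite sk in ik.
have iT : Ordinal ik \in T by rewrite mem_enum.
(* The factor of index at least [M] is moved to the front, so that its adjoint falls on [v]. *)
rewrite (perm_gs _ (h_comm m) _ _ (perm_to_rem iT)) /= form_gen ffunE.
rewrite low_words ?form0r //; exact: leq_ltn_trans (leq0n i) ik.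
Qed.

(** Expanding the differences only lowers exponents, so they stay below [n]; once sorted they belong
    to [nbox] or to [dbox], unless one is negative and the product is zero. *)
Lemma words_cover v : lspan words v ->
  exists a : seq nat -> C, nspan (v - \sum_(s <- dbox) a s *: gs T (toJ s)).
Proof.
apply: (lspan_min (V := [set v | exists a : seq nat -> C,
  nspan (v - \sum_(s <- dbox) a s *: gs T (toJ s))])).
  exact: (subsp_mod dbox (gs T \o toJ) nspan_subsp).
move=> _ [j [jn Dj ->]]; rewrite wordE.
have sV := subsp_mod dbox (gs T \o toJ) nspan_subsp.
apply: (dops_ind (P := fun v => exists a : seq nat -> C,
   nspan (v - \sum_(s <- dbox) a s *: gs T (toJ s)))).
  by move=> x y hx hy; apply: (subsp_sub sV).
move=> j' jj' sj'.
have [/fintype.forallP j'0|] := boolP [forall i, 0 <= j' i]; last first.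
  rewrite negb_forall => /fintype.existsP[x]; rewrite -ltNge => x0.
  rewrite (gs_lt0 _ _ _ (mem_enum _ x) x0); case: sV => h0 _; exact: h0.
have [s [sg sE] [sk ss sa ssum]] := toJ_sort j'0.
have -> : gs T j' = gs T (toJ s) by rewrite sE gs_pj.
have san : all (fun a => a < n)%N s.
  apply: sub_all sa => a /fintype.existsP[i /eqP ->].
  by have := jj' i; have := j'0 i; have /andP[_] := jn i; move: (j i) (j' i) => x y; lia.
have sbn : s \in box k n by rewrite mem_box sk eqxx ss.
have [hM|nM] := boolP (has (fun a => M <= a)%N s).
  exists (fun=> 0); rewrite big1 => [|s' _]; last by rewrite scale0r.
  rewrite subr0; apply: lspan_incl; exists s => //.
  by rewrite mem_filter hM.
apply: (mod_mem (gs T \o toJ)); [|exact: nspan_subsp|].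
  by rewrite filter_uniq // uniq_box.
rewrite mem_filter mem_box sk eqxx ss /=; apply/andP; split; last first.
  by apply/allP => a sa'; rewrite ltnNge; apply: contra nM => Ma; apply/hasP; exists a.
suff -> : (sumn s + m * (k * k.-1))%N = absz (\sum_i j i) by [].
move: ssum; rewrite sj' size_vpairs_enum.
by move: (\sum_i j i) (m * (k * k.-1))%N (sumn s) => x y z; lia.
Qed.

Lemma kapE i : kap (vpairs m T) i = (m * k.-1)%:Z.
Proof. by rewrite kap_vpairs ?enum_uniq // mem_enum mul1n size_enum_ord. Qed.

Lemma pjM (s1 s2 : {perm I}) j : pj s1 (pj s2 j) = pj (s1 * s2)%g j.
Proof. by apply/ffunP => i; rewrite !ffunE permM. Qed.

Lemma pjK (sg : {perm I}) : cancel (pj sg) (pj sg^-1%g).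
Proof. by move=> j; rewrite pjM mulVg; apply/ffunP => i; rewrite ffunE perm1. Qed.

Lemma words_free (x : seq nat -> C) :
  \sum_(s <- dbox) x s *: word (toJ s + kap (vpairs m T)) = 0 ->
  forall s, s \in dbox -> x s = 0.
Proof.
set kp := kap _ => x0.
have kps (sg : {perm I}) : pj sg kp = kp.
  by apply/ffunP => i; rewrite ffunE /kp !kapE.
have word_pj (sg : {perm I}) j : word (pj sg j) = word j.
  rewrite !wordE dops_vpairs_pj; congr (dops _ _ _).
  by apply/funext => j'; rewrite gs_pj.
(* Symmetrizing over all permutations meets the hypothesis of [words_indep]; as words are symmetric,
   it merely multiplies the given combination by the order of the group. *)
pose X := [seq (x s, pj sg (toJ s)) | s <- dbox, sg <- enum {perm I}].
have coefX nu : coef X nu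
    = \sum_(s <- dbox) \sum_(sg : {perm I}) x s *+ (pj sg (toJ s) == nu).
  rewrite /coef /X big_allpairs_dep; apply: eq_bigr => s _.
  by rewrite big_enum.
have Xsym (sg : {perm I}) nu : coef X (pj sg nu) = coef X nu.
  rewrite !coefX; apply: eq_bigr => s _; rewrite (reindex_inj (mulgI sg)) /=.
  by apply: eq_bigr => sg' _; rewrite -pjM (inj_eq (can_inj (pjK sg))).
have Xge q i : q \in X -> 0 <= q.2 i.
  by case/allpairsP => -[s1 sg1] [_ _ ->]; rewrite ffunE toJ_ge0.
have X0 : pair X (fun j => dops (vpairs (2 * m) T) (gs T) (j + kp)) = 0.
  rewrite /pair /X big_allpairs_dep.
  transitivity (\sum_(s <- dbox) #|{perm I}|%:R *: (x s *: word (toJ s + kp))).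
    apply: eq_bigr => s _; rewrite big_enum /= -sumr_const scaler_suml.
    apply: eq_bigr => sg _; rewrite scale1r -wordE -[in LHS](kps sg).
    rewrite -(word_pj sg (toJ s + kp)); congr (_ *: word _).
    by apply/ffunP => i; rewrite !ffunE.
  by rewrite -scaler_sumr x0 scaler0.
have {}X0 := words_indep m_gt0 Xsym Xge X0.
move=> s sB; have := X0 (toJ s); rewrite coefX.
(* Distinct decreasing sequences lie in distinct orbits, so only [s] itself contributes to the
   coefficient at [toJ s]. *)
have sortE s' sg : s' \in dbox -> pj sg (toJ s') = toJ s -> s' = s.
  move=> s'B E; move: sB s'B; rewrite !mem_filter !mem_box.
  move=> /andP[_ /and3P[/eqP sk ss _]] /andP[_ /and3P[/eqP s'k s's _]].
  apply: (sorted_eq (leT := geq)) => //.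
  - by move=> y z w /= zy wz; exact: leq_trans wz zy.
  - by move=> y z; rewrite /= -eqn_leq => /eqP.
  have mapE (r : seq nat) : size r = k -> r = [seq nth 0%N r (i : I) | i <- T].
    move=> rk; rewrite (map_comp (nth 0%N r) val) val_enum_ord -rk.
    by rewrite map_nth_iota0 // take_size.
  rewrite (mapE s sk) {1}(mapE s' s'k) perm_sym.
  have -> : [seq nth 0%N s (i : I) | i <- T]
      = [seq nth 0%N s' (i : I) | i <- [seq sg i | i <- T]].
    rewrite -[RHS]map_comp; apply: eq_map => i /=.
    by have := congr1 (fun f : J => f i) E; rewrite !ffunE => -[].
  exact/perm_map/perm_map_enum.
rewrite (bigD1_seq s) ?filter_uniq ?uniq_box //= [X in _ + X]big_seq_cond.
rewrite [X in _ + X]big1 ?addr0; last first.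
  move=> s' /andP[s'B /negbTE s's]; rewrite big1 // => sg _.
  by case: eqP => // /(sortE _ _ s'B) E; rewrite E eqxx in s's.
(* The coefficient is [x s] times the order of the stabilizer, which contains the identity. *)
rewrite sumrMnr => /eqP; rewrite mulrn_eq0 => /orP[|/eqP //].
rewrite sum_nat_eq0 => /fintype.forallP/(_ 1%g) /=.
suff -> : pj 1%g (toJ s) = toJ s by rewrite eqxx.
by apply/ffunP => i; rewrite ffunE perm1.
Qed.

Lemma has_dim_words : has_dim (lspan words) (size dbox).
Proof.
apply: (@has_dim_sandwich _ _ _ dbox _ nspan (gs T \o toJ)
  (fun s => word (toJ s + kap (vpairs m T)))).
- by rewrite filter_uniq ?uniq_box.
- exact: lspan_subsp.
- exact: nspan_subsp.
- move=> s sB; apply: lspan_incl; exists (toJ s + kap (vpairs m T)).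
  move: sB; rewrite mem_filter mem_box => /andP[Ds /and3P[/eqP sk _ /allP sM]].
  split=> // [i|].
    have := sM _ (mem_nth 0%N (_ : (i < size s)%N)); rewrite sk => /(_ (ltn_ord i)).
    rewrite ffunE kapE ffunE; move: (nth _ _ _) (m * k.-1)%N => a b.
    by move=> ab; apply/andP; split; lia.
  under eq_bigr do rewrite ffunE kapE.
  rewrite big_split /= sum_toJ // sumr_const card_ord pmulrn mulrzz.
  rewrite (_ : absz _ = sumn s + m * (k * k.-1))%N //.
  by rewrite -PoszM [(k * k.-1)%N]mulnC mulnA -PoszD.
- exact: words_cover.
- exact: words_nspan.
- exact: words_free.
Qed.

End Sector.

(** * The operator L_0 *)

Lemma lin_comb (K : fieldType) (E : lmodType K) (a b c : K) (x y z w : E) :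
  b *: (a *: x + y) - c *: (a *: z + w)
  = a *: (b *: x - c *: z) + (b *: y - c *: w).
Proof.
rewrite scalerBr !scalerDr !scalerA opprD (mulrC b) (mulrC c).
exact: addrACA.
Qed.

Section Virasoro.
Context (C : numClosedFieldType) (m : nat).
Local Notation F := (fock C).
Local Notation ket := (ket C).
Local Notation h := (heisL C m).
Local Notation alpha := (alpha C m).
Implicit Types (p : int) (A : {mset nat}%mset) (u v : F).

Definition nordL (t : int * int) : {linear F -> F} :=
  if t.1 <= t.2 then (h t.1 \o h t.2 : {linear F -> F})
  else (h t.2 \o h t.1 : {linear F -> F}).

Lemma nordE i j v : nord m i j v = nordL (i, j) v.
Proof. by rewrite /nord /nordL /=; case: ifP. Qed.

Lemma L0E v :
  L0 m v = 2^-1 *: (\sum_(t \in [set t : int * int | t.1 + t.2 = 0]) nordL t v)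
    - ((m%:R - 1) / alpha) *: h 0 v.
Proof.
rewrite /L0 (eq_fsbigr (fun t => nordL t v)) // => -[i j] _.
exact: nordE.
Qed.

Lemma h_zero p A : h 0 (ket p A) = degz C m p *: ket p A.
Proof. exact: heis_weight. Qed.

Lemma h_annihil n p A :
  h n.+1%:Z (ket p A) = (n.+1 * A n)%:R *: ket p (A `\ n)%mset.
Proof. exact: heis_annihil. Qed.

Lemma hZ i (a : C) v : h i (a *: v) = a *: h i v.
Proof. exact: linearZ. Qed.

Lemma h_minus_plus n p A :
  h (- n.+1%:Z) (h n.+1%:Z (ket p A)) = (n.+1 * A n)%:R *: ket p A.
Proof.
rewrite h_annihil hZ; have -> : - n.+1%:Z = Negz n by lia.
have [A0|An] := posnP (A n); first by rewrite A0 muln0 !scale0r.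
by rewrite h_create msetB1K // -mset_gt0.
Qed.

Lemma nordL_zero p A : nordL (0, 0) (ket p A) = (degz C m p ^+ 2) *: ket p A.
Proof.
rewrite /nordL lexx; change (h 0 (h 0 (ket p A)) = degz C m p ^+ 2 *: ket p A).
by rewrite h_zero hZ h_zero scalerA.
Qed.

Lemma nordL_pos n p A :
  nordL (n.+1%:Z, - n.+1%:Z) (ket p A) = (n.+1 * A n)%:R *: ket p A.
Proof. exact: h_minus_plus. Qed.

Lemma nordL_neg n p A :
  nordL (- n.+1%:Z, n.+1%:Z) (ket p A) = (n.+1 * A n)%:R *: ket p A.
Proof. exact: h_minus_plus. Qed.

(** The pairs (n, - n) and (- n, n) are ordered to the same product, which cancels the factor 1/2 of
    L_0. *)
Definition nord_support (B : nat) : seq (int * int) :=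
  (0, 0) :: [seq (n.+1%:Z, - n.+1%:Z) | n <- iota 0 B]
         ++ [seq (- n.+1%:Z, n.+1%:Z) | n <- iota 0 B].

Lemma mem_mset_wt A a : (0 < A a)%N -> (a < wt A)%N.
Proof.
rewrite mset_gt0 => aA; rewrite /wt (perm_big _ (perm_to_rem (_ : a \in enum_mset A))) //.
by rewrite big_cons leq_addr.
Qed.

Lemma nordL_out p A (B : nat) t : (wt A <= B)%N -> t.1 + t.2 = 0 ->
  t \notin nord_support B -> nordL t (ket p A) = 0.
Proof.
case: t => i j /= AB ij; have -> : j = - i by lia.
have eq0 n : (B <= n)%N -> (n.+1 * A n)%:R *: ket p A = 0.
  move=> Bn; suff -> : A n = 0%N by rewrite muln0 scale0r.
  by apply/eqP; rewrite -leqn0 leqNgt; apply/negP => /mem_mset_wt; lia.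
rewrite inE mem_cat !negb_or; case: i {ij} => [[|n]|n].
- by rewrite eqxx.
- move=> /and3P[_ h1 _]; rewrite nordL_pos eq0 // leqNgt; apply: contra h1 => nB.
  by apply: map_f; rewrite mem_iota.
- have -> : - Negz n = n.+1 by lia.
  have -> : Negz n = - n.+1%:Z by lia.
  move=> /and3P[_ _ h2]; rewrite nordL_neg eq0 // leqNgt; apply: contra h2 => nB.
  by apply: (map_f (fun n : nat => (- n.+1%:Z, n.+1%:Z))); rewrite mem_iota.
Qed.

Lemma nord_support_uniq B : uniq (nord_support B).
Proof.
rewrite /nord_support /= mem_cat negb_or cat_uniq.
rewrite !map_inj_uniq ?iota_uniq; last 2 first.
- by move=> x y []; lia.
- by move=> x y []; lia.
apply/and4P; split=> //.
  by apply/andP; split; apply/mapP => -[n _ []]; lia.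
by apply/hasPn => t /mapP[n _ ->]; apply/mapP => -[n' _ []]; lia.
Qed.

Lemma nord_supportP B t : t \in nord_support B -> t.1 + t.2 = 0.
Proof.
by rewrite inE mem_cat => /predU1P[-> //|/orP[]/mapP[n _ ->]] /=; lia.
Qed.

Lemma sum_nord_support (V : nmodType) (f : int * int -> V) B :
  \sum_(t <- nord_support B | t \in [set t : int * int | t.1 + t.2 = 0]) f t
  = f (0, 0) + (\sum_(n < B) f (n.+1%:Z, - n.+1%:Z)
                + \sum_(n < B) f (- n.+1%:Z, n.+1%:Z)).
Proof.
rewrite big_seq_cond (eq_bigl (fun t => t \in nord_support B)); last first.
  move=> t; apply: andb_idr => tB; apply/mem_set; exact: nord_supportP tB.
rewrite -big_seq big_cons big_cat !big_map /=.
rewrite -(big_mkord xpredT (fun n => f (n.+1%:Z, - n.+1%:Z))).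
by rewrite -(big_mkord xpredT (fun n => f (- n.+1%:Z, n.+1%:Z))) /index_iota subn0.
Qed.

Lemma L0_linear : linear (L0 m : F -> F).
Proof.
move=> a u v; rewrite !L0E fsum_linear; last first.
  by move=> p A; exists (nord_support (wt A)) => t t0; apply: nordL_out.
have -> : h 0 (a *: u + v) = a *: h 0 u + h 0 v by exact: linearP.
move: (h 0 u) (h 0 v) (\sum_(t \in _) nordL t u) (\sum_(t \in _) nordL t v) => z w x y.
exact: lin_comb.
Qed.

HB.instance Definition _ := GRing.isLinear.Build C F F _ (L0 m) L0_linear.

Lemma wt_sum A : wt A = (\sum_(n < wt A) n.+1 * A n)%N.
Proof.
rewrite {1}/wt (eq_big_seq (fun a =>
  \sum_(n < wt A) (n == a :> nat) * n.+1)%N); last first.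
  move=> a aA; have aw : (a < wt A)%N by apply: mem_mset_wt; rewrite mset_gt0.
  rewrite (bigD1 (Ordinal aw)) //= eqxx mul1n big1 ?addn0 // => n.
  by rewrite -val_eqE /= => /negbTE ->.
rewrite exchange_big; apply: eq_bigr => n _; rewrite -big_distrl /= mulnC.
congr (_ * _)%N; rewrite -count_mem_mset -sum1_count [RHS]big_mkcond.
by apply: eq_bigr => a _; rewrite eq_sym [pred1 _ _]/=; case: eqP.
Qed.

Hypothesis m_gt0 : (0 < m)%N.

Lemma L0_ket p A : L0 m (ket p A) = (degq C m p + (wt A)%:R) *: ket p A.
Proof.
have L0A A' : L0 m (ket p A') = (2^-1 * degz C m p ^+ 2
    - (m%:R - 1) / alpha * degz C m p + (wt A')%:R) *: ket p A'.
  rewrite L0E h_zero (fsbigE (nord_support (wt A'))) //; first last.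
  - by move=> t t0; apply: nordL_out.
  - by move=> t; exact: nord_supportP.
  - exact: nord_support_uniq.
  have E (f : nat -> F) : (forall n, f n = (n.+1 * A' n)%:R *: ket p A') ->
      \sum_(n < wt A') f n = (wt A')%:R *: ket p A'.
    move=> fE; have -> : (wt A')%:R = \sum_(n < wt A') (n.+1 * A' n)%:R :> C.
      by rewrite -natr_sum -wt_sum.
    rewrite scaler_suml.
    by apply: eq_bigr => n _; exact: fE.
  rewrite (sum_nord_support (fun t => nordL t (ket p A'))).
  rewrite (E (fun n => nordL (n.+1%:Z, - n.+1%:Z) (ket p A'))
             (fun n => nordL_pos n p A')).
  rewrite (nordL_zero p A').
  move: (ket p A') (wt A')%:R => e w.
  rewrite -!scalerDl !scalerA -scalerBl.
  by congr (_ *: _); have a0 := alpha_neq0 C m_gt0; field.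
(* The scalar part does not depend on [A], so it is read off from the vacuum, where [L0_vac] gives
   [degq]. *)
rewrite L0A; congr ((_ + _) *: _).
have := L0_vac C p m_gt0; rewrite [L0 m _]L0A wt0 addr0 => E.
have := congr1 (fun v : F => v@_((p, mset0) : fock_index)) E.
by rewrite !mcoeffZ ketE eqxx !mulr1.
Qed.

Lemma hom_eigen (f : {linear F -> F}) (c : C) p d v :
  (forall A, (wt A)%:Z = d -> f (ket p A) = c *: ket p A) -> hom p d v -> f v = c *: v.
Proof.
move=> fE hv; rewrite [v in LHS]fock_expand [v in RHS]fock_expand linear_sum scaler_sumr.
rewrite !big_seq; apply: eq_bigr => b; rewrite -mcoeff_neq0 => /hv[bp bd].
by rewrite linearZ /= bp (fE _ bd) scalerA mulrC -scalerA.
Qed.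

Lemma L0_hom p d v : hom p d v -> L0 m v = (degq C m p + d%:~R) *: v.
Proof.
apply: (hom_eigen (f := L0 m : {linear F -> F})) => A <-.
by rewrite -pmulrn; exact: L0_ket.
Qed.

Lemma h0_hom p d v : hom p d v -> h 0 v = degz C m p *: v.
Proof. by apply: (hom_eigen (f := h 0)) => A _; exact: h_zero. Qed.

End Virasoro.

(** * Counting *)

Section Counting.
Variable m : nat.
Hypothesis m_gt0 : (0 < m)%N.

Lemma size_boxSS k M : size (box k.+1 M.+1) = (size (box k.+1 M) + size (box k M.+1))%N.
Proof. by rewrite boxSS size_cat size_map. Qed.

Lemma size_box1 M : size (box 1 M) = M.
Proof. by elim: M => // M IH; rewrite size_boxSS IH box0 addn1. Qed.

(** Lengths above [n] contribute nothing, since then n <= m (k - 1) and no part is allowed. *)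
Definition fibsum (n : nat) : nat := (\sum_(k < n.+1) size (box k (n - m * k.-1)))%N.

Lemma size_box_gt n k : (n < k)%N -> size (box k (n - m * k.-1)) = 0%N.
Proof.
case: k => // k nk; rewrite /= (_ : (n - m * k)%N = 0%N) //.
apply/eqP; rewrite subn_eq0; apply: leq_trans (leq_pmull _ m_gt0).
by rewrite -ltnS.
Qed.

Lemma fibsum_widen n B : (n < B)%N ->
  fibsum n = (\sum_(k < B) size (box k (n - m * k.-1)))%N.
Proof.
move=> nB; rewrite /fibsum (big_ord_widen B (fun k => size (box k (n - m * k.-1)))) //.
rewrite big_mkcond; apply: eq_bigr => k _ /=; case: ifP => // /negbT.
by rewrite -leqNgt => nk; rewrite size_box_gt.
Qed.

Lemma fibsum_lt i : (i < m)%N -> fibsum i = i.+1.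
Proof.
move=> im; rewrite (@fibsum_widen _ i.+2) // !big_ord_recl big1 => [|k _].
  by rewrite addn0 [lift _ _]/= /bump muln0 subn0 size_box1.
rewrite /= (_ : (i - m * _)%N = 0%N) //; apply/eqP; rewrite subn_eq0.
by apply: leq_trans (ltnW im) _; rewrite leq_pmulr.
Qed.

(** Pascal's recursion on the box with k + 1 parts: lowering the bound by one gives the term of
    length k + 1 for i + m - 1, and fixing the largest part gives the term of length k for i,
    because (i + m) - m k = i - m (k - 1). *)
Lemma fibsum_rec i : fibsum (i + m) = (fibsum (i + m - 1) + fibsum i)%N.
Proof.
rewrite (@fibsum_widen _ (i + m).+1) // (@fibsum_widen (i + m - 1) (i + m).+1);
  last by lia.
rewrite (@fibsum_widen i (i + m)); last by lia.
rewrite 2!big_ord_recl -addnA -big_split; congr (_ + _)%N.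
apply: eq_bigr => j _; rewrite lift0 [_.+1.-1]/=; move: (nat_of_ord j) => k {j}.
(* Subtraction is truncated: when i + m <= m k, all three boxes are empty. *)
have [ik|ik] := leqP (i + m) (m * k).
  have -> : (i + m - m * k = 0)%N by lia.
  have -> : (i + m - 1 - m * k = 0)%N by lia.
  case: k ik => [|k] ik; first by lia.
  by have -> : (i - m * k.+1.-1 = 0)%N by move: ik; rewrite mulnS /=; lia.
have -> : (i + m - m * k = (i + m - 1 - m * k).+1)%N by lia.
rewrite size_boxSS; congr (_ + _)%N; case: k ik => [|k] ik; first by rewrite !box0.
rewrite mulnS in ik *; suff -> : (i + m - 1 - (m + m * k)).+1 = (i - m * k.+1.-1)%N by [].
by move: ik => /=; lia.
Qed.

Lemma fib_unique (F : nat -> nat) : (forall i, (i < m)%N -> F i = i.+1) ->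
  (forall i, F (i + m)%N = (F (i + m - 1) + F i)%N) -> F =1 fibsum.
Proof.
move=> F0 Frec; elim/ltn_ind => n IH; have [nm|mn] := ltnP n m.
  by rewrite F0 // fibsum_lt.
by rewrite -(subnK mn) Frec fibsum_rec !IH //; lia.
Qed.

Variable C : numClosedFieldType.

Definition boxpoly k M : {poly C} := \sum_(s <- box k M) 'X^(sumn s).

Lemma boxpolySS k M :
  boxpoly k.+1 M.+1 = boxpoly k.+1 M + 'X^M * boxpoly k M.+1.
Proof.
rewrite /boxpoly boxSS big_cat big_map mulr_sumr; congr (_ + _).
by apply: eq_bigr => s _; rewrite exprD.
Qed.

(** Double induction through the q-Pascal recursion [boxpolySS]; this product form is the one in
    which [gbinomE] characterizes the Gaussian binomial. *)
Lemma boxpoly_mul k N :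
  boxpoly k N.+1 * \prod_(1 <= j < k.+1) (1 - 'X^j)
  = \prod_(1 <= j < k.+1) (1 - 'X^(N + j)).
Proof.
elim: k N => [|k IHk] N; first by rewrite !big_nil mulr1 /boxpoly big_seq1.
elim: N => [|N IHN]; rewrite boxpolySS mulrDl.
  rewrite [boxpoly _ 0]big_nil mul0r add0r mul1r big_nat_recr //= mulrA IHk.
  by [].

rewrite IHN [\prod_(1 <= j < k.+2) (1 - 'X^j)]big_nat_recr //= mulrA.
rewrite -[X in _ + X * _]mulrA IHk [RHS]big_nat_recr //= [\prod_(1 <= j < k.+2) _]big_ltn // big_add1 /=.
rewrite (eq_bigr (fun j => 1 - 'X^(N.+1 + j))) => [|j _]; last by rewrite addnS addSn.
set P := \prod_(_ <= _ < _) _; rewrite addn1 exprD; ring.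
Qed.

(** With M = n - m (k - 1), the upper index is (M - 1) + k, as for partitions with k parts smaller
    than M. For k > 0 and M <= 0 it is below k, and the convention in [gbinom] agrees with the empty
    sum. *)
Lemma gbinom_box n k :
  gbinom C (n%:Z - (m%:Z - 1) * (k%:Z - 1)) k = boxpoly k (n - m * k.-1).
Proof.
have gE N : gbinom C (N + k)%:Z k = boxpoly k N.+1.
  have D0 : \prod_(1 <= j < k.+1) (1 - 'X^j) != 0 :> {poly C}.
    rewrite prodf_seq_neq0; apply/allP => j; rewrite mem_index_iota => /andP[j0 _] /=.
    apply/eqP => /(congr1 (fun q : {poly C} => q`_0)) /eqP.
    by rewrite coefB coef1 coefXn coef0 (ltn_eqF j0) subr0 oner_eq0.
  by apply: (mulIf D0); rewrite gbinomE boxpoly_mul.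
case: k gE => [|k] gE.
  have -> : n%:Z - (m%:Z - 1) * (0%:Z - 1) = (n + m.-1 + 0)%N by lia.
  by rewrite gE /boxpoly !box0.
rewrite /=; have -> : k.+1%:Z - 1 = k by lia.
have [nk|nk] := leqP n (m * k).
  rewrite /gbinom ifT; last by move: nk; lia.
  have -> : (n - m * k = 0)%N by lia.
  by rewrite /boxpoly big_nil.
have -> : (n - m * k = (n - m * k).-1.+1)%N by lia.
by rewrite -gE; congr (gbinom C _ _); lia.
Qed.

Lemma coef_boxpoly k M j : (boxpoly k M)`_j = (size [seq s <- box k M | sumn s == j])%:R.
Proof.
rewrite coef_sum size_filter -sum1_count natr_sum [RHS]big_mkcond.
by apply: eq_bigr => s _; rewrite coefXn eq_sym; case: eqP.
Qed.

End Counting.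

(** * Charge and degree decomposition *)

Section Grading.
Context (C : numClosedFieldType) (m : nat) (p : int) (n : nat).
Local Notation F := (fock C).
Local Notation ket := (ket C).
Local Notation h := (heisL C m).
Local Notation W k := (@words C m p k n).
Local Notation V := (Vsub C m p n).
Local Notation ch k := (p - (2 * m * k)%:Z).
Local Notation Wd k d := (W k (pred1 (d + m * (k * k.-1))%N)).
Implicit Types (k d : nat) (u v : F) (b : fock_index).

Hypothesis m_gt0 : (0 < m)%N.

Lemma Vsub_words : V = lspan [set v | exists k, W k predT v].
Proof.
rewrite /Vsub; congr lspan; apply/seteqP; split=> v /=.
  case=> s [sn ->]; exists (size s).
  pose j := [ffun i : 'I_(size s) => p - 1 - nth 0 s i].
  exists j; split=> // [i|].
    have := allP sn _ (mem_nth 0 (ltn_ord i)); rewrite ffunE.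
    by move: (nth _ _ _) => x; lia.
  transitivity (foldr (amode m) (vac C p) [seq p - 1 - j i | i <- enum 'I_(size s)]).
    congr (foldr _ _ _).
    rewrite (eq_map (g := fun i : 'I_(size s) => nth 0 s i)) => [|i].
      by rewrite (map_comp (nth 0 s) val) val_enum_ord map_nth_iota0 // take_size.
    by rewrite ffunE subKr.
  by rewrite foldr_map.
case=> k [j [jn _ ->]]; exists [seq p - 1 - j i | i <- enum 'I_k].
split; last by rewrite foldr_map.
by apply/allP => x /mapP[i _ ->]; have := jn i; move: (j i) => y; lia.
Qed.

Lemma word_hom k (j : {ffun 'I_k -> int}) :
  hom (ch k) (\sum_i j i - (m * (k * k.-1))%:Z) (word C m p (enum 'I_k) j).
Proof.
rewrite wordE //; apply: (dops_ind (P := hom _ _)) => [x y hx hy|j' _ E].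
  exact: (subsp_sub (hom_subsp _ _)).
by rewrite -(@size_vpairs_enum m) -E -big_enum; exact: hom_gs.
Qed.

Arguments word_hom {k} j [b] _.

Lemma words_hom k d v : lspan (Wd k d) v -> hom (ch k) d v.
Proof.
apply: (lspan_min (V := hom (ch k) d)); first exact: hom_subsp.
move=> _ [j [jn /eqP jd ->]]; have := word_hom j.
suff -> : \sum_i j i - (m * (k * k.-1))%:Z = d by [].
have : 0 <= \sum_i j i by apply: sumr_ge0 => i _; have /andP[] := jn i.
by move: jd; move: (\sum_i j i) (m * (k * k.-1))%N => x y; lia.
Qed.

Lemma words_Vsub k (D : pred nat) v : lspan (W k D) v -> V v.
Proof.
rewrite Vsub_words; apply: lspan_mono => _ [j [jn _ ->]].
by exists k, j.
Qed.

Definition projL (c d : int) : {linear F -> F} :=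
  lin_ext (fun b => ((b.1 == c) && ((wt b.2)%:Z == d))%:R *: ket b.1 b.2).

Lemma projL_hom c d q e v : hom q e v -> projL c d v = ((q == c) && (e == d))%:R *: v.
Proof. by apply: (hom_eigen (f := projL c d)) => A <-; exact: lin_ext_ket. Qed.

Lemma diag_coef (f : {linear F -> F}) (g : fock_index -> C) v b :
  (forall q A, f (ket q A) = g (q, A) *: ket q A) -> (f v)@_b = g b * v@_b.
Proof.
move=> fE; rewrite [v in LHS]fock_expand [v in RHS]fock_expand linear_sum !raddf_sum.
rewrite mulr_sumr; apply: eq_bigr => b' _; rewrite linearZ /= fE.
rewrite !mcoeffZ ketE mulrCA -surjective_pairing.
by case: eqP => [->|]; rewrite ?mulr0.
Qed.

Lemma degz_inj : injective (degz C m).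
Proof.
move=> x y /eqP; rewrite /degz (inj_eq (mulIf _)) ?invr_eq0 ?alpha_neq0 //.
by rewrite eqr_opp eqr_int => /eqP.
Qed.

Lemma joint_support x y v b : joint_eigenspace m V x y v -> v@_b != 0 ->
  degz C m b.1 = x /\ degq C m b.1 + (wt b.2)%:R = y.
Proof.
case=> _ hx hy bv; split; apply: (mulIf bv).
  rewrite -(diag_coef (f := h 0) (g := fun b => degz C m b.1)); last exact: h_zero.
  by rewrite -mcoeffZ -hx.
rewrite -(diag_coef (f := L0 m : {linear F -> F})
  (g := fun b => degq C m b.1 + (wt b.2)%:R)).
  by rewrite -mcoeffZ -hy.
by move=> q A; exact: L0_ket.
Qed.

(** Words are homogeneous, so projecting a combination of words onto one charge and degree keeps
    some of them and kills the others. *)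
Lemma Vsub_hom_words k d v : V v -> hom (ch k) d v -> lspan (Wd k d) v.
Proof.
move=> Vv hv; have <- : projL (ch k) d v = v by rewrite (projL_hom _ _ hv) !eqxx scale1r.
move: Vv; rewrite Vsub_words.
apply: (lspan_min (V := [set v | lspan (Wd k d) (projL (ch k) d v)])).
  have [s0 sl] := lspan_subsp (Wd k d).
  split=> [|a u w /= hu hw]; rewrite /= ?linear0 //.
  by rewrite linearP; apply: sl.
move=> _ [k' [j [jn _ ->]]] /=; rewrite (projL_hom _ _ (word_hom j)).
case: andP => [[/eqP kk /eqP jd]|_]; last by rewrite scale0r; exact: lspan0.
rewrite scale1r; apply: lspan_incl.
have {}kk : k' = k.
  have /eqP : (2 * m * k')%N = (2 * m * k)%N by move: kk; lia.
  by rewrite eqn_pmul2l ?muln_gt0 // => /eqP.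
subst k'; exists j; split=> //=; apply/eqP; move: jd.
by move: (\sum_i j i) (m * (k * k.-1))%N => x y; lia.
Qed.

Lemma joint_words k d v :
  joint_eigenspace m V (degz C m (ch k)) (degq C m (ch k) + d%:R) v
  <-> lspan (Wd k d) v.
Proof.
split=> [jv|wv]; last first.
  have hv := words_hom wv; split; first exact: words_Vsub wv.
    exact: h0_hom hv.
  by rewrite (L0_hom m_gt0 hv) -pmulrn.
have [Vv _ _] := jv; apply: Vsub_hom_words => // b bv.
have [E1 E2] := joint_support jv bv; have E := degz_inj E1; split=> //.
by move: E2; rewrite E => /addrI /eqP; rewrite eqr_nat => /eqP ->.
Qed.

Lemma charge_subsp (Q : int -> Prop) : subsp [set v : F | forall b, v@_b != 0 -> Q b.1].
Proof.
split=> [b|a u w hu hw b]; first by rewrite mcoeff0 eqxx.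
rewrite mcoeffD mcoeffZ; have [->|/hu//] := eqVneq u@_b 0.
by rewrite mulr0 add0r; exact: hw.
Qed.

Lemma span_charge (S : set F) (Q : int -> Prop) v b :
  (forall u, S u -> exists k (D : pred nat), W k D u /\ Q (ch k)) ->
  lspan S v -> v@_b != 0 -> Q b.1.
Proof.
move=> SQ Sv; move: Sv b.
apply: (lspan_min (V := [set v : F | forall b, v@_b != 0 -> Q b.1])).
  exact: charge_subsp.
by move=> _ /SQ[k [D [[j [_ _ ->]] Qk]]] b /(word_hom j)[->].
Qed.

(** This locates all pairs of eigenvalues that occur; elsewhere the character has coefficient
    zero. *)
Lemma joint_nonzero x y v : joint_eigenspace m V x y v -> v != 0 ->
  exists k d, x = degz C m (ch k) /\ y = degq C m (ch k) + d%:R.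
Proof.
move=> jv v0; have [b bv] : exists b, v@_b != 0.
  apply: contrapT => nb; move/eqP: v0; apply; apply/malgP => b.
  by rewrite mcoeff0; apply: contrapT => /eqP bv; apply: nb; exists b.
have [Vv _ _] := jv; have [k bk] : exists k, b.1 = ch k.
  rewrite Vsub_words in Vv.
  apply: (span_charge (Q := fun c => exists k, c = ch k) _ Vv bv) => u [k Wu].
  by exists k, predT; split=> //; exists k.
by exists k, (wt b.2); have [<- <-] := joint_support jv bv; rewrite bk.
Qed.

Lemma Vsub_stable (f : {linear F -> F}) :
  (forall q e v, hom q e v -> exists c, f v = c *: v) -> stable f V.
Proof.
move=> fE v; rewrite Vsub_words.
have [s0 sl] := lspan_subsp [set v | exists k, W k predT v].
apply: (lspan_min (V := [set v | lspan [set v | exists k, W k predT v] (f v)])).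
  split=> [|a u w /= hu hw]; rewrite /= ?linear0 // linearP; exact: sl.
move=> _ [k [j [jn _ ->]]] /=; have [c ->] := fE _ _ _ (word_hom j).
by apply: subsp_scale; [exact: lspan_subsp | apply: lspan_incl; exists k, j].
Qed.

Lemma Vsub_joint : V `<=` lspan [set v | exists x y, joint_eigenspace m V x y v].
Proof.
move=> v; rewrite {1}Vsub_words; apply: lspan_mono => _ [k [j [jn _ ->]]].
have hw := word_hom j; set w := word _ _ _ _ _ in hw *.
exists (degz C m (ch k)), (degq C m (ch k) + (\sum_i j i - (m * (k * k.-1))%:Z)%:~R).
split; [|exact: h0_hom hw|exact: L0_hom hw].
by apply: (@words_Vsub k predT); apply: lspan_incl; exists j.
Qed.

Lemma has_dim_joint k d :
  has_dim (joint_eigenspace m V (degz C m (ch k)) (degq C m (ch k) + d%:R))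
    (size [seq s <- box k (n - m * k.-1) | sumn s == d]).
Proof.
apply: (has_dim_ext (V := lspan (Wd k d))).
  by move=> v; split; move/joint_words.
have := @has_dim_words C m p k n (pred1 (d + m * (k * k.-1))%N) m_gt0.
by rewrite /dbox (eq_filter (a2 := fun s => sumn s == d)) // => s; rewrite /= eqn_add2r.
Qed.

Lemma has_dim0_eq0 v (U : set F) : has_dim U 0 -> U v -> v = 0.
Proof. by case=> b [_ _ gen] /gen[c ->]; rewrite big_ord0. Qed.

(** The box of such a length is empty, so the dimension count itself makes these words vanish; the
    whole space is then a finite sum of sectors. *)
Lemma words_gt_eq0 k v : (n < k)%N -> W k predT v -> v = 0.
Proof.
move=> nk /(@lspan_incl C F) Wv; apply: (has_dim0_eq0 (U := lspan (W k predT))) => //.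
have := @has_dim_words C m p k n predT m_gt0.
by rewrite /dbox filter_predT size_box_gt.
Qed.

Definition lowsec K : set F := lspan [set v | exists2 k, (k < K)%N & W k predT v].

(** Words of different lengths have different charges, so the sectors form a direct sum. *)
Lemma has_dim_lowsec K :
  has_dim (lowsec K) (\sum_(k < K) size (box k (n - m * k.-1)))%N.
Proof.
elim: K => [|K IH].
  rewrite big_ord0; apply: has_dim0 => v; split=> [|->]; last exact: lspan0.
  by case=> [[|r] [c [w [hw ->]]]]; [rewrite big_ord0 | have [] := hw ord0].
have hK := @has_dim_words C m p K n predT m_gt0; rewrite /dbox filter_predT in hK.
rewrite big_ord_recr; apply: has_dim_add IH hK.
- exact: lspan_subsp.
- exact: lspan_subsp.
- move=> v; split.
    apply: (lspan_min (V := [set v | exists v1 v2,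
      [/\ lowsec K v1, lspan (W K predT) v2 & v = v1 + v2]])).
      have [s0 sl] := lspan_subsp [set v : F | exists2 k, (k < K)%N & W k predT v].
      have [t0 tl] := lspan_subsp (W K predT).
      split=> [|a _ _ [u1 [u2 [hu1 hu2 ->]]] [w1 [w2 [hw1 hw2 ->]]]].
        by exists 0, 0; rewrite addr0.
      exists (a *: u1 + w1), (a *: u2 + w2); split; [exact: sl | exact: tl |].
      by rewrite scalerDr addrACA.
    move=> w [k]; rewrite ltnS leq_eqVlt => /predU1P[->|kK] Ww.
      by exists 0, w; rewrite add0r; split=> //; [exact: lspan0 | exact: lspan_incl].
    exists w, 0; rewrite addr0; split=> //; last exact: lspan0.
    by apply: lspan_incl; exists k.
  move=> [v1 [v2 [h1 h2 ->]]]; apply: subsp_add; first exact: lspan_subsp.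
    by apply: lspan_mono h1 => u [k kK Wu]; exists k => //; exact: ltnW.
  by apply: lspan_mono h2 => u Wu; exists K.
- move=> v h1 h2; apply/malgP => b; rewrite mcoeff0; apply/eqP/negPn/negP => bv.
  have bK : b.1 = ch K.
    apply: (span_charge (Q := fun c => c = ch K) _ h2 bv) => u Wu.
    by exists K, predT.
  have : exists2 k, (k < K)%N & b.1 = ch k.
    apply: (span_charge (Q := fun c => exists2 k, (k < K)%N & c = ch k) _ h1 bv).
    by move=> u [k kK Wu]; exists k, predT; split=> //; exists k.
  rewrite bK => -[k kK].
  have : (2 * m * k < 2 * m * K)%N by rewrite ltn_pmul2l ?muln_gt0.
  by move: (2 * m * k)%N (2 * m * K)%N => x y; lia.
Qed.

Lemma has_dim_Vsub : has_dim V (fibsum m n).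
Proof.
apply: has_dim_ext (has_dim_lowsec n.+1) => v; rewrite Vsub_words.
split; first by apply: lspan_mono => u [k _ Wu]; exists k.
apply: (lspan_min (V := lowsec n.+1)); first exact: lspan_subsp.
move=> u [k Wu]; have [kn|nk] := ltnP k n.+1.
  by apply: lspan_incl; exists k.
by rewrite (words_gt_eq0 nk Wu); exact: lspan0.
Qed.

End Grading.

(** * The character *)

Section Character.
Context (C : numClosedFieldType) (m : nat).
Hypothesis m_gt0 : (0 < m)%N.
Local Notation alpha := (alpha C m).

Lemma degz_shift (p : int) (k : nat) :
  degz C m (p - (2 * m * k)%:Z) = degz C m p + k%:R * alpha.
Proof.
rewrite /degz rmorphB /= -pmulrn natrM -(alpha_sqr C m).
by have a0 := alpha_neq0 C m_gt0; field.
Qed.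

Lemma qseries_nat (P : {poly C}) (d : nat) : qseries P 0 d%:R = P`_d.
Proof.
rewrite /qseries eqxx; have [dP|Pd] := ltnP d (size P).
  rewrite (bigD1 (Ordinal dP)) //= eqxx mulr1 big1 ?addr0 // => j.
  by rewrite -val_eqE /= eqr_nat eq_sym => /negbTE ->; rewrite mulr0.
rewrite (nth_default _ Pd) big1 // => j _; rewrite eqr_nat gtn_eqF ?mulr0 //.
exact: leq_trans (ltn_ord j) Pd.
Qed.

Lemma qseries_eq0 (P : {poly C}) x y :
  (x = 0 -> forall d : nat, y <> d%:R) -> qseries P x y = 0.
Proof.
move=> xy; rewrite /qseries big1 // => j _.
case: eqP => [/xy yn|_]; last by rewrite mulr0.
by case: eqP => [/yn//|_]; rewrite mulr0.
Qed.

Lemma fsbig_single (f : nat -> C) k :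
  (forall k', k' != k -> f k' = 0) -> \sum_(k \in [set: nat]) f k = f k.
Proof.
move=> f0; rewrite (fsbigE [:: k]) //=; last by move=> k' _; rewrite inE => /f0.
by rewrite big_mkcond big_seq1 in_setT.
Qed.

Lemma has_char_Vsub (p : nat) :
  has_char m (Vsub C m p%:Z p)
    (zqshift (degz C m p%:Z) 0 (fun x y => \sum_(k \in [set: nat])
       zqshift (k%:R * alpha) (degq C m (p%:Z - 2 * k%:Z * m%:Z))
         (qseries (gbinom C (p%:Z - (m%:Z - 1) * (k%:Z - 1)) k)) x y)).
Proof.
have chE k : p%:Z - 2 * k%:Z * m%:Z = p%:Z - (2 * m * k)%:Z.
  by rewrite !PoszM mulrAC.
split.
- apply: (Vsub_stable m_gt0 (f := heisL C m 0)) => q e v hv.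
  by exists (degz C m q); exact: h0_hom hv.
- apply: (Vsub_stable m_gt0 (f := L0 m : {linear fock C -> fock C})) => q e v hv.
  by exists (degq C m q + e%:~R); exact: L0_hom hv.
- exact: Vsub_joint.
move=> x y.
(* At a pair of eigenvalues of a sector, the z-exponent singles out one [k] in the sum; at all other
   pairs both sides are zero. *)
have [[k [d [-> ->]]]|no] := pselect (exists k d : nat,
    x = degz C m (p%:Z - (2 * m * k)%:Z) /\ y = degq C m (p%:Z - (2 * m * k)%:Z) + d%:R).
  eexists; first exact: has_dim_joint.
  rewrite /zqshift degz_shift addrAC subrr add0r subr0 (fsbig_single (k := k)).
    by rewrite subrr chE addrAC subrr add0r qseries_nat gbinom_box // coef_boxpoly.
  move=> k' kk; apply: qseries_eq0 => /eqP.
  rewrite -mulrBl mulf_eq0 (negbTE (alpha_neq0 C m_gt0)) orbF subr_eq0 eqr_nat eq_sym.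
  by rewrite (negbTE kk).
exists 0%N.
  apply: has_dim0 => v; split=> [jv|->].
    by apply: contrapT => /eqP v0; apply: no; exact: (joint_nonzero m_gt0 jv v0).
  split; rewrite ?scaler0; [exact: lspan0 | exact: (linear0 (heisL C m 0)) |].
  exact: (linear0 (L0 m : {linear fock C -> fock C})).
rewrite /zqshift fsbig1 // => k _; apply: qseries_eq0 => E d E'; apply: no.
exists k, d; rewrite degz_shift -E' chE; split; last by ring.
by apply/eqP; rewrite -subr_eq0 opprD addrA E.
Qed.

End Character.

Theorem proposition3p1 (R : realType) (m : nat) (hm : (1 <= m)%N) :
  (forall p : nat, (0 < p)%N ->
     has_char m (Vsub R[i] m p%:Z p)
       (zqshift (degz R[i] m p%:Z) 0
          (fun x y : R[i] =>
             \sum_(k \in [set: nat])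
               zqshift (k%:R * alpha R[i] m)
                 (degq R[i] m (p%:Z - 2 * k%:Z * m%:Z))
                 (qseries (gbinom R[i] (p%:Z - (m%:Z - 1) * (k%:Z - 1)) k))
                 x y)))
  /\
  (forall F : nat -> nat,
     (forall i : nat, (i < m)%N -> F i = i.+1) ->
     (forall i : nat, F (i + m)%N = (F (i + m - 1) + F i)%N) ->
     forall (p : int) (n : nat), has_dim (Vsub R[i] m p n) (F n)).
Proof.
split=> [p _|F F0 Frec p n]; first exact: has_char_Vsub.
by rewrite (fib_unique hm F0 Frec); exact: has_dim_Vsub.
Qed.
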